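(* Let $M=(M_s)_{s\in\mathbb{N}}$ be a sequence of positive real numbers satisfying (H1) $M_{\ell}^{s-k}<M_{k}^{s-\ell}M_{s}^{\ell-k}$ for all $s>\ell>k$ in $\mathbb{N}$; (H2) $\lim_{s\to\infty}s^{-1}\ln(M_{s+1}/M_s)=0$. Let $r>0$, $\tau>1$ and $\gamma>0$. Then there exists $\varepsilon_*=\varepsilon_*(\gamma,\tau,r,M)>0$, depending only on $\gamma,\tau,r,M$, such that for every $\alpha\in\mathbb{R}\setminus\mathbb{Q}$ and every $A\in U_r^M(\mathbb{T},SL(2,\mathbb{R}))$: if $\|A-R\|_{M,r}\le\varepsilon_*$ for some $R\in SO(2,\mathbb{R})$, and the fibered rotation number $\rho_f=\rho(\alpha,A)$ satisfies $$\|k\alpha\pm2\rho_f\|_{\mathbb{Z}}\ge\gamma\langle k\rangle^{-\tau}\quad\text{for all }k\in\mathbb{Z},\qquad \langle k\rangle=\max\{1,|k|\},$$ then $(\alpha,A)$ is $C^\infty$ rotations reducible.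
   Context: $\mathbb{T}=\mathbb{R}/\mathbb{Z}$, $\mathbb{N}=\{0,1,2,\dots\}$, $\|x\|_{\mathbb{Z}}=\inf_{j\in\mathbb{Z}}|x-j|$. $\|f\|_{M,r}=c\sup_{s\in\mathbb{N}}\big((1+s)^2r^s\|D_\theta^sf\|_{C^0}M_s^{-1}\big)$ with $c=4\pi^2/3$; $U_r^M(\mathbb{T},* )$ is the set of $*$-valued smooth functions on $\mathbb{T}$ with $\|f\|_{M,r}<\infty$. A cocycle $(\alpha,A)$ is the map $(\theta,w)\mapsto(\theta+\alpha,A(\theta)w)$ on $\mathbb{T}\times\mathbb{R}^2$. It is $C^\infty$ rotations reducible if there exist $B\in C^\infty(\mathbb{T},PSL(2,\mathbb{R}))$ and $C\in C^\infty(\mathbb{T},SO(2,\mathbb{R}))$ with $B(\cdot+\alpha)A(\cdot)B(\cdot)^{-1}=C(\cdot)$ (equality in $PSL(2,\mathbb{R})$). Fibered rotation number: if $A\in C^0(\mathbb{T},SL(2,\mathbb{R}))$ is homotopic to the identity, there are continuous $\psi:\mathbb{T}\times\mathbb{T}\to\mathbb{R}$ and $u:\mathbb{T}\times\mathbb{T}\to\mathbb{R}^+$ with $A(x)\binom{\cos2\pi y}{\sin2\pi y}=u(x,y)\binom{\cos2\pi(y+\psi(x,y))}{\sin2\pi(y+\psi(x,y))}$. For any probability measure $\mu$ on $\mathbb{T}\times\mathbb{T}$ invariant under $(x,y)\mapsto(x+\alpha,y+\psi(x,y))$ and projecting to Lebesgue measure on the first coordinate, $\rho(\alpha,A)=\int\psi\,d\mu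 \bmod \mathbb{Z}$; this does not depend on the choices of $\psi,\mu$. *)

(* Defs.v *)
From HB Require Import structures.
From mathcomp Require Import all_boot all_order all_algebra.
From mathcomp Require Import generic_quotient ring_quotient.
From mathcomp Require Import all_classical all_reals all_analysis.
Set Implicit Arguments.
Unset Strict Implicit.
Unset Printing Implicit Defensive.
Import Order.TTheory GRing.Theory Num.Theory.
Import numFieldNormedType.Exports.
Local Open Scope classical_set_scope.
Local Open Scope quotient_scope.
Local Open Scope ring_scope.

(* R/Z with the quotient group law, the quotient topology and its Borel sets.
   [Num.int_num_subdef] is the predicate underlying the qualifier [Num.int]. *)
Section Circle.
Variable R : realType.

Definition RmodZ : Type :=
  Quotient.quot (GRing.ZmodClosed.clone R (@Num.int_num_subdef R) _).
HB.instance Definition _ := Quotient.on RmodZ.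
HB.instance Definition _ := GRing.Zmodule.on RmodZ.

Definition circle : Type := quotient_topology RmodZ.
HB.instance Definition _ := Quotient.on circle.
HB.instance Definition _ := Topological.on circle.
HB.instance Definition _ := GRing.Zmodule.copy circle RmodZ.
HB.instance Definition _ := isPointed.Build circle (0 : circle).

Definition toT (x : R) : circle := \pi_circle x.

Lemma toTD (x y : R) : toT (x + y) = toT x + toT y.
Proof. exact: Quotient.pi_add. Qed.

Lemma toT_eq (x y : R) : toT x = toT y <-> x - y \is a Num.int.
Proof.
rewrite -[X in _ <-> is_true X]/(x - y \in
  GRing.ZmodClosed.clone R (@Num.int_num_subdef R) _).
by rewrite Quotient.idealrBE; split=> [h|/eqP//]; apply/eqP.
Qed.

Lemma toT_continuous : continuous toT.
Proof. exact: pi_continuous. Qed.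

Lemma toT_surj (x : circle) : exists y : R, toT y = x.
Proof. by exists (repr x); rewrite /toT reprK. Qed.

Definition borel_torus2 : Type :=
  g_sigma_algebraType (@open (circle * circle)%type).

Definition circle_lebesgue (E : set circle) : \bar R :=
  lebesgue_measure (`[0, 1[%classic `&` toT @^-1` E).

End Circle.

Section SL2.
Variable R : realType.

Record SL2 := MkSL2 { SL2_val :> 'M[R]_2; _ : \det SL2_val == 1 }.
HB.instance Definition _ := [isSub for SL2_val].
HB.instance Definition _ := [Choice of SL2 by <:].

Implicit Types A B : SL2.

Lemma SL2_det A : \det A = 1. Proof. by case: A => A /= /eqP. Qed.

Lemma SL2_unit A : (A : 'M[R]_2) \in unitmx.
Proof. by rewrite unitmxE SL2_det unitr1. Qed.

Fact SL2_one_subproof : \det (1%:M : 'M[R]_2) == 1.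
Proof. by rewrite det1. Qed.
Fact SL2_mul_subproof A B : \det (A *m B) == 1.
Proof. by rewrite det_mulmx !SL2_det mulr1. Qed.
Fact SL2_inv_subproof A : \det (invmx A) == 1.
Proof. by rewrite det_inv SL2_det invr1. Qed.

Definition SL2_one := MkSL2 SL2_one_subproof.
Definition SL2_mul A B := MkSL2 (SL2_mul_subproof A B).
Definition SL2_inv A := MkSL2 (SL2_inv_subproof A).

Fact SL2_mulA : associative SL2_mul.
Proof. by move=> A B C; apply: val_inj; rewrite /= mulmxA. Qed.
Fact SL2_mul1 : left_id SL2_one SL2_mul.
Proof. by move=> A; apply: val_inj; rewrite /= mul1mx. Qed.
Fact SL2_1mul : right_id SL2_one SL2_mul.
Proof. by move=> A; apply: val_inj; rewrite /= mulmx1. Qed.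
Fact SL2_mulV : left_inverse SL2_one SL2_inv SL2_mul.
Proof. by move=> A; apply: val_inj; rewrite /= mulVmx ?SL2_unit. Qed.
Fact SL2_Vmul : right_inverse SL2_one SL2_inv SL2_mul.
Proof. by move=> A; apply: val_inj; rewrite /= mulmxV ?SL2_unit. Qed.
HB.instance Definition _ :=
  isGroup.Build SL2 SL2_mulA SL2_mul1 SL2_1mul SL2_mulV SL2_Vmul.

Definition SO2 : set SL2 := [set A | (A : 'M[R]_2) *m A^T = 1%:M].

(* PSL(2,R) = SL(2,R) / {1, -1} *)
Definition SL2_pm A B := (A == B) || ((A : 'M[R]_2) == - (B : 'M[R]_2)).

Fact SL2_pm_equiv : equiv_class_of SL2_pm.
Proof.
split=> [A|A B|B A C]; rewrite /SL2_pm.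
- by rewrite eqxx.
- by rewrite eq_sym; congr (_ || _); rewrite -eqr_oppLR eq_sym.
- case/orP=> /eqP AB /orP[] /eqP BC; rewrite -?AB -?BC ?AB ?BC ?eqxx ?orbT //.
  by rewrite -val_eqE /= AB BC opprK eqxx.
Qed.
Canonical SL2_pm_rel := EquivRelPack SL2_pm_equiv.
Canonical SL2_pm_encModRel := defaultEncModRel SL2_pm.

Definition PSL2 : Type := {eq_quot SL2_pm}.
HB.instance Definition _ := EqQuotient.on PSL2.
HB.instance Definition _ := Choice.on PSL2.

Definition toPSL (A : SL2) : PSL2 := \pi_PSL2 A.

Definition PSL2_one : PSL2 := toPSL 1%g.
Definition PSL2_mul (a b : PSL2) : PSL2 := toPSL (repr a * repr b)%g.
Definition PSL2_inv (a : PSL2) : PSL2 := toPSL (repr a)^-1%g.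

Lemma toPSL_eq A B :
  toPSL A = toPSL B <-> A = B \/ (A : 'M[R]_2) = - (B : 'M[R]_2).
Proof.
rewrite /toPSL; split=> [/eqP|h].
  by rewrite piE => /orP[] /eqP; [left|right].
by apply/eqP; rewrite piE; apply/orP; case: h => ->; rewrite eqxx; [left|right].
Qed.

Lemma repr_toPSL A :
  repr (toPSL A) = A \/ (repr (toPSL A) : 'M[R]_2) = - (A : 'M[R]_2).
Proof. by apply/toPSL_eq; rewrite /toPSL reprK. Qed.

Lemma toPSLM A B : toPSL (A * B)%g = PSL2_mul (toPSL A) (toPSL B).
Proof.
apply/esym/toPSL_eq; case: (repr_toPSL A) => hA; case: (repr_toPSL B) => hB.
- by left; rewrite hA hB.
- by right; rewrite /= hA hB mulmxN.
- by right; rewrite /= hA hB mulNmx.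
- by left; apply: val_inj; rewrite /= hA hB mulmxN mulNmx opprK.
Qed.

Lemma toPSLV A : toPSL A^-1%g = PSL2_inv (toPSL A).
Proof.
apply/esym/toPSL_eq; case: (repr_toPSL A) => hA; first by left; rewrite hA.
right; rewrite /= hA -scaleN1r invmxZ.
  by rewrite invrN invr1 scaleN1r.
by rewrite unitmxZ ?SL2_unit ?unitrN1.
Qed.

Fact PSL2_mulA : associative PSL2_mul.
Proof.
move=> a b c; rewrite -[a]reprK -[b]reprK -[c]reprK -!/(toPSL _).
by rewrite -!toPSLM mulgA.
Qed.
Fact PSL2_mul1 : left_id PSL2_one PSL2_mul.
Proof. by move=> a; rewrite -[a]reprK -/(toPSL _) -toPSLM mul1g. Qed.
Fact PSL2_1mul : right_id PSL2_one PSL2_mul.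
Proof. by move=> a; rewrite -[a]reprK -/(toPSL _) -toPSLM mulg1. Qed.
Fact PSL2_mulV : left_inverse PSL2_one PSL2_inv PSL2_mul.
Proof. by move=> a; rewrite -[a]reprK -/(toPSL _) -toPSLV -toPSLM mulVg. Qed.
Fact PSL2_Vmul : right_inverse PSL2_one PSL2_inv PSL2_mul.
Proof. by move=> a; rewrite -[a]reprK -/(toPSL _) -toPSLV -toPSLM mulgV. Qed.
HB.instance Definition _ :=
  isGroup.Build PSL2 PSL2_mulA PSL2_mul1 PSL2_1mul PSL2_mulV PSL2_Vmul.
End SL2.

Section Functions.
Variable R : realType.
Implicit Types (V : normedModType R) (M : nat -> R) (r : R).

(* Functions on the circle are differentiated through their 1-periodic lifts. *)
Definition smoothT V (f : circle R -> V) : Prop :=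
  forall n x, derivable (derive1n n (f \o @toT R)) x 1.

Definition C0_norm V (g : R -> V) : \bar R :=
  ereal_sup [set (`|g x|)%:E | x in [set: R]].

(* For matrix-valued [f], [`| |] is the max norm on the entries. *)
Definition norm_Mr M r V (f : circle R -> V) : \bar R :=
  (((4 * pi ^+ 2) / 3)%:E *
   ereal_sup [set (((1 + s%:R) ^+ 2 * r ^+ s)%:E *
                   C0_norm (derive1n s (f \o @toT R)) * ((M s)^-1)%:E)%E
             | s in [set: nat]])%E.

Definition U_Mr M r V : set (circle R -> V) :=
  [set f | smoothT f /\ (norm_Mr M r f < +oo)%E].

Definition mx_of (A : circle R -> SL2 R) : circle R -> 'M[R]_2 :=
  fun x => A x.

(* SL2 -> PSL2 is a two-sheeted covering: a PSL2-valued map is smooth iff it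
   has smooth local lifts to SL2. *)
Definition smooth_PSL (B : circle R -> PSL2 R) : Prop :=
  forall x : R, exists b : R -> SL2 R, \forall y \near x,
    B (toT y) = toPSL (b y) /\
    forall n, derivable (derive1n n (fun z => b z : 'M[R]_2)) y 1.

Definition rotations_reducible (alpha : R) (A : circle R -> SL2 R) : Prop :=
  exists (B : circle R -> PSL2 R) (C : circle R -> SL2 R),
    [/\ smooth_PSL B, smoothT (mx_of C), forall x, SO2 (C x) &
        forall x, (B (x + toT alpha) * toPSL (A x) * (B x)^-1)%g
                  = toPSL (C x)].

Definition dir (y : R) : 'cV[R]_2 :=
  \col_(i < 2) if i == 0 then cos (2 * pi * y) else sin (2 * pi * y).

(* [rho] = rho(alpha, A). As the value is independent of [psi], [u] and [mu],
   it is rendered as a relation; for continuous [A],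
   such [psi] and [u] exist precisely when [A] is homotopic to the identity. *)
Definition fibered_rotation_number (alpha : R) (A : circle R -> SL2 R)
    (rho : circle R) : Prop :=
  exists (psi u : circle R * circle R -> R)
         (mu : probability (borel_torus2 R) R),
    [/\ continuous psi, continuous u /\ (forall z, 0 < u z),
        (forall (x : circle R) (y : R),
           A x *m dir y = u (x, toT y) *: dir (y + psi (x, toT y))),
        (forall E : set (borel_torus2 R), measurable E ->
           mu ((fun z : circle R * circle R =>
                  (z.1 + toT alpha, z.2 + toT (psi z))) @^-1` E) = mu E) /\
        (forall E : set (circle R), <<s @open (circle R) >> E ->
           mu (@fst _ _ @^-1` E) = circle_lebesgue E) &
        rho = toT (\int[mu]_z psi z)].

Definition dist_int (x : R) : R :=
  inf [set `|x - j%:~R| | j in [set: int]].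

Definition bracket (k : int) : R := Num.max 1 `|k%:~R|.
End Functions.

(* Main.v *)
Require Import Defs.
From mathcomp Require Import all_boot all_order all_algebra.
From mathcomp Require Import all_classical all_reals all_analysis.
From mathcomp Require Import measurable_realfun.
From mathcomp Require Import complex ring lra zify.
Import Order.TTheory GRing.Theory Num.Theory.
Import numFieldNormedType.Exports.
Set Implicit Arguments.
Unset Strict Implicit.
Unset Printing Implicit Defensive.
Local Open Scope classical_set_scope.
Local Open Scope ring_scope.

(** Identify R^2 with the complex plane. A real 2x2 matrix acts as w -> a w + b conj(w), its
    determinant is |a|^2 - |b|^2, and for determinant 1 it is a rotation exactly when b = 0. The
    cocycle becomes a pair of functions (a, b), at the start with a = kap (1 + z), |kap| = 1 and z,
    b small; along the scheme a = kap (cis f + z) with a small real phase f.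

    One KAM step ([kam_step]) corrects the modulus of a, removes the low frequencies of f by a
    rotation cis psi, and solves a linear equation for m with divisors e(k alpha) - kap^2;
    conjugation by w -> w - m conj(w) then leaves in b only quadratic errors and a high-frequency
    tail. As alpha may be Liouville, psi may be large. Its frequencies however stay below a cutoff
    q, so the norm of cis psi is bounded in terms of the bandwidth alone ([wle_cis_bandwidth]). The
    frequencies of f beyond q are kept: f is measured with N extra derivatives, so they are O(q^-N),
    below the divisors of the equation for m, and [linear_solve] treats them as a perturbation.

    The scales (n, r, q) of a step come from [scale_step]. The divisors e(k alpha) - 1 with 0 < |k|
    < q cost about 2^n, while the condition on rho gives divisors of order q^-N on the longer window
    |k| <= 2^r, r >= 6n/5: when alpha is very close to a rational of denominator q, the frequencies
    of the window can be reduced modulo q. Each step spends one factor of the weight [wgt], which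
    makes the tail beyond the window as small as the error, and n_(j+1) <= 19 n_j / 10 leaves room
    for quadratic convergence.

    The divisors of a step involve the current kap, whereas the hypothesis is about rho. The
    relation [rotates] carries the rotation number through all conjugations, and [rotates_near]
    shows that kap is close to e(rho).

    The rotations cis psi need not converge, so neither need the frames. The quadratic form induced
    by a frame does not see these rotations: it is bounded in every polynomial weight, uniformly in
    the step, and its defect of invariance tends to zero ([kam_invariant_defect]). A limit along an
    ultrafilter is a smooth invariant form ([metric_limit]), whose triangular square root conjugates
    A to rotations ([rotations_reducible_of_metric]).

    To start the scheme, (H2) gives M_(4t) <= C 2^(t^2), so the Fourier coefficients of A - R beat
    the initial weight ([wfun_growth], [initial_wle]). The first scale is at most 2 k0, where k0
    depends only on gamma and tau; hence the smallness is uniform in alpha. *)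

(** * Moduli, unit complex numbers and the distance to the integers *)

Section Complex.
Variable R : realType.
Local Open Scope complex_scope.
Implicit Types (x y u : R) (z w : R[i]).

(** A real-valued modulus, so that estimates are real inequalities; the norm of [R[i]] takes its
    values in [R[i]]. *)
Definition cabs z : R := Normc.normc z.

Lemma cabsE z : cabs z = Num.sqrt (complex.Re z ^+ 2 + complex.Im z ^+ 2).
Proof. by case: z. Qed.
Lemma cabs_ge0 z : 0 <= cabs z.
Proof. by rewrite cabsE sqrtr_ge0. Qed.
Lemma cabsM z w : cabs (z * w) = cabs z * cabs w.
Proof. exact: Normc.normcM. Qed.
Lemma cabsD z w : cabs (z + w) <= cabs z + cabs w.
Proof. exact: le_normcD. Qed.
Lemma cabsN z : cabs (- z) = cabs z.
Proof. exact: normcN. Qed.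
Lemma cabsB z w : cabs (z - w) <= cabs z + cabs w.
Proof. by rewrite -(cabsN w); exact: cabsD. Qed.
Lemma cabs0 : cabs 0 = 0.
Proof. exact: Normc.normc0. Qed.
Lemma cabs1 : cabs 1 = 1.
Proof. exact: Normc.normc1. Qed.
Lemma cabs_eq0 z : cabs z = 0 -> z = 0.
Proof. exact: Normc.eq0_normc. Qed.
Lemma cabs_real x : cabs x%:C = `|x|.
Proof. by rewrite cabsE /= expr0n addr0 sqrtr_sqr. Qed.
Lemma natC (n : nat) : n%:R = (n%:R : R)%:C.
Proof. by rewrite rmorph_nat. Qed.
Lemma cabs_nat n : cabs n%:R = n%:R.
Proof. by rewrite natC cabs_real ger0_norm. Qed.
Lemma cabsi : cabs 'i = 1.
Proof. by rewrite cabsE /= expr0n expr1n add0r sqrtr1. Qed.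
Lemma cabsV z : cabs z^-1 = (cabs z)^-1.
Proof. exact: Normc.normcV. Qed.
Lemma cabsX z n : cabs (z ^+ n) = cabs z ^+ n.
Proof. by elim: n => [|n IH]; rewrite ?expr0 ?cabs1// !exprS cabsM IH. Qed.
Lemma cabsJ z : cabs (conjc z) = cabs z.
Proof. by case: z => a b; rewrite !cabsE /= sqrrN. Qed.
Lemma cabs_dist z w : cabs (z - w) = cabs (w - z).
Proof. by rewrite -cabsN opprB. Qed.
Lemma cabs_sub_ge z w : cabs z - cabs w <= cabs (z - w).
Proof. by rewrite lerBlDr (le_trans _ (cabsD _ _))// subrK. Qed.
Lemma cabs_add_ge z w : cabs z - cabs w <= cabs (z + w).
Proof. by rewrite -(cabsN w) -{2}(opprK w) cabs_sub_ge. Qed.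
Lemma cabs_sq z : cabs z ^+ 2 = complex.Re z ^+ 2 + complex.Im z ^+ 2.
Proof. by rewrite cabsE sqr_sqrtr// addr_ge0 ?sqr_ge0. Qed.
Lemma mulcJ z : z * conjc z = (cabs z ^+ 2)%:C.
Proof.
rewrite cabs_sq; case: z => a b; apply/eqP; rewrite eq_complex /=.
by apply/andP; split; apply/eqP; ring.
Qed.
Lemma Re_le_cabs z : `|complex.Re z| <= cabs z.
Proof. by rewrite cabsE -sqrtr_sqr ler_wsqrtr// lerDl sqr_ge0. Qed.
Lemma Im_le_cabs z : `|complex.Im z| <= cabs z.
Proof. by rewrite cabsE -sqrtr_sqr ler_wsqrtr// lerDr sqr_ge0. Qed.
Lemma cabs_le_ReIm z : cabs z <= `|complex.Re z| + `|complex.Im z|.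
Proof.
rewrite -(@ler_pXn2r _ 2)// ?nnegrE ?cabs_ge0 ?addr_ge0//.
rewrite cabs_sq -(real_normK (num_real (complex.Re z))) -(real_normK (num_real (complex.Im z))).
rewrite sqrrD; have := mulr_ge0 (normr_ge0 (complex.Re z)) (normr_ge0 (complex.Im z)); lra.
Qed.
Lemma cabs_ReIm_le z (a b : R) :
  `|complex.Re z| <= a -> `|complex.Im z| <= b -> cabs z <= a + b.
Proof. by move=> h k; rewrite (le_trans (cabs_le_ReIm z))// lerD. Qed.
Lemma cabs_mul_le z w (a b : R) : cabs z <= a -> cabs w <= b -> cabs (z * w) <= a * b.
Proof. by move=> h k; rewrite cabsM ler_pM ?cabs_ge0. Qed.
Lemma cabs_add_le z w (a b : R) : cabs z <= a -> cabs w <= b -> cabs (z + w) <= a + b.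
Proof. by move=> h k; rewrite (le_trans (cabsD _ _))// lerD. Qed.
Lemma cabs_sub_le z w (a b : R) : cabs z <= a -> cabs w <= b -> cabs (z - w) <= a + b.
Proof. by move=> h k; rewrite (le_trans (cabsB _ _))// lerD. Qed.
Lemma cabs_sum (I : Type) (s : seq I) (P : pred I) (F : I -> R[i]) :
  cabs (\sum_(i <- s | P i) F i) <= \sum_(i <- s | P i) cabs (F i).
Proof.
elim/big_ind2 : _ => //[|z a w b h k]; first by rewrite cabs0.
exact: cabs_add_le.
Qed.

Lemma conjcD z w : conjc (z + w) = conjc z + conjc w.
Proof. by case: z w => a b [c d]; apply/eqP; rewrite eq_complex/= opprD !eqxx. Qed.
Lemma conjcM z w : conjc (z * w) = conjc z * conjc w.
Proof.
case: z w => a b [c d]; apply/eqP; rewrite eq_complex/=.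
by apply/andP; split; apply/eqP; ring.
Qed.
Lemma conjcN z : conjc (- z) = - conjc z.
Proof. by case: z => a b. Qed.
Lemma conjcB z w : conjc (z - w) = conjc z - conjc w.
Proof. by rewrite conjcD conjcN. Qed.
Lemma conjcc z : conjc (conjc z) = z.
Proof. by case: z => a b; rewrite /= opprK. Qed.
Lemma conjc_realC x : conjc x%:C = x%:C.
Proof. by rewrite /= oppr0. Qed.
Lemma ReD z w : complex.Re (z + w) = complex.Re z + complex.Re w.
Proof. by case: z w => a b [c d]. Qed.
Lemma ImD z w : complex.Im (z + w) = complex.Im z + complex.Im w.
Proof. by case: z w => a b [c d]. Qed.
Lemma ReN z : complex.Re (- z) = - complex.Re z.
Proof. by case: z. Qed.
Lemma ImN z : complex.Im (- z) = - complex.Im z.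
Proof. by case: z. Qed.
Lemma ReM z w : complex.Re (z * w) =
  complex.Re z * complex.Re w - complex.Im z * complex.Im w.
Proof. by case: z w => a b [c d]. Qed.
Lemma ImM z w : complex.Im (z * w) =
  complex.Re z * complex.Im w + complex.Im z * complex.Re w.
Proof. by case: z w => a b [c d]. Qed.

Lemma complexP z w :
  complex.Re z = complex.Re w -> complex.Im z = complex.Im w -> z = w.
Proof. by move=> h k; apply/eqP; rewrite eq_complex h k !eqxx. Qed.

Lemma rcD x y : (x + y)%:C = x%:C + y%:C.
Proof. exact: rmorphD. Qed.
Lemma rcN x : (- x)%:C = - x%:C.
Proof. exact: rmorphN. Qed.
Lemma rcB x y : (x - y)%:C = x%:C - y%:C.
Proof. exact: rmorphB. Qed.
Lemma rcM x y : (x * y)%:C = x%:C * y%:C.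
Proof. exact: rmorphM. Qed.

Definition cis x : R[i] := cos x +i* sin x.

Lemma cisD x y : cis (x + y) = cis x * cis y.
Proof. by apply: complexP; rewrite /= ?cosD ?sinD; ring. Qed.
Lemma cis0 : cis 0 = 1.
Proof. by rewrite /cis cos0 sin0. Qed.
Lemma cisN x : cis (- x) = conjc (cis x).
Proof. by rewrite /cis cosN sinN. Qed.
Lemma cabs_cis x : cabs (cis x) = 1.
Proof. by rewrite cabsE /= cos2Dsin2 sqrtr1. Qed.
Lemma cisNM x : cis (- x) * cis x = 1.
Proof. by rewrite -cisD addNr cis0. Qed.
Lemma cisMN x : cis x * cis (- x) = 1.
Proof. by rewrite -cisD subrr cis0. Qed.
Lemma cisX x n : cis (x *+ n) = cis x ^+ n.
Proof. by elim: n => [|n IH]; rewrite ?mulr0n ?cis0// mulrS cisD IH exprS. Qed.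

Lemma abs_sin_le x : `|sin x| <= `|x|.
Proof.
wlog x0 : x / 0 <= x => [H|].
  by case: (leP 0 x) => [/H//|/ltW x0]; rewrite -normrN -sinN -(normrN x) H ?oppr_ge0.
have [c _] := @MVT_segment R sin cos 0 x x0 (fun y _ => is_derive_sin y)
  (continuous_subspaceT (fun y => @continuous_sin R y)).
by rewrite sin0 !subr0 => ->; rewrite normrM ler_piMl// cos_max.
Qed.

Lemma abs_cosB1_le x : `|cos x - 1| <= x ^+ 2.
Proof.
have -> : cos x - 1 = - (2 * sin (x / 2) ^+ 2).
  have hx : x = x / 2 + x / 2 by field.
  rewrite {1}hx cosD; have := cos2Dsin2 (x / 2). nra.
rewrite normrN normrM normrX ger0_norm//.
have := abs_sin_le (x / 2); rewrite normrM (ger0_norm (_ : 0 <= 2^-1))// => h.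
have := sqr_ge0 x; rewrite -(real_normK (num_real x)).
by have := normr_ge0 (sin (x / 2)); have := normr_ge0 x; nra.
Qed.

Lemma abs_sinB_le x : `|sin x - x| <= 2 * x ^+ 2.
Proof.
wlog x0 : x / 0 <= x => [H|].
  case: (leP 0 x) => [/H//|/ltW x0]; rewrite -normrN -sqrrN.
  by rewrite (_ : - (sin x - x) = sin (- x) - - x) ?H ?oppr_ge0// sinN; ring.
have [x1|x1] := leP x 1; last first.
  have := sin_max x; rewrite ler_norml => /andP[h1 h2].
  by rewrite ler_norml; apply/andP; split; nra.
pose f := fun y : R => sin y - y.
have df (y : R) : is_derive y (1 : R) f (cos y - 1) by exact: is_deriveB.
have cf : {within `[0, x], continuous f}.
  by apply: derivable_within_continuous => y _; case: (df y).
have [c] := @MVT_segment R f (fun y => cos y - 1) 0 x x0 (fun y _ => df y) cf.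
rewrite in_itv /= => /andP[c0 cx]; rewrite /f sin0 !subr0 => ->.
rewrite normrM expr2 (ger0_norm x0) mulrA ler_wpM2r// (le_trans (abs_cosB1_le c))//.
by nra.
Qed.

Lemma cabs_cisB1_le x : cabs (cis x - 1) <= `|x|.
Proof.
rewrite -(@ler_pXn2r _ 2)// ?nnegrE ?cabs_ge0// cabs_sq /= subr0.
have -> : (cos x - 1) ^+ 2 + sin x ^+ 2 = 4 * sin (x / 2) ^+ 2.
  have hx : x = x / 2 + x / 2 by field.
  rewrite {1 2}hx cosD sinD; have := cos2Dsin2 (x / 2).
  move: (cos _) (sin _) => c s h; have h' : c ^+ 2 = 1 - s ^+ 2 by rewrite -h; ring.
  rewrite (_ : _ + _ = (c ^+ 2 - s ^+ 2 - 1) ^+ 2 + 4 * s ^+ 2 * c ^+ 2); last by ring.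
  by rewrite h'; ring.
have := abs_sin_le (x / 2); rewrite normrM (ger0_norm (_ : 0 <= 2^-1))// => h.
rewrite -(real_normK (num_real (sin _))).
by have := normr_ge0 (sin (x / 2)); have := normr_ge0 x; nra.
Qed.

Lemma cabs_cisB1B_le x : cabs (cis x - 1 - 'i * x%:C) <= 3 * x ^+ 2.
Proof.
rewrite (_ : 3 * x ^+ 2 = x ^+ 2 + 2 * x ^+ 2); last by ring.
apply: cabs_ReIm_le => /=.
  by rewrite !(mul0r,mul1r,subr0,mulr0) abs_cosB1_le.
by rewrite !(mul0r,mul1r,subr0,mulr0,add0r) abs_sinB_le.
Qed.

Lemma cabs_cisB_le x y : cabs (cis x - cis y) <= `|x - y|.
Proof.
rewrite (_ : cis x - cis y = cis y * (cis (x - y) - 1)); last first.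
  by rewrite mulrBr -cisD mulr1; congr (cis _ - _); ring.
by rewrite cabsM cabs_cis mul1r cabs_cisB1_le.
Qed.

Definition e x : R[i] := cis (2 * pi * x).

Lemma eD x y : e (x + y) = e x * e y.
Proof. by rewrite /e mulrDr cisD. Qed.
Lemma e0 : e 0 = 1.
Proof. by rewrite /e mulr0 cis0. Qed.
Lemma eN x : e (- x) = conjc (e x).
Proof. by rewrite /e mulrN cisN. Qed.
Lemma cabs_e x : cabs (e x) = 1.
Proof. exact: cabs_cis. Qed.
Lemma eMN x : e x * e (- x) = 1.
Proof. by rewrite -eD subrr e0. Qed.
Lemma e1 : e 1 = 1.
Proof. by rewrite /e /cis mulr1 mulr_natl cos2pi sin2pi. Qed.
Lemma eX x n : e (x *+ n) = e x ^+ n.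
Proof. by elim: n => [|n IH]; rewrite ?mulr0n ?e0// mulrS eD IH exprS. Qed.
Lemma e_int (k : int) : e k%:~R = 1.
Proof.
case: k => n; first by rewrite -pmulrn eX e1 expr1n.
by rewrite NegzE mulrNz eN -pmulrn eX e1 expr1n conjc1.
Qed.

Lemma pi_le4 : (pi : R) <= 4.
Proof. by have := pihalf_ge1 R; have /andP[] := pihalf_02 R; lra. Qed.

Lemma cabs_eB_le x y : cabs (e x - e y) <= 8 * `|x - y|.
Proof.
rewrite (le_trans (cabs_cisB_le _ _))// -mulrBr normrM ler_wpM2r//.
by rewrite ger0_norm ?mulr_ge0 ?pi_ge0//; have := pi_le4; lra.
Qed.

Lemma nearest_int x : exists k : int, `|x - k%:~R| <= 2^-1.
Proof.
exists (Num.floor (x + 2^-1)); have := floor_itv (x + 2^-1).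
by rewrite ler_norml intrD => /andP[h1 h2]; apply/andP; split; lra.
Qed.

(** By the half-angle formula and the mean value theorem, sin t = t cos(c) cos(t/2) with c and t/2
    in [0, pi/4], where a product of two cosines is at least 1/2. *)
Lemma half_le_sin (t : R) : 0 <= t <= pi / 2 -> t / 2 <= sin t.
Proof.
move=> /andP[t0 t1].
have c4 : (2 : R)^-1 <= cos (pi / 4) ^+ 2.
  have : cos ((pi : R) / 4 + pi / 4) = 0.
    by rewrite (_ : (pi : R) / 4 + pi / 4 = pi / 2) ?cos_pihalf//; field.
  by rewrite cosD; have := cos2Dsin2 ((pi : R) / 4); lra.
have c40 : (0 : R) <= cos (pi / 4).
  by apply: cos_ge0_pihalf; have := pi_ge0 R; lra.
have cge y : 0 <= y <= pi / 4 -> cos (pi / 4) <= cos y.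
  move=> /andP[y0 y1]; have := pi_gt0 R => p0.
  by rewrite leNgt ltr_cos ?in_itv /= -?leNgt//; apply/andP; split; lra.
have [c] := @MVT_segment R sin cos 0 (t / 2) (divr_ge0 t0 (ler0n _ 2))
  (fun y _ => is_derive_sin y) (continuous_subspaceT (fun y => @continuous_sin R y)).
rewrite in_itv /= sin0 !subr0 => /andP[cc0 cc1] hs.
rewrite {2}(_ : t = t / 2 + t / 2) ?sinD; last by field.
have h1 : cos (pi / 4) <= cos c by apply: cge; lra.
have h2 : cos (pi / 4) <= cos (t / 2) by apply: cge; lra.
have h3 : 2^-1 <= cos c * cos (t / 2).
  by rewrite (le_trans c4)// expr2 ler_pM.
by rewrite hs; nra.
Qed.

(** Since |e(x) - 1| = 2 |sin(pi x)|, the modulus controls the distance to the nearest integer.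
    Every small-divisor bound goes through this inequality. *)
Lemma cabs_eB1_ge x (k : int) : `|x - k%:~R| <= 2^-1 -> 2 * `|x - k%:~R| <= cabs (e x - 1).
Proof.
have -> : e x = e (x - k%:~R) by rewrite eD -mulrNz e_int mulr1.
move: (x - _) => {}x x12.
wlog x0 : x x12 / 0 <= x => [H|].
  case: (leP 0 x) => [/H->//|/ltW x0]; rewrite -normrN (le_trans (H _ _ _)) ?normrN ?oppr_ge0//.
  by rewrite eN -(cabsJ (e x - 1)) conjcB conjc1.
rewrite ger0_norm//; rewrite ger0_norm// in x12.
have p0 := pi_gt0 R; have p2 := pihalf_ge1 R.
have h : 2 * x <= `|2 * sin (pi * x)|.
  rewrite ger0_norm; first by have := @half_le_sin (pi * x); nra.
  by rewrite mulr_ge0// sin_ge0_pi//; apply/andP; split; nra.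
rewrite (le_trans h)// -(@ler_pXn2r _ 2)// ?nnegrE ?cabs_ge0//.
rewrite cabs_sq /= subr0 real_normK ?num_real//.
have hx : 2 * pi * x = pi * x + pi * x by ring.
rewrite hx cosD sinD; have := cos2Dsin2 (pi * x) => h1.
move: (cos _) (sin _) h1 => c s h1.
rewrite (_ : (c * c - s * s - 1) ^+ 2 + (s * c + c * s) ^+ 2 =
  (c ^+ 2 + s ^+ 2) ^+ 2 - 2 * (c ^+ 2 + s ^+ 2) + 1 + 4 * s ^+ 2); last by ring.
by rewrite h1 exprMn; lra.
Qed.

End Complex.

(** * Trigonometric polynomials as lists of terms *)

Section TrigPolynomials.
Variable R : realType.
Local Open Scope complex_scope.
Local Notation C := R[i].
Local Notation tpoly := (seq (int * C)).
Implicit Types (t s : tpoly) (w : int -> R) (f g : R -> C) (k l : int) (x : R).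

(** A polynomial is a list of (frequency, coefficient) pairs in which frequencies may repeat, so
    that sums and products are plain list operations. Consequently [nw] only bounds the Wiener norm
    from above, until [merge] collects equal frequencies. *)
Definition ev t x : C := \sum_(p <- t) p.2 * e (p.1%:~R * x).
Definition nw w t : R := \sum_(p <- t) cabs p.2 * w p.1.
Definition tmul t s : tpoly := [seq (p.1 + q.1, p.2 * q.2) | p <- t, q <- s].
Definition tconj t : tpoly := [seq (- p.1, conjc p.2) | p <- t].
Definition tmap (c : int -> C) t : tpoly := [seq (p.1, c p.1 * p.2) | p <- t].

Lemma ev_cat t s x : ev (t ++ s) x = ev t x + ev s x.
Proof. by rewrite /ev big_cat. Qed.
Lemma ev_nil x : ev [::] x = 0.
Proof. by rewrite /ev big_nil. Qed.
Lemma ev1 k (c : C) x : ev [:: (k, c)] x = c * e (k%:~R * x).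
Proof. by rewrite /ev big_seq1. Qed.
Lemma evM t s x : ev (tmul t s) x = ev t x * ev s x.
Proof.
rewrite /ev /tmul big_allpairs_dep /= big_distrl /=; apply: eq_bigr => p _.
rewrite big_distrr /=; apply: eq_bigr => q _.
by rewrite intrD mulrDl eD; ring.
Qed.
Lemma conjc_sum (I : Type) (r : seq I) (F : I -> C) :
  conjc (\sum_(i <- r) F i) = \sum_(i <- r) conjc (F i).
Proof.
elim: r => [|i r IH]; first by rewrite !big_nil conjc0.
by rewrite !big_cons conjcD IH.
Qed.
Lemma evJ t x : ev (tconj t) x = conjc (ev t x).
Proof.
rewrite /ev /tconj big_map conjc_sum; apply: eq_bigr => p _ /=.
by rewrite conjcM -eN; congr (_ * e _); rewrite mulrNz mulNr.
Qed.
Lemma ev_shift (al : R) t x : ev (tmap (fun k => e (k%:~R * al)) t) x = ev t (x + al).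
Proof.
rewrite /ev /tmap big_map; apply: eq_bigr => p _ /=.
by rewrite mulrDr eD; ring.
Qed.
Lemma ev_scale (c : C) t x : ev (tmap (fun=> c) t) x = c * ev t x.
Proof.
by rewrite /ev /tmap big_map big_distrr; apply: eq_bigr => p _ /=; rewrite mulrA.
Qed.
Lemma ev_period t x : ev t (x + 1) = ev t x.
Proof.
rewrite /ev; apply: eq_bigr => p _; rewrite mulrDr mulr1 eD.
by rewrite e_int mulr1.
Qed.

Lemma nw_cat w t s : nw w (t ++ s) = nw w t + nw w s.
Proof. by rewrite /nw big_cat. Qed.
Lemma nw1 w k c : nw w [:: (k, c)] = cabs c * w k.
Proof. by rewrite /nw big_seq1. Qed.

(** Submultiplicativity makes the weighted Wiener norm an algebra norm, evenness makes it stable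
    under conjugation, and [1 <= w k] makes it dominate the sup norm. *)
Definition weight w := [/\ w 0 = 1, forall k, 1 <= w k, forall k, w (- k) = w k &
  forall k l, w (k + l) <= w k * w l].

Lemma weight_ge0 w k : weight w -> 0 <= w k.
Proof. by case=> _ h _ _; rewrite (le_trans _ (h k)). Qed.

Lemma nw_ge0 w t : (forall k, 0 <= w k) -> 0 <= nw w t.
Proof. by move=> h; apply: sumr_ge0 => p _; rewrite mulr_ge0// cabs_ge0. Qed.

Lemma nwM w t s : weight w -> nw w (tmul t s) <= nw w t * nw w s.
Proof.
move=> W; rewrite /nw /tmul big_allpairs_dep /= big_distrl /=; apply: ler_sum => p _.
rewrite big_distrr /=; apply: ler_sum => q _; rewrite cabsM.
case: W => _ _ _ h; rewrite mulrACA ler_wpM2l// mulr_ge0 ?cabs_ge0//.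
Qed.
Lemma nwJ w t : (forall k, w (- k) = w k) -> nw w (tconj t) = nw w t.
Proof.
by move=> h; rewrite /nw big_map; apply: eq_bigr => p _ /=; rewrite h cabsJ.
Qed.
Lemma nw_map w w' (c : int -> C) (M : R) t : 0 <= M ->
  (forall p, p \in t -> cabs (c p.1) * w' p.1 <= M * w p.1) ->
  nw w' (tmap c t) <= M * nw w t.
Proof.
move=> M0 h; rewrite /nw big_map big_distrr /= big_seq [leRHS]big_seq.
apply: ler_sum => p pt /=.
by rewrite cabsM mulrAC [leLHS]mulrC [leRHS]mulrCA ler_wpM2l ?cabs_ge0// h.
Qed.
Lemma nw_le w w' (M : R) t : 0 <= M ->
  (forall p, p \in t -> w' p.1 <= M * w p.1) -> nw w' t <= M * nw w t.
Proof.
move=> M0 h; rewrite /nw big_distrr /= big_seq [leRHS]big_seq.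
by apply: ler_sum => p pt; rewrite mulrCA ler_wpM2l ?cabs_ge0// h.
Qed.
Lemma nw_filter w (a : pred (int * C)) t : (forall k, 0 <= w k) ->
  nw w (seq.filter a t) <= nw w t.
Proof.
move=> h; rewrite /nw big_filter big_mkcond; apply: ler_sum => p _.
by case: ifP => // _; rewrite mulr_ge0// cabs_ge0.
Qed.
Lemma ev_filter (a : pred (int * C)) t x :
  ev t x = ev (seq.filter a t) x + ev (seq.filter (predC a) t) x.
Proof. by rewrite /ev !big_filter (bigID a). Qed.
Lemma nw_filterC w (a : pred (int * C)) t :
  nw w t = nw w (seq.filter a t) + nw w (seq.filter (predC a) t).
Proof. by rewrite /nw !big_filter (bigID a). Qed.
Lemma cabs_ev w t x : (forall k, 1 <= w k) -> cabs (ev t x) <= nw w t.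
Proof.
move=> h; rewrite (le_trans (cabs_sum _ _ _))//; apply: ler_sum => p _.
by rewrite cabsM cabs_e ler_wpM2l ?cabs_ge0.
Qed.

(** The sum is geometric with ratio z = e(l/n). As z^n = 1, it vanishes unless z = 1, which 0 < |l|
    < n excludes. *)
Lemma sum_e_orthogonal (n : nat) (l : int) : (`|l| < n)%N ->
  \sum_(j < n) e (l%:~R * (j%:R / n%:R)) = if l == 0 then n%:R else 0 :> C.
Proof.
move=> ln; have n0 : n%:R != 0 :> R by rewrite pnatr_eq0; lia.
case: eqP => [->|/eqP l0].
  by rewrite (eq_bigr (fun=> 1)) ?sumr_const ?card_ord// => j _; rewrite mul0r e0.
pose z := e (l%:~R / n%:R) : C.
have zX (j : nat) : e (l%:~R * (j%:R / n%:R)) = z ^+ j.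
  by rewrite /z -eX -[X in _ = e X]mulr_natr; congr (e _); rewrite mulrA mulrAC.
rewrite (eq_bigr (fun j : 'I_n => z ^+ j)); last by move=> j _; rewrite zX.
have : z ^+ n - 1 = 0 by rewrite -zX divff// mulr1 e_int subrr.
rewrite subrX1 => /eqP; rewrite mulf_eq0 => /orP[|/eqP//].
move=> /eqP z1; exfalso; have [m hm] := nearest_int (l%:~R / n%:R : R).
have := cabs_eB1_ge hm; rewrite -/z z1 cabs0 => h.
have : `|l%:~R / n%:R - m%:~R : R| = 0 by apply/eqP; rewrite eq_le normr_ge0; lra.
move=> /eqP; rewrite normr_eq0 subr_eq0 => /eqP hl.
have : l = m * n%:Z.
  apply: (@intr_inj R); rewrite intrM -hl; rewrite -mulrA mulVf ?mulr1//.
by move=> lm; move: ln l0; rewrite lm abszM; case: (m) => [[|?]|?] /=; nia.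
Qed.

Definition coef t k : C := \sum_(p <- t | p.1 == k) p.2.

(** Averaging over n equispaced nodes is exact when no frequency of [t] aliases to [k]. Fourier
    coefficients are thus controlled by the sup norm without integration. *)
Lemma coefE t k (n : nat) : (forall p, p \in t -> (`|p.1 - k| < n)%N) -> (0 < n)%N ->
  coef t k = n%:R^-1 * \sum_(j < n) ev t (j%:R / n%:R) * e (- (k%:~R * (j%:R / n%:R))).
Proof.
move=> h n0; have nz : n%:R != 0 :> C by rewrite pnatr_eq0; lia.
apply: (mulfI nz); rewrite mulrA divff// mul1r.
under eq_bigr do rewrite /ev big_distrl /=.
rewrite exchange_big /= /coef big_distrr /= big_mkcond /=.
rewrite big_seq [RHS]big_seq; apply: eq_bigr => p pt.
under eq_bigr do rewrite -mulrA -eD -mulrBl -intrB.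
rewrite -big_distrr /= sum_e_orthogonal ?h// subr_eq0.
by case: eqP => _; rewrite ?mulr0// mulrC.
Qed.

Lemma tpoly_bound t k : exists2 n : nat, (0 < n)%N & forall p, p \in t -> (`|p.1 - k| < n)%N.
Proof.
elim: t => [|p t [n n0 IH]]; first by exists 1%N.
exists (maxn n (`|p.1 - k|.+1)%N); first by rewrite leq_max n0.
by move=> q; rewrite inE => /orP[/eqP->|/IH]; rewrite leq_max ?ltnSn ?orbT// => ->.
Qed.

Lemma cabs_coef t k (M : R) : (forall x, cabs (ev t x) <= M) -> cabs (coef t k) <= M.
Proof.
move=> h; have [n n0 hn] := tpoly_bound t k; rewrite (coefE hn n0) cabsM.
have nz : (0 : R) < n%:R by rewrite ltr0n.
rewrite cabsV cabs_nat mulrC ler_pdivrMr//.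
rewrite (le_trans (cabs_sum _ _ _))//.
apply: (@le_trans _ _ (\sum_(j < n) M)); last first.
  by rewrite sumr_const card_ord mulr_natr.
by apply: ler_sum => j _; rewrite cabsM cabs_e mulr1.
Qed.

Definition merge t : tpoly := [seq (k, coef t k) | k <- undup (map fst t)].

Lemma ev_merge t x : ev (merge t) x = ev t x.
Proof.
rewrite /ev /merge big_map /coef.
under eq_bigr do rewrite /= big_distrl /=.
rewrite (exchange_big_dep xpredT) //= big_seq [RHS]big_seq; apply: eq_bigr => p pt.
rewrite (eq_bigl (pred1 p.1)) => [|k]; last by rewrite eq_sym.
rewrite -big_filter filter_pred1_uniq ?undup_uniq ?mem_undup ?map_f//.
by rewrite big_seq1.
Qed.

End TrigPolynomials.

(** * Limits of bounded sequences along an ultrafilter *)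

Section UltraLimit.
Variable R : realType.
Implicit Types (u v : nat -> R).

(** Along an ultrafilter finer than [\oo] every bounded sequence converges, so one choice gives
    limits at all points and all frequencies at once, with no extraction of subsequences. *)
Definition ufilter : set_system nat :=
  sval (cid (ultraFilterLemma (eventually_filter : ProperFilter \oo))).

#[local] Instance ufilter_ultra : UltraFilter ufilter.
Proof. exact: (svalP (cid (ultraFilterLemma (eventually_filter : ProperFilter \oo)))).1. Qed.
#[local] Instance ufilter_proper : ProperFilter ufilter.
Proof. exact: ultra_proper. Qed.
Lemma eventually_ufilter : \oo `<=` ufilter.
Proof. exact: (svalP (cid (ultraFilterLemma (eventually_filter : ProperFilter \oo)))).2. Qed.

Lemma ultra_bounded_cvg u (B : R) : (forall n, `|u n| <= B) ->
  exists l : R, u n @[n --> ufilter] --> l.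
Proof.
move=> h; have FB : (u @ ufilter) `[- B, B]%classic.
  suff : ufilter (fun n => u n \in `[- B, B]) by [].
  by apply: filterE => n; rewrite in_itv /= -ler_norml.
have [p [_ hp]] := segment_compact _ FB.
exists p => V nV; case: (in_ultra_setVsetC (u @^-1` V) ufilter_ultra) => // hV.
have [y [nVy Vy]] := hp (~` V) V hV nV; case: (nVy Vy).
Qed.

Definition ulim u : R := lim (u @ ufilter).

Lemma ulim_cvg u B : (forall n, `|u n| <= B) -> u n @[n --> ufilter] --> ulim u.
Proof. by move=> /ultra_bounded_cvg [l hl]; apply/cvg_ex; exists l. Qed.

Lemma ulim_ge u (l B : R) : (forall n, `|u n| <= B) ->
  (forall (n : nat), l <= u n) -> l <= ulim u.
Proof.
move=> h k; apply: (ler_cvg_to (cvg_cst l) (ulim_cvg h)).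
exact: filterE.
Qed.
Lemma ulim_le u (l B : R) : (forall n, `|u n| <= B) ->
  (forall (n : nat), u n <= l) -> ulim u <= l.
Proof.
move=> h k; apply: (ler_cvg_to (ulim_cvg h) (cvg_cst l)).
exact: filterE.
Qed.
Lemma ulim_eq u (l : R) : u n @[n --> ufilter] --> l -> ulim u = l.
Proof. by move=> h; apply: cvg_lim. Qed.

(** The sequence is Cauchy with an explicit rate. The factors 2 come from treating real and
    imaginary parts separately. *)
Lemma ulimC_limit (z : nat -> R[i]) (B : R) (eta : nat -> R) :
  (forall n, cabs (z n) <= B) -> (forall m n, cabs (z m - z n) <= eta m + eta n) ->
  eta n @[n --> \oo] --> (0 : R) ->
  exists2 l : R[i], (forall n, cabs (l - z n) <= 2 * eta n) & cabs l <= 2 * B.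
Proof.
move=> zB zc e0.
have reB n : `|complex.Re (z n)| <= B by exact: le_trans (Re_le_cabs _) _.
have imB n : `|complex.Im (z n)| <= B by exact: le_trans (Im_le_cabs _) _.
have cvge : eta n @[n --> ufilter] --> (0 : R).
  by apply: cvg_trans e0; apply: cvg_app; exact: eventually_ufilter.
exists (ulim (fun n => complex.Re (z n)) +i* ulim (fun n => complex.Im (z n)))%C.
- move=> n.
  have hn : eta m + eta n @[m --> ufilter] --> eta n.
    by rewrite -[X in _ --> X]add0r; apply: cvgD => //; exact: cvg_cst.
  rewrite mulr2n mulrDl mul1r; apply: cabs_ReIm_le; rewrite (ReD,ImD) (ReN,ImN).
  + apply: (ler_cvg_to (cvg_norm (cvgB (ulim_cvg reB) (cvg_cst (complex.Re (z n))))) hn).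
    apply: filterE => m; rewrite /= (le_trans _ (zc m n))//.
    by rewrite (le_trans _ (Re_le_cabs _))// ReD ReN.
  + apply: (ler_cvg_to (cvg_norm (cvgB (ulim_cvg imB) (cvg_cst (complex.Im (z n))))) hn).
    apply: filterE => m; rewrite /= (le_trans _ (zc m n))//.
    by rewrite (le_trans _ (Im_le_cabs _))// ImD ImN.
- rewrite mulr2n mulrDl mul1r; apply: cabs_ReIm_le => /=; rewrite ler_norml; apply/andP; split.
  + by apply: (ulim_ge reB) => n; have := reB n; rewrite ler_norml => /andP[].
  + by apply: (ulim_le reB) => n; have := reB n; rewrite ler_norml => /andP[].
  + by apply: (ulim_ge imB) => n; have := imB n; rewrite ler_norml => /andP[].
  + by apply: (ulim_le imB) => n; have := imB n; rewrite ler_norml => /andP[].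
Qed.
End UltraLimit.


(** * Weighted Wiener norms *)

Section WienerNorm.
Variable R : realType.
Local Open Scope complex_scope.
Local Notation C := R[i].
Local Notation tpoly := (seq (int * C)).
Implicit Types (t s : tpoly) (w : int -> R) (f g : R -> C) (k l : int) (x B : R).

(** The closure, for uniform convergence, of the ball of radius [B] of the weighted Wiener norm.
    Stating the bound through approximants makes it stable under uniform limits and dispenses with
    the Fourier coefficients of [f]. *)
Definition wle w f B := forall eta : R, 0 < eta ->
  exists2 t : tpoly, nw w t <= B & forall x, cabs (f x - ev t x) <= eta.

Lemma eq_wle w f g B : (forall x, f x = g x) -> wle w f B -> wle w g B.
Proof. by move=> fg h eta /h [t tB ht]; exists t => // x; rewrite -fg. Qed.
Lemma wle_mono w f B B' : B <= B' -> wle w f B -> wle w f B'.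
Proof. by move=> BB h eta /h [t tB ht]; exists t => //; exact: le_trans BB. Qed.
Lemma wle_weight w w' f B (M : R) : 0 <= M -> (forall k, w' k <= M * w k) ->
  wle w f B -> wle w' f (M * B).
Proof.
move=> M0 ww h eta /h [t tB ht]; exists t => //.
by apply: le_trans (nw_le M0 (fun p _ => ww p.1)) _; exact: ler_wpM2l.
Qed.
Lemma wle_weight_le w w' f B : (forall k, w' k <= w k) -> wle w f B -> wle w' f B.
Proof. by move=> h; rewrite -[B in X in _ -> X]mul1r; apply: wle_weight => // k; rewrite mul1r. Qed.
Lemma wle_ev w t B : nw w t <= B -> wle w (ev t) B.
Proof. by move=> h eta e0; exists t => // x; rewrite subrr cabs0 ltW. Qed.
Lemma wle_lim w f B : (forall eta : R, 0 < eta -> exists2 g, wle w g B &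
  forall x, cabs (f x - g x) <= eta) -> wle w f B.
Proof.
move=> h eta eta0; have e20 : 0 < eta / 2 by lra.
have [g wg fg] := h _ e20; have [t tB ht] := wg _ e20; exists t => // x.
rewrite (_ : f x - _ = (f x - g x) + (g x - ev t x)); last by ring.
by rewrite (splitr eta) cabs_add_le.
Qed.
Lemma wle_ge0 w f B : weight w -> wle w f B -> 0 <= B.
Proof.
move=> W h; have [t tB _] := h 1 ltr01; apply: le_trans tB; apply: nw_ge0 => k.
exact: weight_ge0.
Qed.
Lemma wle_sup w f B x : weight w -> wle w f B -> cabs (f x) <= B.
Proof.
move=> W h; apply/ler_addgt0Pr => eta /h [t tB ht].
rewrite (_ : f x = ev t x + (f x - ev t x)); last by ring.
rewrite cabs_add_le// (le_trans (cabs_ev _ _ _) tB)// => k.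
by case: W.
Qed.
Lemma wle_add w f g B B' : wle w f B -> wle w g B' ->
  wle w (fun x => f x + g x) (B + B').
Proof.
move=> hf hg eta eta0; have e20 : 0 < eta / 2 by lra.
have [t tB ht] := hf _ e20; have [s sB hs] := hg _ e20; exists (t ++ s).
  by rewrite nw_cat lerD.
move=> x; rewrite ev_cat opprD addrACA (splitr eta); exact: cabs_add_le.
Qed.
Lemma wle_scale w f B (c : C) (M : R) : (forall k, 0 <= w k) -> cabs c <= M ->
  wle w f B -> wle w (fun x => c * f x) (M * B).
Proof.
move=> w0 cM h eta eta0.
have M0 : 0 <= M := le_trans (cabs_ge0 _) cM.
have e0 : 0 < eta / (M + 1) by rewrite divr_gt0//; lra.
have [t tB ht] := h _ e0; exists (tmap (fun=> c) t).
  apply: le_trans (ler_wpM2l M0 tB); apply: nw_map => // p _.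
  by rewrite ler_wpM2r.
move=> x; rewrite ev_scale -mulrBr cabsM.
apply: (@le_trans _ _ (M * (eta / (M + 1)))); first by rewrite ler_pM ?cabs_ge0.
by rewrite mulrA ler_pdivrMr; nra.
Qed.
Lemma wle_opp w f B : (forall k, 0 <= w k) -> wle w f B -> wle w (fun x => - f x) B.
Proof.
move=> w0 h; rewrite -[B]mul1r; apply: (@eq_wle _ (fun x => - 1 * f x)).
  by move=> x; rewrite mulN1r.
by apply: wle_scale => //; rewrite cabsN cabs1.
Qed.
Lemma wle_sub w f g B B' : (forall k, 0 <= w k) -> wle w f B -> wle w g B' ->
  wle w (fun x => f x - g x) (B + B').
Proof. by move=> w0 hf hg; apply: wle_add => //; exact: wle_opp. Qed.
Lemma wle_mul w f g B B' : weight w -> wle w f B -> wle w g B' ->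
  wle w (fun x => f x * g x) (B * B').
Proof.
move=> W hf hg eta eta0.
have B0 := wle_ge0 W hf; have B'0 := wle_ge0 W hg.
have e0 : 0 < eta / (B + B' + 1) by rewrite divr_gt0//; lra.
have [t tB ht] := hf _ e0; have [s sB hs] := hg _ e0; exists (tmul t s).
  apply: le_trans (nwM _ _ W) _; apply: ler_pM => //; apply: nw_ge0 => k; exact: weight_ge0.
move=> x; rewrite evM.
rewrite (_ : _ - _ = f x * (g x - ev s x) + (f x - ev t x) * ev s x); last by ring.
have h1 : cabs (ev s x) <= B'.
  by rewrite (le_trans (cabs_ev _ _ _) sB)// => k; case: W.
apply: le_trans (cabs_add_le (cabs_mul_le (wle_sup x W hf) (hs x)) (cabs_mul_le (ht x) h1)) _.
by rewrite [X in _ + X]mulrC -mulrDl mulrA ler_pdivrMr; nra.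
Qed.
Lemma wle_cst w (c : C) : w 0 = 1 -> wle w (fun=> c) (cabs c).
Proof.
move=> w0; apply: (@eq_wle _ (ev [:: (0, c)])).
  by move=> x; rewrite ev1 mul0r e0 mulr1.
by apply: wle_ev; rewrite nw1 w0 mulr1.
Qed.
Lemma wle_conj w f B : (forall k, w (- k) = w k) -> wle w f B ->
  wle w (fun x => conjc (f x)) B.
Proof.
move=> ws h eta /h [t tB ht]; exists (tconj t); first by rewrite nwJ.
by move=> x; rewrite evJ -conjcB cabsJ.
Qed.
Lemma wle_shift w f B (al : R) : (forall k, 0 <= w k) -> wle w f B ->
  wle w (fun x => f (x + al)) B.
Proof.
move=> w0 h eta /h [t tB ht]; exists (tmap (fun k => e (k%:~R * al)) t).
  rewrite -[B]mul1r (le_trans _ (ler_wpM2l ler01 tB))// nw_map// => p _.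
  by rewrite cabs_e.
by move=> x; rewrite ev_shift.
Qed.
Lemma wle_Re w f B : (forall k, 0 <= w k) -> (forall k, w (- k) = w k) -> wle w f B ->
  wle w (fun x => (complex.Re (f x))%:C) B.
Proof.
move=> w0 ws h.
apply: (@eq_wle _ (fun x => 2^-1 * (f x + conjc (f x)))).
  by move=> x; rewrite addcJ mulrA mulVf ?mul1r// pnatr_eq0.
rewrite (_ : B = 2^-1 * (B + B)); last by field.
apply: wle_scale => //; last by apply: wle_add => //; apply: wle_conj.
by rewrite cabsV cabs_nat.
Qed.
Lemma wle_Im w f B : (forall k, 0 <= w k) -> (forall k, w (- k) = w k) -> wle w f B ->
  wle w (fun x => (complex.Im (f x))%:C) B.
Proof.
move=> w0 ws h; apply: (@eq_wle _ (fun x => (complex.Re (- 'i * f x))%:C)).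
  by move=> x; rewrite ReM /=; congr (_%:C); ring.
apply: wle_Re => //; rewrite -[B]mul1r; apply: wle_scale => //.
by rewrite cabsN cabsi.
Qed.

(** The functions obey the recursion g_(n+1) = g_n (1 + f) + n f^2, whose coefficients are
    nonnegative; the bounds obey the same recursion with f replaced by b. *)
Lemma wle_powB w f (b : R) (n : nat) : weight w -> wle w f b ->
  wle w (fun x => (1 + f x) ^+ n - 1 - n%:R * f x) ((1 + b) ^+ n - 1 - n%:R * b).
Proof.
move=> W h; have w0 k := weight_ge0 k W.
elim: n => [|n IH].
  apply: (@eq_wle _ (fun=> 0)) => [x|]; first by rewrite !expr0; ring.
  rewrite (_ : _ - _ - _ = cabs (0 : C)); first by apply: wle_cst; case: W.
  by rewrite cabs0 expr0; ring.
apply: (@eq_wle _ (fun x => ((1 + f x) ^+ n - 1 - n%:R * f x) * (1 + f x) +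
  n%:R * (f x * f x))).
  by move=> x; rewrite exprS -natr1; ring.
rewrite (_ : _ ^+ n.+1 - _ - _ = ((1 + b) ^+ n - 1 - n%:R * b) * (1 + b) + n%:R * (b * b));
  last by rewrite exprS -natr1; ring.
apply: wle_add.
  apply: wle_mul => //; apply: wle_add => //.
  by rewrite -[X in wle _ _ X](@cabs1 R); apply: wle_cst; case: W.
apply: wle_scale => //; last exact: wle_mul.
by rewrite cabs_nat.
Qed.

Lemma pow_quadratic_bound (b : R) (n : nat) : 0 <= b -> n%:R * b <= 1 ->
  (1 + b) ^+ n <= 1 + n%:R * b + (n%:R * b) ^+ 2.
Proof.
move=> b0; elim: n => [|n IH] h; first by rewrite expr0; nra.
have n0 : 0 <= n%:R :> R by [].
have {}IH : (1 + b) ^+ n <= 1 + n%:R * b + (n%:R * b) ^+ 2.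
  by apply: IH; apply: le_trans h; rewrite ler_wpM2r// ler_nat.
rewrite -natr1 exprS in h *; have := ler_wpM2l (addr_ge0 ler01 b0) IH; nra.
Qed.

Lemma cabs_expB (a c : C) (M : R) (n : nat) : 1 <= M -> cabs a <= M -> cabs c <= M ->
  cabs (a ^+ n - c ^+ n) <= n%:R * M ^+ n * cabs (a - c).
Proof.
move=> M1 aM cM; have M0 : 0 <= M by lra.
elim: n => [|n IH]; first by rewrite !expr0 subrr cabs0 !mul0r.
rewrite (_ : _ - _ = a * (a ^+ n - c ^+ n) + (a - c) * c ^+ n); last by rewrite !exprS; ring.
have h : cabs (c ^+ n) <= M ^+ n by rewrite cabsX lerXn2r ?nnegrE ?cabs_ge0.
apply: le_trans (cabs_add_le (cabs_mul_le aM IH) (cabs_mul_le (lexx _) h)) _.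
rewrite -natr1 exprS.
have h2 : M ^+ n <= M * M ^+ n by rewrite ler_peMl// exprn_ge0.
have := ler_wpM2l (cabs_ge0 (a - c)) h2; lra.
Qed.

Lemma cabs_powB_cis x (n : nat) : (0 < n)%N ->
  cabs ((1 + 'i * (x / n%:R)%:C) ^+ n - cis x) <= 3 * x ^+ 2 * expR `|x| / n%:R.
Proof.
move=> n0; have nz : (0 : R) < n%:R by rewrite ltr0n.
rewrite -[X in cis X](_ : (x / n%:R) *+ n = x); last first.
  by rewrite -mulr_natr divfK// gt_eqF.
rewrite cisX; set y := x / n%:R.
have ny : n%:R * `|y| = `|x|.
  by rewrite /y normrM normfV (ger0_norm (ltW nz)) mulrC divfK// gt_eqF.
apply: le_trans (cabs_expB n (_ : 1 <= 1 + `|y|) _ _) _.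
- by rewrite lerDl.
- apply: cabs_add_le; first by rewrite cabs1.
  by rewrite cabsM cabs_real cabsi mul1r.
- by rewrite cabs_cis lerDl.
have h1 : (1 + `|y|) ^+ n <= expR `|x|.
  rewrite -ny expRM_natl lerXn2r ?nnegrE ?expR_ge0 ?addr_ge0//.
  exact: expR_ge1Dx.
rewrite cabs_dist opprD addrA.
apply: le_trans (ler_pM _ (cabs_ge0 _) (ler_wpM2l (ltW nz) h1) (cabs_cisB1B_le y)) _.
  by rewrite mulr_ge0 ?exprn_ge0 ?addr_ge0.
rewrite /y exprMn exprVn le_eqVlt; apply/orP; left; apply/eqP.
by field; rewrite gt_eqF.
Qed.

Lemma archi_small (a eta : R) : 0 < eta -> exists2 n : nat, (0 < n)%N & a / n%:R <= eta.
Proof.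
move=> eta0; pose n := (Num.trunc (`|a| / eta)).+1; exists n => //.
have n0 : (0 : R) < n%:R by rewrite ltr0n.
rewrite ler_pdivrMr// mulrC -ler_pdivrMr//.
have := truncnS_gt (`|a| / eta); rewrite -/n => h.
by rewrite (le_trans _ (ltW h))// ler_pM2r ?invr_gt0// ler_norm.
Qed.

Section Exponential.
Variables (w : int -> R) (u : R -> R) (B : R).
Hypothesis (W : weight w) (hu : wle w (fun x => (u x)%:C) B) (B1 : B <= 1).


(** cis u is the uniform limit of (1 + i u/n)^n, and [wle_powB] bounds the part of order two and
    higher of each power by B^2, uniformly in n. *)
Lemma wle_cisB1B : wle w (fun x => cis (u x) - 1 - 'i * (u x)%:C) (B ^+ 2).
Proof.
have w0 k := weight_ge0 k W; have B0 := wle_ge0 W hu.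
apply: wle_lim => eta /(archi_small (3 * 1 * expR 1)) [n n0 hn].
have nz : (0 : R) < n%:R by rewrite ltr0n.
exists (fun x => (1 + 'i * (u x / n%:R)%:C) ^+ n - 1 - n%:R * ('i * (u x / n%:R)%:C)).
  have hf : wle w (fun x => 'i * (u x / n%:R)%:C) (B / n%:R).
    rewrite -[B / _]mul1r; apply: wle_scale => //; first by rewrite cabsi.
    apply: (@eq_wle _ (fun x => (n%:R^-1)%:C * (u x)%:C)).
      by move=> x; rewrite -rmorphM mulrC.
    by rewrite mulrC; apply: wle_scale => //; rewrite cabs_real ger0_norm ?invr_ge0.
  apply: wle_mono (wle_powB n W hf).
  have h : n%:R * (B / n%:R) = B by rewrite mulrC divfK// gt_eqF.
  have := @pow_quadratic_bound (B / n%:R) n (divr_ge0 B0 (ltW nz)); rewrite h.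
  by move=> /(_ B1); lra.
move=> x; have ux : `|u x| <= B by rewrite -cabs_real; exact: (wle_sup x W hu).
have -> : n%:R * ('i * (u x / n%:R)%:C) = 'i * (u x)%:C.
  rewrite mulrCA natC -rmorphM.
  by rewrite mulrCA divff ?gt_eqF// mulr1.
rewrite (_ : _ - _ - _ - _ = - ((1 + 'i * (u x / n%:R)%:C) ^+ n - cis (u x))); last by ring.
rewrite cabsN (le_trans (cabs_powB_cis _ n0))// (le_trans _ hn)//.
apply: ler_wpM2r; first by rewrite invr_ge0 ltW.
apply: ler_pM => //; rewrite ?expR_ge0 ?(mulr_ge0 (ler0n _ 3) (sqr_ge0 _))//; last by rewrite ler_expR (le_trans ux).
by rewrite ler_pM2l// -(real_normK (num_real (u x))) expr_le1// (le_trans ux).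
Qed.

Lemma wle_cisB1 : wle w (fun x => cis (u x) - 1) (2 * B).
Proof.
have w0 k := weight_ge0 k W; have B0 := wle_ge0 W hu.
apply: (@eq_wle _ (fun x => (cis (u x) - 1 - 'i * (u x)%:C) + 'i * (u x)%:C)).
  by move=> x; rewrite subrK.
apply: wle_mono (wle_add wle_cisB1B (wle_scale w0 (_ : cabs 'i <= 1) hu)); last by rewrite cabsi.
by have := ler_wpM2r B0 B1; rewrite expr2; lra.
Qed.

Lemma wle_cis : wle w (fun x => cis (u x)) (1 + 2 * B).
Proof.
apply: (@eq_wle _ (fun x => 1 + (cis (u x) - 1))); first by move=> x; rewrite addrC subrK.
apply: wle_add wle_cisB1; rewrite -[X in wle _ _ X](@cabs1 R); apply: wle_cst.
by case: W.
Qed.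
End Exponential.

End WienerNorm.

(** * Frequency splitting and the cohomological equation *)

Section Splitting.
Variable R : realType.
Local Open Scope complex_scope.
Local Notation C := R[i].
Local Notation tpoly := (seq (int * C)).
Implicit Types (t s : tpoly) (w : int -> R) (f g : R -> C) (k l : int) (x B : R) (S : pred int).

(** For an exact polynomial with frequencies in [S] each coefficient can be divided by its own
    divisor, which the approximants behind [wle] do not provide. *)
Definition wfin S w f B := exists t : tpoly,
  [/\ forall x, f x = ev t x, nw w t <= B & forall p, p \in t -> S p.1].

Lemma wfin_wle S w f B : wfin S w f B -> wle w f B.
Proof.
by case=> t [ft tB _]; apply: (@eq_wle _ _ (ev t)) => [x|]; [rewrite ft|exact: wle_ev].
Qed.

Definition irange (N : nat) : seq int := [seq i%:Z - N%:Z | i <- iota 0 (N.*2.+1)].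

Lemma mem_irange N k : (k \in irange N) = (`|k| <= N)%N.
Proof.
apply/mapP/idP => [ [j]|h]; first by rewrite mem_iota => /andP[_ h] ->; lia.
by exists (`|(k + N%:Z)%R|%N); [rewrite mem_iota|]; lia.
Qed.
Lemma irange_uniq N : uniq (irange N).
Proof. by rewrite map_inj_uniq ?iota_uniq// => i j; lia. Qed.

Lemma sum_group (V : nmodType) (ks : seq int) t (F : int * C -> V) : uniq ks ->
  \sum_(k <- ks) \sum_(p <- t | p.1 == k) F p = \sum_(p <- t | p.1 \in ks) F p.
Proof.
move=> U; rewrite (exchange_big_dep xpredT) //= [RHS]big_mkcond; apply: eq_bigr => p _.
rewrite (eq_bigl (pred1 p.1)) => [|k]; last by rewrite eq_sym.
case: ifP => h; first by rewrite -big_filter filter_pred1_uniq ?big_seq1.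
by rewrite big_seq_cond big1// => k /andP[hk /eqP kp]; rewrite -kp hk in h.
Qed.

Lemma nw_coef_le w t (ks : seq int) : (forall k, 0 <= w k) -> uniq ks ->
  \sum_(k <- ks) cabs (coef t k) * w k <= nw w t.
Proof.
move=> w0 U; apply: (@le_trans _ _ (\sum_(k <- ks) \sum_(p <- t | p.1 == k) cabs p.2 * w p.1)).
  apply: ler_sum => k _; rewrite (eq_bigr (fun p => cabs p.2 * w k)) => [|p /eqP -> //].
  by rewrite -big_distrl ler_wpM2r// cabs_sum.
rewrite sum_group// /nw big_mkcond; apply: ler_sum => p _.
by case: ifP => // _; rewrite mulr_ge0 ?cabs_ge0.
Qed.

Lemma coef_cat t s k : coef (t ++ s) k = coef t k + coef s k.
Proof. by rewrite /coef big_cat. Qed.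
Lemma coef_tmap (c : int -> C) t k : coef (tmap c t) k = c k * coef t k.
Proof.
by rewrite /coef big_map /= big_distrr; apply: eq_bigr => p /eqP ->.
Qed.

Lemma cabs_coefB t s k (M : R) : (forall x, cabs (ev t x - ev s x) <= M) ->
  cabs (coef t k - coef s k) <= M.
Proof.
move=> h; rewrite (_ : _ - _ = coef (t ++ tmap (fun=> -1) s) k).
  by apply: cabs_coef => x; rewrite ev_cat ev_scale mulN1r.
by rewrite coef_cat coef_tmap mulN1r.
Qed.

(* The low-frequency part is built from the limits of the coefficients of the
   approximating trigonometric polynomials. *)
Lemma wle_split w f B S (N : nat) : (forall k, 0 <= w k) ->
  (forall k, S k -> `|k| <= N)%N -> wle w f B ->
  exists lo, wfin S w lo B /\ forall w' (g : R), 0 <= g -> (forall k, 0 <= w' k) ->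
    (forall k, ~~ S k -> w' k <= g * w k) -> wle w' (fun x => f x - lo x) (g * B).
Proof.
move=> w0 SN hf; pose eta n : R := n.+1%:R^-1.
have eta0 n : 0 < eta n by rewrite invr_gt0.
have [T hT] : {T : nat -> tpoly & forall n, nw w (T n) <= B /\
    forall x, cabs (f x - ev (T n) x) <= eta n}.
  apply: (@choice _ _ (fun n t => nw w t <= B /\ forall x, cabs (f x - ev t x) <= eta n)).
  by move=> n; have [t tB ht] := hf _ (eta0 n); exists t.
have etaC : eta n @[n --> \oo] --> (0 : R) by exact: cvg_harmonic.
have eta1 n : eta n <= 1 by rewrite invf_le1// ler1n.
have cauchy k m n : cabs (coef (T m) k - coef (T n) k) <= eta m + eta n.
  apply: cabs_coefB => x.
  rewrite (_ : _ - _ = (f x - ev (T n) x) - (f x - ev (T m) x)); last by ring.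
  by rewrite [leRHS]addrC cabs_sub_le//; [exact: (hT n).2|exact: (hT m).2].
have [c hc] : {c : int -> C & forall k n, cabs (c k - coef (T n) k) <= 2 * eta n}.
  apply: (@choice _ _ (fun k z => forall n, cabs (z - coef (T n) k) <= 2 * eta n)) => k.
  have hb n : cabs (coef (T n) k) <= cabs (coef (T 0%N) k) + 2.
    rewrite (_ : coef (T n) k = coef (T 0%N) k + (coef (T n) k - coef (T 0%N) k)); last by ring.
    apply: cabs_add_le => //; apply: le_trans (cauchy _ _ _) _.
    by have := eta1 n; have := eta1 0%N; lra.
  by have [z hz _] := ulimC_limit hb (cauchy k) etaC; exists z.
pose ks := [seq k <- irange N | S k].
have ksS k : (k \in ks) = S k.
  by rewrite mem_filter mem_irange; case: (boolP (S k)) => // /SN ->.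
have ksU : uniq ks by rewrite filter_uniq ?irange_uniq.
pose lo : tpoly := [seq (k, c k) | k <- ks].
exists (ev lo); split.
  exists lo; split => // [|p /mapP[k kk ->]]; last by rewrite /= -ksS.
  pose W := \sum_(k <- ks) w k.
  have W0 : 0 <= W by apply: sumr_ge0.
  (* On a finite window the error [2 * eta] made on each coefficient adds up to a quantity that
     tends to 0, so the bound [B] passes to the limit without loss. *)
  apply/ler_addgt0Pr => d d0; have [n n0 hn] := archi_small (2 * W) d0.
  have [tB _] := hT n.-1; rewrite /nw big_map /=.
  apply: (@le_trans _ _ (\sum_(k <- ks) (cabs (coef (T n.-1) k) * w k + 2 * eta n.-1 * w k))).
    apply: ler_sum => k _; rewrite -mulrDl ler_wpM2r//.
    rewrite (_ : c k = coef (T n.-1) k + (c k - coef (T n.-1) k)); last by ring.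
    exact: cabs_add_le.
  rewrite big_split /= lerD//; first exact: le_trans (nw_coef_le _ w0 ksU) tB.
  by rewrite -big_distrr /= -/W /eta prednK// mulrAC.
move=> w' g g0 w'0 hg d d0.
pose W : R := (size ks)%:R.
have [n n0 hn] := archi_small (1 + 2 * W) d0; have [tB ht] := hT n.-1.
(* The remainder is approximated by the high part of an approximant; the mismatch between the low
   coefficients of the latter and [c] adds at most [2 * W / n], uniformly in x. *)
exists (seq.filter (fun p => ~~ S p.1) (T n.-1)).
  rewrite (le_trans _ (ler_wpM2l g0 (le_trans (nw_filter (fun p => ~~ S p.1) (T n.-1) w0) tB)))//.
  by apply: nw_le => // p; rewrite mem_filter => /andP[+ _]; exact: hg.
move=> x; apply: le_trans hn.
have E : ev (T n.-1) x = \sum_(k <- ks) coef (T n.-1) k * e (k%:~R * x) +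
    ev (seq.filter (fun p => ~~ S p.1) (T n.-1)) x.
  rewrite (ev_filter (fun p => S p.1)); congr (_ + _).
  rewrite (eq_bigr (fun k => \sum_(p <- T n.-1 | p.1 == k) p.2 * e (p.1%:~R * x))).
    by rewrite sum_group// /ev big_filter; apply: eq_bigl => p; rewrite ksS.
  by move=> k _; rewrite /coef big_distrl; apply: eq_bigr => p /eqP ->.
rewrite (_ : f x - ev lo x - _ = (f x - ev (T n.-1) x) +
  (\sum_(k <- ks) (coef (T n.-1) k - c k) * e (k%:~R * x))); last first.
  rewrite E /ev big_map /=.
  under [X in _ = _ + X]eq_bigr do rewrite mulrBl.
  by rewrite sumrB; ring.
rewrite mulrDl; apply: cabs_add_le; first by rewrite mul1r /eta -{2}(prednK n0).
apply: le_trans (cabs_sum _ _ _) _.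
apply: (@le_trans _ _ (\sum_(k <- ks) 2 * eta n.-1)).
  by apply: ler_sum => k _; rewrite cabsM cabs_e mulr1 cabs_dist.
rewrite big_const_seq count_predT iter_addr_0 -mulr_natr /eta prednK// -/W.
by rewrite le_eqVlt; apply/orP; left; apply/eqP; rewrite /W; ring.
Qed.

Lemma wfin_filter S S1 w f B : (forall k, 0 <= w k) -> wfin S w f B ->
  exists g h, [/\ wfin (predI S S1) w g B, wfin (predD S S1) w h B &
    forall x, f x = g x + h x].
Proof.
move=> w0 [t [ft tB tS]].
exists (ev (seq.filter (fun p => S1 p.1) t)), (ev (seq.filter (predC (fun p => S1 p.1)) t)).
split.
- exists (seq.filter (fun p => S1 p.1) t); split => //.
    exact: le_trans (nw_filter _ _ w0) tB.
  by move=> p; rewrite mem_filter /= => /andP[-> /tS ->].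
- exists (seq.filter (predC (fun p => S1 p.1)) t); split => //.
    exact: le_trans (nw_filter _ _ w0) tB.
  by move=> p; rewrite mem_filter /= => /andP[-> /tS ->].
- by move=> x; rewrite ft (ev_filter (fun p => S1 p.1)).
Qed.

Lemma wfin_add S w f g B B' : wfin S w f B -> wfin S w g B' ->
  wfin S w (fun x => f x + g x) (B + B').
Proof.
move=> [t [ft tB tS]] [s [gs sB sS]]; exists (t ++ s); split.
- by move=> x; rewrite ev_cat ft gs.
- by rewrite nw_cat lerD.
- by move=> p; rewrite mem_cat => /orP[/tS|/sS].
Qed.

Lemma wfin_Re S w f B : (forall k, w (- k) = w k) -> (forall k, S k -> S (- k)) ->
  wfin S w f B -> wfin S w (fun x => (complex.Re (f x))%:C) B.
Proof.
move=> ws SS [t [ft tB tS]]; exists (tmap (fun=> 2^-1) (t ++ tconj t)); split.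
- by move=> x; rewrite ev_scale ev_cat evJ -ft addcJ mulrA mulVf ?mul1r// pnatr_eq0.
- apply: le_trans (@nw_map _ w w _ 2^-1 _ _ _) _ => [//|p _|].
    by rewrite cabsV cabs_nat.
  by rewrite nw_cat nwJ//; lra.
- move=> p /mapP[q + ->] /=; rewrite mem_cat => /orP[/tS//|/mapP[q' /tS h ->] /=].
  exact: SS.
Qed.

Lemma wfin_weight S w w' f B (M : R) : 0 <= M -> (forall k, S k -> w' k <= M * w k) ->
  wfin S w f B -> wfin S w' f (M * B).
Proof.
move=> M0 h [t [ft tB tS]]; exists t; split => //.
by apply: le_trans (ler_wpM2l M0 tB); apply: nw_le => // p /tS; exact: h.
Qed.

Lemma wfin_mono S w f B B' : B <= B' -> wfin S w f B -> wfin S w f B'.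
Proof. by move=> BB [t [ft tB tS]]; exists t; split => //; exact: le_trans BB. Qed.

(** The equation is diagonal in Fourier modes, with divisors a e(k al) - b. The change of weight
    from [w] to [w'] is allowed to pay for them. *)
Lemma wfin_cohom S w w' f B (M al : R) (a b : C) : 0 <= M ->
  (forall k, S k -> w' k <= M * w k * cabs (a * e (k%:~R * al) - b) /\
     a * e (k%:~R * al) - b != 0) -> wfin S w f B ->
  exists2 m, wfin S w' m (M * B) & forall x, a * m (x + al) - b * m x = f x.
Proof.
move=> M0 h [t [ft tB tS]]; pose D k := a * e (k%:~R * al) - b.
exists (ev (tmap (fun k => (D k)^-1) t)).
  exists (tmap (fun k => (D k)^-1) t); split => //; last by move=> p /mapP[q /tS ? ->].
  apply: le_trans (ler_wpM2l M0 tB); apply: nw_map => // p /tS /h [h1 h2].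
  rewrite cabsV mulrC ler_pdivrMr// lt_neqAle cabs_ge0 andbT eq_sym.
  by apply/negP => /eqP/cabs_eq0/eqP; apply/negP.
move=> x; rewrite -ev_shift ft /ev /tmap -map_comp !big_map !big_distrr /= -sumrB big_seq.
rewrite [RHS]big_seq; apply: eq_bigr => p /tS /h [_ h2] /=.
by rewrite -/(D p.1) in h2 *; rewrite /D in h2 *; field.
Qed.
End Splitting.

(** * Exponentials of large phases with bounded bandwidth *)

Section LargeExponential.
Variable R : realType.
Local Open Scope complex_scope.
Local Notation C := R[i].
Local Notation tpoly := (seq (int * C)).
Implicit Types (t s : tpoly) (w : int -> R) (f g : R -> C) (k l : int) (x h : R).

Definition tpow t (n : nat) : tpoly := iter n (tmul t) [:: (0, 1)].
(** Multiplying the k-th coefficient by exp(k h) amounts to evaluating the polynomial on a line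
    parallel to the real axis in the complex plane. *)
Definition twist h t : tpoly := tmap (fun k => (expR (k%:~R * h))%:C) t.

Lemma ev_tpow t n x : ev (tpow t n) x = ev t x ^+ n.
Proof.
elim: n => [|n IH]; first by rewrite /tpow /= ev1 mul0r e0 mulr1 expr0.
by rewrite /tpow iterS evM -/(tpow t n) IH exprS.
Qed.
Lemma ev_twistM h t s x : ev (twist h (tmul t s)) x = ev (twist h t) x * ev (twist h s) x.
Proof.
rewrite -evM /twist /tmul /tmap /ev map_allpairs !big_allpairs_dep /= big_map.
apply: eq_bigr => p _; rewrite big_map; apply: eq_bigr => q _ /=.
by rewrite intrD !mulrDl expRD rmorphM eD; ring.
Qed.
Lemma ev_twist_tpow h t n x : ev (twist h (tpow t n)) x = ev (twist h t) x ^+ n.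
Proof.
elim: n => [|n IH]; first by rewrite /twist /tpow /= ev1 !mul0r expR0 e0 !mulr1 expr0.
by rewrite /tpow iterS ev_twistM -/(tpow t n) IH exprS.
Qed.

(** Cauchy's estimate: the bound at [h] serves the nonnegative frequencies, the one at [- h] the
    negative frequencies. *)
Lemma coef_twist_le t k (h M : R) : (forall x, cabs (ev (twist h t) x) <= M) ->
  (forall x, cabs (ev (twist (- h) t) x) <= M) ->
  cabs (coef t k) <= M * expR (- (`|k%:~R : R| * h)).
Proof.
move=> h1 h2.
have H h' : (forall x, cabs (ev (twist h' t) x) <= M) ->
    cabs (coef t k) <= M * expR (- (k%:~R * h')).
  move=> /(cabs_coef k); rewrite coef_tmap cabsM cabs_real ger0_norm ?expR_ge0// => H.
  have E : expR (k%:~R * h') * expR (- (k%:~R * h')) = 1 by rewrite expRxMexpNx_1.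
  have := ler_wpM2r (expR_ge0 (- (k%:~R * h'))) H.
  by rewrite mulrAC E mul1r.
case: (leP 0 (k%:~R : R)) => k0; first by rewrite ger0_norm ?H.
by rewrite ltr0_norm// mulNr -mulrN; exact: H.
Qed.

Lemma abs_expRB1_le (y : R) : `|y| <= 2^-1 -> `|expR y - 1| <= 2 * `|y|.
Proof.
move=> y2; case: (leP 0 y) => y0.
  rewrite (ger0_norm y0) in y2 *; have := expR_ge1Dx y; have := expR_ge1Dx (- y).
  have := expRxMexpNx_1 y; have := expR_ge0 y; move: (expR y) (expR (- y)) => a b a0 ab h1 h2.
  by rewrite ger0_norm; nra.
rewrite (ltr0_norm y0) in y2 *; have := expR_ge1Dx y => h1.
have : expR y <= 1 by rewrite expR_le1 ltW.
by move=> h2; rewrite ler0_norm; lra.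
Qed.

Lemma geometric_bound (rho : R) n : 0 <= rho < 1 ->
  \sum_(i < n) rho ^+ i <= (1 - rho)^-1.
Proof.
move=> /andP[r0 r1]; have h : 0 < 1 - rho by lra.
rewrite -[leRHS]mul1r ler_pdivlMr// mulrC.
rewrite -opprB mulNr -subrX1 opprB.
by rewrite gerBl exprn_ge0.
Qed.

(** Each half-line of frequencies is dominated by a geometric series of ratio exp(-1/(4L)), whose
    sum is at most 5L. *)
Lemma sum_expR_bound (L : R) (ks : seq int) : 1 <= L -> uniq ks ->
  \sum_(k <- ks) expR (- (`|k%:~R : R| / (4 * L))) <= 10 * L.
Proof.
move=> L1 U; pose rho := expR (- (4 * L)^-1).
have y0 : 0 < (4 * L)^-1 by rewrite invr_gt0; lra.
have r0 : 0 <= rho by exact: expR_ge0.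
have r1 : (1 - rho)^-1 <= 5 * L.
  have := expR_ge1Dx (4 * L)^-1; have := expRxMexpNx_1 (4 * L)^-1; rewrite -/rho.
  have yL : (4 * L)^-1 * (4 * L) = 1 by rewrite mulVf//; lra.
  move: (expR _) => a ab h; have rl : 5 * L * (1 - rho) >= 1.
    have := ler_wpM2r r0 h; rewrite ab => h2.
    have L4 : 0 <= 4 * L by lra.
    have := ler_wpM2r L4 h2; rewrite mul1r.
    have -> : (1 + (4 * L)^-1) * rho * (4 * L) = 4 * L * rho + (4 * L)^-1 * (4 * L) * rho by ring.
    by rewrite yL mul1r; nra.
  have d0 : 0 < 1 - rho by rewrite subr_gt0 /rho expR_lt1; lra.
  by rewrite -[leLHS]mul1r ler_pdivrMr.
have rlt : rho < 1 by rewrite /rho expR_lt1; lra.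
have expE (k : int) : expR (- (`|k%:~R : R| / (4 * L))) = rho ^+ `|k|%N.
  rewrite /rho -expRM_natl; congr expR; rewrite mulrN; congr (- (_ * _)).
  by rewrite natr_absz intr_norm.
under eq_bigr do rewrite expE.
have [N hN] : exists N, forall k, k \in ks -> (`|k| < N)%N.
  elim: (ks) => [|k s [N IH]]; first by exists 0%N.
  exists (maxn N `|k|.+1) => l; rewrite inE => /orP[/eqP->|/IH]; rewrite leq_max ?ltnSn ?orbT//.
  by move=> ->.
pose sub (b : bool) := [seq `|k|%N | k <- ks & (0 <= k) == b].
have hs b : \sum_(j <- sub b) rho ^+ j <= 5 * L.
  apply: le_trans r1; apply: le_trans (geometric_bound N _); last by rewrite r0.
  rewrite -(big_mkord xpredT (fun i => rho ^+ i)) /index_iota subn0.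
  have Us : uniq (sub b).
    rewrite map_inj_in_uniq ?filter_uniq// => k l; rewrite !mem_filter.
    by move=> /andP[/eqP hk _] /andP[/eqP hl _]; lia.
  have sN : {subset sub b <= iota 0 N}.
    by move=> j /mapP[k]; rewrite mem_filter => /andP[_ /hN kN] ->; rewrite mem_iota.
  rewrite (perm_big [seq j <- iota 0 N | j \in sub b]) /=; last first.
    apply: uniq_perm; rewrite ?filter_uniq ?iota_uniq// => j.
    by rewrite mem_filter; case: (boolP (j \in sub b)) => // /sN ->.
  rewrite big_filter big_mkcond; apply: ler_sum => j _.
  by case: ifP => // _; rewrite exprn_ge0.
rewrite (bigID (fun k => (0 <= k) == true)) /=.
have -> : 10 * L = 5 * L + 5 * L by ring.
apply: lerD.
  by have := hs true; rewrite /sub big_map big_filter.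
have := hs false; rewrite /sub big_map big_filter.
by rewrite (eq_bigl (fun k : int => ~~ ((0 <= k) == true))) // => k; case: (0 <= k).
Qed.

(* A real phase of bandwidth at most a fraction of [L]: on the circles of radius
   [exp (+-1/(2L))] the modulus of [exp (i psi)] stays bounded, so its Fourier
   coefficients decay like [exp (-|k|/(2L))], whatever the size of [psi] is. *)
Lemma wle_cis_bandwidth (w : int -> R) (psi : R -> R) (L C0 : R) : 1 <= L ->
  (forall k, 0 <= w k) -> (forall k, w k <= C0 * expR (`|k%:~R : R| / (4 * L))) ->
  wfin (fun k => `|k%:~R : R| <= L) (fun k => `|k%:~R : R|) (fun x => (psi x)%:C) (L / 16) ->
  wle w (fun x => cis (psi x)) (20 * C0 * L).
Proof.
move=> L1 w0 wC [t [pt tB tL]].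
have L0 : 0 < L by lra.
pose h : R := (2 * L)^-1; have h0 : 0 < h by rewrite invr_gt0; lra.
pose Z := \sum_(p <- t) 2 * cabs p.2.
have Z0 : 0 <= Z by apply: sumr_ge0 => p _; rewrite mulr_ge0 ?cabs_ge0.
have hL (p : int * C) : p \in t -> `|p.1%:~R : R| * h <= 2^-1.
  move=> /tL pL; apply: le_trans (ler_wpM2r (ltW h0) pL) _.
  by rewrite /h invfM mulrCA mulfV ?mulr1// gt_eqF.
have twB (hh : R) x : `|hh| = h -> cabs (ev (twist hh t) x) <= Z.
  move=> hE; apply: le_trans (cabs_sum _ _ _) _; rewrite /twist /tmap big_map big_seq /Z.
  rewrite [leRHS]big_seq; apply: ler_sum => p pt' /=.
  rewrite !cabsM cabs_e mulr1 cabs_real ger0_norm ?expR_ge0// ler_wpM2r ?cabs_ge0//.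
  have := @abs_expRB1_le (p.1%:~R * hh); rewrite normrM hE => /(_ (hL _ pt')).
  have := hL _ pt'; rewrite ler_norml => H1 /andP[_ H2].
  by apply: (@le_trans _ _ (1 + 2 * (`|p.1%:~R : R| * h))); lra.
(* As [psi] is real, only the factors exp(k hh) - 1 produce an imaginary part. They are at most
   2|k|h, so the first-moment norm L/16 suffices, however large [psi] is. *)
have twI (hh : R) x : `|hh| = h -> `|complex.Im (ev (twist hh t) x)| <= 16^-1.
  move=> hE.
  have E : ev (twist hh t) x = (psi x)%:C +
      ev (tmap (fun k => (expR (k%:~R * hh) - 1)%:C) t) x.
    rewrite pt /ev /twist /tmap !big_map -big_split /=; apply: eq_bigr => p _.
    by rewrite rmorphB rmorph1; ring.
  rewrite E ImD /= add0r; apply: le_trans (Im_le_cabs _) _.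
  apply: le_trans (cabs_sum _ _ _) _; rewrite /tmap big_map.
  have LL : (L / 16) * (2 * h) = 16^-1 by rewrite /h invfM; field; lra.
  rewrite -LL; apply: le_trans (ler_wpM2r (_ : 0 <= 2 * h) tB); last by lra.
  rewrite /nw big_distrl /= big_seq [leRHS]big_seq; apply: ler_sum => p pt' /=.
  rewrite !cabsM cabs_e mulr1 cabs_real.
  have := @abs_expRB1_le (p.1%:~R * hh); rewrite normrM hE => /(_ (hL _ pt')) H.
  have := ler_wpM2r (cabs_ge0 p.2) H; lra.
have psiZ x : `|psi x| <= Z.
  rewrite -cabs_real pt; apply: le_trans (cabs_sum _ _ _) _; apply: ler_sum => p _.
  by rewrite cabsM cabs_e; have := cabs_ge0 p.2; lra.
have E2 : expR (2^-1 : R) <= 2.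
  have := expR_ge1Dx (- 2^-1 : R); have := expRxMexpNx_1 (2^-1 : R); have := expR_ge0 (2^-1 : R).
  by move: (expR _) (expR _) => a b; nra.
move=> eta eta0.
have [n1 n10 hn1] := archi_small (3 * Z ^+ 2 * expR Z) eta0.
have [n2 n20 hn2] := archi_small (Z ^+ 2) (ltac:(lra) : 0 < 4^-1 :> R).
pose n := maxn n1 n2; have n0 : (0 < n)%N by rewrite leq_max n10.
have nz : (0 : R) < n%:R by rewrite ltr0n.
have le_n m (a : R) : (0 < m)%N -> (m <= n)%N -> 0 <= a -> a / n%:R <= a / m%:R.
  by move=> m0 mn a0; rewrite ler_wpM2l// lef_pV2 ?posrE ?ltr0n// ler_nat.
pose s : tpoly := (0, 1) :: tmap (fun=> 'i * (n%:R^-1)%:C) t.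
have evs hh x : ev (twist hh s) x = 1 + 'i * (n%:R^-1)%:C * ev (twist hh t) x.
  rewrite /ev /twist /tmap /s /= big_cons -map_comp !big_map /= !mul0r expR0 e0 !mulr1.
  congr (_ + _); rewrite big_distrr; apply: eq_bigr => p _ /=; ring.
(* With z the twisted phase, |1 + iz/n|^2 = 1 - 2 Im z/n + |z|^2/n^2 is at most 1 + 1/(2n): [twI]
   bounds the second term and the choice of [n2] the third. The n-th power is therefore at most
   exp(1/4). *)
have tw2 (hh : R) x : `|hh| = h -> cabs (ev (twist hh (tpow s n)) x) <= 2.
  move=> hE; rewrite ev_twist_tpow cabsX evs.
  have := twI hh x hE; have := twB hh x hE; move: (ev _ _) => z zZ zI.
  apply: le_trans (_ : _ <= expR (4^-1 * n%:R^-1) ^+ n) _.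
    rewrite lerXn2r ?nnegrE ?cabs_ge0 ?expR_ge0//.
    rewrite -(@ler_pXn2r _ 2) ?nnegrE ?cabs_ge0 ?expR_ge0//.
    apply: le_trans (_ : _ <= 1 + 2^-1 * n%:R^-1) _; last first.
      rewrite -expRM_natl; apply: le_trans (expR_ge1Dx _) _.
      by rewrite ler_expR; lra.
    have -> : cabs (1 + 'i * (n%:R^-1)%:C * z) ^+ 2 =
        1 - 2 * complex.Im z / n%:R + cabs z ^+ 2 / n%:R ^+ 2.
      by rewrite !cabs_sq; case: (z) => a b /=; field; rewrite gt_eqF.
    have H1 : cabs z ^+ 2 / n%:R ^+ 2 <= 4^-1 / n%:R.
      rewrite (expr2 n%:R) invfM mulrA ler_pM2r ?invr_gt0//.
      apply: le_trans hn2; apply: le_trans (le_n n2 _ n20 (leq_maxr _ _) (sqr_ge0 _)).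
      by rewrite ler_pM2r ?invr_gt0// lerXn2r ?nnegrE ?cabs_ge0.
    have H2 : `|complex.Im z| / n%:R <= 16^-1 / n%:R.
      by rewrite ler_pM2r ?invr_gt0.
    have H3 : - complex.Im z / n%:R <= `|complex.Im z| / n%:R.
      by rewrite ler_pM2r ?invr_gt0// -normrN ler_norm.
    have K (a b c d : R) : 0 < d -> b <= 4^-1 * d -> c <= 16^-1 * d -> - a <= c ->
      1 - 2 * a + b <= 1 + 2^-1 * d by move=> *; lra.
    by rewrite -mulrA; apply: (K _ _ _ _ _ H1 H2); rewrite ?invr_gt0// -mulNr.
  rewrite -expRM_natl mulrCA divff ?gt_eqF// mulr1.
  by apply: le_trans E2; rewrite ler_expR; lra.
(* Frequencies are collected so that the norm runs over distinct k, each with coefficient at most 2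
   exp(-|k|/(2L)); the weight consumes half of this decay. *)
exists (merge (tpow s n)); last first.
  move=> x; rewrite ev_merge ev_tpow.
  have -> : ev s x = 1 + 'i * (psi x / n%:R)%:C.
    rewrite /s /ev big_cons /= mul0r e0 mulr1; congr (_ + _).
    by rewrite -/(ev _ x) ev_scale -pt -mulrA -rmorphM [_^-1 * _]mulrC.
  rewrite cabs_dist; apply: le_trans (cabs_powB_cis _ n0) _; apply: le_trans hn1.
  apply: le_trans (le_n n1 _ n10 (leq_maxl _ _) _); last first.
    by rewrite !mulr_ge0 ?expR_ge0 ?exprn_ge0.
  apply: ler_wpM2r; first by rewrite invr_ge0 ltW.
  apply: ler_pM; rewrite ?expR_ge0 ?(mulr_ge0 (ler0n _ 3) (sqr_ge0 _))//.
    by rewrite ler_pM2l// -(real_normK (num_real (psi x))) lerXn2r ?nnegrE.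
  by rewrite ler_expR.
rewrite /nw /merge big_map /=.
have C00 : 0 <= C0.
  have := le_trans (w0 0) (wC 0); rewrite normr0 mul0r expR0 mulr1; exact: id.
rewrite (_ : 20 * C0 * L = 2 * C0 * (10 * L)); last by ring.
apply: le_trans (ler_wpM2l _ (sum_expR_bound L1 (undup_uniq (map fst (tpow s n))))); last first.
  by rewrite mulr_ge0.
rewrite big_distrr; apply: ler_sum => k _ /=.
have hE1 : `|h| = h by rewrite gtr0_norm.
have hE2 : `|- h| = h by rewrite normrN.
have H := @coef_twist_le (tpow s n) k h 2 (fun x => tw2 h x hE1) (fun x => tw2 (- h) x hE2).
apply: le_trans (ler_pM (cabs_ge0 _) (w0 _) H (wC k)) _.
rewrite mulrACA -expRD le_eqVlt; apply/orP; left; apply/eqP; congr (_ * expR _).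
by rewrite /h; field; rewrite gt_eqF.
Qed.

End LargeExponential.

(** * Wiener norms from finite differences *)

Section Interpolation.
Variable R : realType.
Local Open Scope complex_scope.
Local Notation C := R[i].
Local Notation tpoly := (seq (int * C)).
Implicit Types (w : int -> R) (f : R -> C) (k : int) (n : nat) (x h : R).

Definition fdiff (V : zmodType) h (f : R -> V) x : V := f (x + h) - f x.

Lemma fdiff_period (V : zmodType) h (f : R -> V) s : (forall x, f (x + 1) = f x) ->
  forall x, iter s (fdiff h) f (x + 1) = iter s (fdiff h) f x.
Proof.
by move=> fp; elim: s => [|s IH] x //=; rewrite /fdiff addrAC !IH.
Qed.

Definition dft f n k : C := n%:R^-1 * \sum_(j < n) f (j%:R / n%:R) * e (- (k%:~R * (j%:R / n%:R))).

Lemma dft_shift f n k : (0 < n)%N -> (forall x, f (x + 1) = f x) ->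
  dft (fun x => f (x + n%:R^-1)) n k = e (k%:~R / n%:R) * dft f n k.
Proof.
move=> n0 fp; rewrite /dft mulrCA; congr (_ * _).
have nz : n%:R != 0 :> R by rewrite pnatr_eq0; lia.
pose g (j : nat) := f (j%:R / n%:R) * e (- (k%:~R * (j%:R / n%:R))).
have gn : g n = g 0%N.
  rewrite /g mul0r mulr0 oppr0 e0 divff// -[X in f X]add0r fp !mulr1.
  by rewrite -mulrNz e_int mulr1.
have -> : \sum_(j < n) f (j%:R / n%:R) * e (- (k%:~R * (j%:R / n%:R))) = \sum_(j < n) g j.+1.
  rewrite -/(\sum_(j < n) g j); case: (n) gn => [|m] gm; first by rewrite !big_ord0.
  by rewrite big_ord_recl [RHS]big_ord_recr gm addrC.
rewrite big_distrr; apply: eq_bigr => j _; rewrite /g [RHS]mulrCA -eD; congr (f _ * e _).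
  by rewrite -natr1 mulrDl mul1r.
by rewrite -natr1; field.
Qed.

(** Discrete integration by parts: a difference of step 1/n multiplies the k-th discrete coefficient
    by e(k/n) - 1. *)
Lemma dft_fdiff f n k s : (0 < n)%N -> (forall x, f (x + 1) = f x) ->
  dft (iter s (fdiff n%:R^-1) f) n k = (e (k%:~R / n%:R) - 1) ^+ s * dft f n k.
Proof.
move=> n0 fp; elim: s => [|s IH]; first by rewrite mul1r.
rewrite iterS exprS -mulrA -IH mulrBl mul1r -dft_shift//; last exact: fdiff_period.
rewrite /dft /fdiff -mulrBr -sumrB; congr (_ * _).
by apply: eq_bigr => j _; rewrite mulrBl.
Qed.

Lemma cabs_dft f n k (M : R) : (0 < n)%N -> (forall x, cabs (f x) <= M) -> cabs (dft f n k) <= M.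
Proof.
move=> n0 h; have nz : (0 : R) < n%:R by rewrite ltr0n.
rewrite /dft cabsM cabsV cabs_nat mulrC ler_pdivrMr//.
apply: le_trans (cabs_sum _ _ _) _; apply: (@le_trans _ _ (\sum_(j < n) M)).
  by apply: ler_sum => j _; rewrite cabsM cabs_e mulr1.
by rewrite sumr_const card_ord mulr_natr.
Qed.

Lemma sum_irange (F : int -> C) M :
  \sum_(k <- irange M) F k = \sum_(i < M.*2.+1) F (i%:Z - M%:Z).
Proof. by rewrite /irange big_map -(big_mkord xpredT (fun i => F (i%:Z - M%:Z))) /index_iota subn0. Qed.

Definition interp f M : tpoly := [seq (k, dft f M.*2.+1 k) | k <- irange M].

Lemma interp_node f M (l : nat) : (l < M.*2.+1)%N ->
  ev (interp f M) (l%:R / M.*2.+1%:R) = f (l%:R / M.*2.+1%:R).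
Proof.
set n := M.*2.+1 => ln; have nz : n%:R != 0 :> C by rewrite pnatr_eq0.
rewrite /ev /interp big_map /= /dft.
under eq_bigr do rewrite -mulrA big_distrl /=.
rewrite -big_distrr exchange_big /=; apply: (mulfI nz); rewrite mulrA divff// mul1r.
rewrite (bigD1 (Ordinal ln)) //= [X in _ + X]big1 => [|j jl]; last first.
  under eq_bigr do rewrite -mulrA -eD.
  rewrite -big_distrr sum_irange /=.
  have E (i : nat) : - ((i%:Z - M%:Z)%:~R * (j%:R / n%:R)) + (i%:Z - M%:Z)%:~R * (l%:R / n%:R) =
      (l%:Z - j%:Z)%:~R * (i%:R / n%:R) - (M%:R * (l%:Z - j%:Z)%:~R / n%:R) :> R.
    by rewrite !intrB /=; field; rewrite pnatr_eq0.
  under eq_bigr do rewrite E eD.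
  rewrite -big_distrl /= sum_e_orthogonal; last by have := ltn_ord j; lia.
  rewrite subr_eq0; case: eqP => [h|_]; last by rewrite mul0r mulr0.
  by case/eqP: jl; apply: val_inj => /=; lia.
rewrite addr0 (eq_bigr (fun=> f (l%:R / n%:R))).
  by rewrite sum_irange sumr_const card_ord [RHS]mulr_natl.
by move=> k _; rewrite -mulrA -eD addNr e0 mulr1.
Qed.

(** The approximants interpolate [f] at 2M+1 equispaced nodes. Their coefficients are bounded by
    discrete integration by parts, with an order [s] chosen separately for each frequency. They
    converge uniformly because [f] and the interpolants have Lipschitz constants G 1 and 8KB,
    independent of M. *)
Lemma wle_interpolation w f (B K : R) (G : nat -> R) (cb : int -> R) :
  (forall k, 0 <= w k) -> (forall k, `|k%:~R| <= K * w k) -> (forall x, f (x + 1) = f x) ->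
  (forall s h x, 0 < h -> cabs (iter s (fdiff h) f x) <= G s * h ^+ s) ->
  G 0%N <= cb 0 -> (forall k, k != 0 -> exists s, G s <= cb k * (2 * `|k%:~R|) ^+ s) ->
  (forall M, \sum_(k <- irange M) cb k * w k <= B) -> wle w f B.
Proof.
move=> w0 wK fp hG cb0 hcb hB.
have cB M k : (`|k| <= M)%N -> cabs (dft f M.*2.+1 k) <= cb k.
  move=> kM; set n := M.*2.+1; have nz : (0 : R) < n%:R by rewrite ltr0n.
  have [->|k0] := eqVneq k 0.
    apply: le_trans cb0; apply: cabs_dft => // x.
    by have := hG 0%N 1 x ltr01; rewrite expr0 mulr1.
  have [s hs] := hcb _ k0.
  have K0 : (0 : R) < 2 * `|k%:~R| by rewrite mulr_gt0// normr_gt0 intr_eq0.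
  rewrite -(ler_pM2r (exprn_gt0 s K0)); apply: le_trans hs.
  have H : cabs (dft (iter s (fdiff n%:R^-1) f) n k) <= G s * n%:R^-1 ^+ s.
    by apply: cabs_dft => // x; apply: hG; rewrite invr_gt0.
  rewrite dft_fdiff// cabsM cabsX exprVn ler_pdivlMr ?exprn_gt0// in H.
  apply: le_trans H; rewrite mulrC mulrAC ler_wpM2r ?cabs_ge0// -exprMn.
  rewrite lerXn2r ?nnegrE ?mulr_ge0 ?cabs_ge0// -ler_pdivrMr// -mulrA.
  (* For |k| <= M and n = 2M+1 the nearest integer to k/n is 0, whence |e(k/n) - 1| >= 2|k|/n. *)
  have := @cabs_eB1_ge R (k%:~R / n%:R) 0.
  rewrite subr0 normrM normfV (ger0_norm (ltW nz)); apply.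
  rewrite ler_pdivrMr// -intr_norm -abszE.
  have h2 : (2 * `|k|)%N%:R <= n%:R :> R by rewrite ler_nat; lia.
  by rewrite natrM in h2; rewrite -pmulrn; lra.
have G1 : 0 <= G 1%N.
  by have := hG 1%N 1 0 ltr01; rewrite expr1n mulr1; apply: le_trans; exact: cabs_ge0.
have B0 : 0 <= B.
  apply: le_trans (hB 0%N); apply: sumr_ge0 => k _; rewrite mulr_ge0//.
  have [->|k0] := eqVneq k 0.
    by apply: le_trans cb0; have := hG 0%N 1 0 ltr01; rewrite mulr1; apply: le_trans; exact: cabs_ge0.
  by apply: le_trans (cB `|k|%N k (leqnn _)); exact: cabs_ge0.
have K0 : 0 <= K.
  have := le_trans (normr_ge0 _) (wK 1) => h; rewrite leNgt; apply/negP => Kn.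
  have := wK 1; rewrite normr1 => h1.
  by have := mulr_le0_ge0 (ltW Kn) (w0 1); lra.
move=> eta eta0.
have [M0 M00 hM0] := archi_small (G 1%N + 8 * K * B) eta0.
pose M := M0; set n := M.*2.+1; have nz : (0 : R) < n%:R by rewrite ltr0n.
have hn : (G 1%N + 8 * K * B) / n%:R <= eta.
  apply: le_trans hM0; rewrite ler_wpM2l//; first by rewrite addr_ge0// !mulr_ge0.
  by rewrite lef_pV2 ?posrE ?ltr0n// ler_nat /n /M; lia.
have tw : nw w (interp f M) <= B.
  apply: le_trans (hB M); rewrite /nw /interp big_map /= big_seq [leRHS]big_seq.
  by apply: ler_sum => k; rewrite mem_irange => kM; rewrite ler_wpM2r// cB.
exists (interp f M) => // x.
wlog x01 : x / 0 <= x < 1 => [H|].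
  have fz y (m : int) : f (y + m%:~R) = f y.
    have fn (q : nat) y' : f (y' + q%:R) = f y'.
      by elim: q => [|q IH]; rewrite ?addr0// -natr1 addrA fp IH.
    case: m => q; first exact: fn.
    by rewrite NegzE mulrNz -pmulrn; have := fn q.+1 (y - q.+1%:R); rewrite subrK => ->.
  have tz y (m : int) : ev (interp f M) (y + m%:~R) = ev (interp f M) y.
    by rewrite /ev; apply: eq_bigr => p _; rewrite mulrDr eD -intrM e_int mulr1.
  have := H (x - (Num.floor x)%:~R).
  rewrite -mulrNz fz tz; apply; have := floor_itv x; rewrite intrD mulrNz.
  by move=> /andP[h1 h2]; apply/andP; split; lra.
have /andP[x0 x1] := x01.
pose l := Num.trunc (x * n%:R).
have xn0 : 0 <= x * n%:R by rewrite mulr_ge0// ltW.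
have /andP[l1 l2] := truncn_itv xn0; rewrite -/l in l1 l2.
have ln : (l < n)%N.
  by rewrite -(ltr_nat R); apply: le_lt_trans l1 _; rewrite gtr_pMl.
have d0 : 0 <= x - l%:R / n%:R by rewrite subr_ge0 ler_pdivrMr.
have d1 : x - l%:R / n%:R <= n%:R^-1.
  by rewrite lerBlDl -[X in _ + X]mul1r -mulrDl ler_pdivlMr// natr1 ltW.
have Ef : cabs (f x - f (l%:R / n%:R)) <= G 1%N / n%:R.
  have [->|dn] := eqVneq x (l%:R / n%:R).
    by rewrite subrr cabs0 divr_ge0.
  have dp : 0 < x - l%:R / n%:R by rewrite lt_neqAle d0 andbT eq_sym subr_eq0.
  have := hG 1%N _ (l%:R / n%:R) dp; rewrite /= /fdiff expr1 (addrC (l%:R / n%:R)) subrK => h.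
  by apply: le_trans h _; rewrite ler_wpM2l.
have Et : cabs (ev (interp f M) x - ev (interp f M) (l%:R / n%:R)) <= 8 * K * B / n%:R.
  rewrite /ev -sumrB; apply: le_trans (cabs_sum _ _ _) _.
  apply: (@le_trans _ _ (\sum_(p <- interp f M) cabs p.2 * w p.1 * (8 * K / n%:R))).
    apply: ler_sum => p _; rewrite -mulrBr cabsM -mulrA ler_wpM2l ?cabs_ge0//.
    apply: le_trans (cabs_eB_le _ _) _; rewrite -mulrBr normrM (ger0_norm d0).
    rewrite (_ : w p.1 * _ = 8 * ((K * w p.1) * n%:R^-1)); last by ring.
    by rewrite ler_pM2l// ler_pM.
  rewrite -big_distrl /= mulrC (_ : 8 * K * B / n%:R = (8 * K / n%:R) * B); last by ring.
  by rewrite ler_wpM2l// divr_ge0// ?mulr_ge0// ltW.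
rewrite (_ : _ - _ = (f x - f (l%:R / n%:R)) -
   (ev (interp f M) x - ev (interp f M) (l%:R / n%:R))); last first.
  by rewrite interp_node//; ring.
by apply: le_trans (cabs_sub_le Ef Et) _; rewrite -mulrDl.
Qed.

End Interpolation.

(** * The linearised conjugacy equation *)

Section LinearEquation.
Variable R : realType.
Local Open Scope complex_scope.
Local Notation C := R[i].
Implicit Types (k l : int) (x : R).

(* Neumann iteration: [f] is a small perturbation of the constant-coefficient
   operator, and what lies outside the frequency window is left in [hi]. *)
Lemma linear_solve (w w' : int -> R) (S : pred int) (Ns : nat) (al : R) (kap : C)
    (f : R -> R) (b : R -> C) (D beta gt phi : R) :
  weight w -> weight w' -> (forall k, S k -> `|k| <= Ns)%N ->
  (forall k, ~~ S k -> w' k <= gt * w k) -> 0 <= gt ->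
  cabs kap = 1 -> 0 < D -> (forall k, S k -> D <= cabs (conjc kap * e (k%:~R * al) - kap)) ->
  wle w (fun x => cis (f x) - 1) phi -> 4 * phi <= D -> wle w b beta ->
  forall n : nat, exists m lo hi, [/\ wfin S w m (2 * beta / D), wle w lo (beta / 2 ^+ n),
    wle w' hi (2 * gt * beta) &
    forall x, b x - (conjc kap * conjc (cis (f x)) * m (x + al) - kap * cis (f x) * m x) =
      lo x + hi x].
Proof.
move=> W W' SN gtP gt0 kap1 D0 hD hphi phiD hb.
have w0 k := weight_ge0 k W; have w'0 k := weight_ge0 k W'.
have ws k : w (- k) = w k by case: W.
have beta0 := wle_ge0 W hb; have phi0 := wle_ge0 W hphi.
(* The induction carries the partial sums of the geometric series, which the statement replaces by
   their limits. *)
move=> n; suff [m [lo [hi [hm hlo hhi E]]]] : exists m lo hi,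
  [/\ wfin S w m (beta / D * (2 - 2 / 2 ^+ n)), wfin S w lo (beta / 2 ^+ n),
    wle w' hi (gt * beta * (2 - 1 / 2 ^+ n)) &
    forall x, b x - (conjc kap * conjc (cis (f x)) * m (x + al) - kap * cis (f x) * m x) =
      lo x + hi x].
  have p0 : 0 < (2 ^+ n)^-1 :> R by rewrite invr_gt0 exprn_gt0.
  exists m, lo, hi; split => //.
  - apply: wfin_mono hm; rewrite (_ : 2 * beta / D = beta / D * 2); last by ring.
    by apply: ler_wpM2l; [rewrite divr_ge0// ltW|lra].
  - exact: wfin_wle hlo.
  - apply: wle_mono hhi; rewrite (_ : 2 * gt * beta = gt * beta * 2); last by ring.
    by apply: ler_wpM2l; [exact: mulr_ge0|lra].
elim: n => [|n [m [lo [hi [hm hlo hhi E]]]]].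
  have [lo [hlo hhi]] := wle_split w0 SN hb.
  exists (fun=> 0), lo, (fun x => b x - lo x); split.
  - exists [::]; split => [x|//|//]; first by rewrite ev_nil.
    by rewrite /nw big_nil expr0 divr1 subrr mulr0.
  - by rewrite expr0 divr1.
  - rewrite expr0 divr1 (_ : 2 - 1 = 1) ?mulr1; last by lra.
    exact: hhi.
  - by move=> x; rewrite !mulr0 !subr0 addrC subrK.
pose bn := beta / 2 ^+ n.
have bn0 : 0 <= bn by rewrite divr_ge0// exprn_ge0.
have Di0 : 0 <= D^-1 by rewrite invr_ge0 ltW.
have hS k : S k -> w k <= D^-1 * w k * cabs (conjc kap * e (k%:~R * al) - kap) /\
    conjc kap * e (k%:~R * al) - kap != 0.
  move=> Sk; split.
    rewrite mulrAC mulrC -[leLHS]mulr1 ler_wpM2l// mulrC ler_pdivlMr// mul1r.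
    exact: hD.
  by apply/eqP => h; have := hD _ Sk; rewrite h cabs0 leNgt D0.
have [d hd Ed] := wfin_cohom Di0 hS hlo.
have d1 : wle w (fun x => d (x + al)) (D^-1 * bn) := wle_shift al w0 (wfin_wle hd).
(* [t] is the error made by solving with cis f replaced by 1. The condition 4 phi <= D makes it at
   most half of the current residual. *)
pose t x := - (conjc kap * ((conjc (cis (f x)) - 1) * d (x + al)) -
  kap * ((cis (f x) - 1) * d x)).
have ht : wle w t (bn / 2).
  apply: (@wle_mono _ _ _ (1 * (phi * (D^-1 * bn)) + 1 * (phi * (D^-1 * bn)))).
    have -> : bn / 2 = (4 * phi * (D^-1 * bn) + (D - 4 * phi) * (D^-1 * bn)) / 2.
      by field; rewrite gt_eqF.
    have : 0 <= (D - 4 * phi) * (D^-1 * bn).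
      by rewrite mulr_ge0 ?subr_ge0// mulr_ge0// invr_ge0 ltW.
    lra.
  apply: wle_opp => //; apply: wle_sub => //; apply: wle_scale; rewrite ?cabsJ ?kap1//.
    apply: wle_mul => //; apply: (@eq_wle _ _ (fun x => conjc (cis (f x) - 1))).
      by move=> x; rewrite conjcB conjc1.
    exact: wle_conj.
  by apply: wle_mul => //; exact: wfin_wle hd.
have [tlo [htlo hthi]] := wle_split w0 SN ht.
have E2 : (2 ^+ n.+1)^-1 = (2 ^+ n)^-1 / 2 :> R by rewrite exprSr invfM.
exists (fun x => m x + d x), tlo, (fun x => hi x + (t x - tlo x)); split.
- apply: wfin_mono (wfin_add hm hd); rewrite E2 /bn le_eqVlt; apply/orP; left.
  by apply/eqP; field; rewrite ?expf_neq0 ?(gt_eqF D0)//.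
- by rewrite E2 mulrA.
- apply: wle_mono (wle_add hhi (hthi w' gt gt0 w'0 gtP)); rewrite E2 /bn le_eqVlt.
  by apply/orP; left; apply/eqP; field; rewrite ?expf_neq0//.
- move=> x; have := E x; have := Ed x; rewrite /t => h1 h2.
  have -> : b x = lo x + hi x +
     (conjc kap * conjc (cis (f x)) * m (x + al) - kap * cis (f x) * m x).
    by rewrite -h2; ring.
  by rewrite -h1; ring.
Qed.

End LinearEquation.

(** * One step of the KAM scheme *)

Section KamStep.
Variable R : realType.
Local Open Scope complex_scope.
Local Notation C := R[i].
Implicit Types (k l : int) (x B : R) (S : pred int) (w : int -> R).

Definition trig (m : R -> C) := exists t, forall x, m x = ev t x.
(** Conjugation by w -> w - m conj(w), composed on the right with w -> w + m conj(w), which is the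
    inverse up to the factor 1 - |m|^2. Such positive factors do not affect directions and are left
    in. *)
Definition cj_a (al : R) (m a b : R -> C) x : C :=
  a x - m (x + al) * conjc (b x) + b x * conjc (m x) - m (x + al) * conjc (m x) * conjc (a x).
Definition cj_b (al : R) (m a b : R -> C) x : C :=
  b x + a x * m x - conjc (a x) * m (x + al) - m (x + al) * m x * conjc (b x).
(** Conjugation by the rotation w -> cis(psi) w, together with multiplication by the positive
    function [h]. *)
Definition rt_a (al : R) (h psi : R -> R) (a : R -> C) x : C :=
  cis (psi (x + al) - psi x) * (h x)%:C * a x.
Definition rt_b (al : R) (h psi : R -> R) (b : R -> C) x : C :=
  cis (psi (x + al) + psi x) * (h x)%:C * b x.
Definition brk k : R := Num.max 1 `|k%:~R|.

Lemma brk_ge1 k : 1 <= brk k.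
Proof. by rewrite /brk le_max lexx. Qed.
Lemma brk_gek k : `|k%:~R| <= brk k.
Proof. by rewrite /brk le_max lexx orbT. Qed.
Lemma brkN k : brk (- k) = brk k.
Proof. by rewrite /brk mulrNz normrN. Qed.

Lemma wfin_sub S (S' : pred int) w (f : R -> C) B : (forall k, S k -> S' k) -> wfin S w f B -> wfin S' w f B.
Proof. by move=> h [t [ft tB tS]]; exists t; split => // p /tS /h. Qed.
Lemma wfin_trig S w (f : R -> C) B : wfin S w f B -> trig f.
Proof. by case=> t [ft _ _]; exists t. Qed.
Lemma wle_unit w (f : R -> C) B (c : C) : (forall k, 0 <= w k) -> cabs c = 1 -> wle w f B ->
  wle w (fun x => c * f x) B.
Proof. by move=> w0 c1 h; rewrite -[B]mul1r; apply: wle_scale => //; rewrite c1. Qed.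

Lemma wle_split_real w (f : R -> R) B (q : nat) :
  (forall k, 0 <= w k) -> (forall k, w (- k) = w k) -> wle w (fun x => (f x)%:C) B ->
  exists lo : R -> R, wfin (fun k => `|k| < q)%N w (fun x => (lo x)%:C) B /\
  forall w' (g : R), 0 <= g -> (forall k, 0 <= w' k) -> (forall k, w' (- k) = w' k) ->
    (forall k, (q <= `|k|)%N -> w' k <= g * w k) -> wle w' (fun x => (f x - lo x)%:C) (g * B).
Proof.
move=> w0 ws hf.
have SN k : (`|k| < q)%N -> (`|k| <= q)%N by move=> /ltnW.
have [lo [hlo hhi]] := wle_split w0 SN hf.
exists (fun x => complex.Re (lo x)); split.
  by apply: wfin_Re => // k; rewrite abszN.
move=> w' g g0 w'0 w's h.
apply: (@eq_wle _ _ (fun x => (complex.Re ((f x)%:C - lo x))%:C)).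
  by move=> x; rewrite ReD ReN.
by apply: wle_Re => //; apply: hhi => // k; rewrite -leqNgt; exact: h.
Qed.

(** [Rot a b] abstracts the property that the pair (a, b) has the prescribed rotation number, [u0]
    being its exponential. It is preserved by the two conjugations and pins down [kap] when (a, b)
    is close to the constant kap. *)
Variables (al : R) (u0 : C) (Rot : (R -> C) -> (R -> C) -> Prop).
Hypothesis Rot_ext : forall a b a' b', (forall x, a x = a' x) -> (forall x, b x = b' x) ->
  Rot a b -> Rot a' b'.
Hypothesis Rot_rt : forall (h psi : R -> R) a b, (forall x, 0 < h x) ->
  trig (fun x => (psi x)%:C) -> Rot a b -> Rot (rt_a al h psi a) (rt_b al h psi b).
Hypothesis Rot_cj : forall m a b, trig m -> (forall x, cabs (m x) < 1) -> Rot a b ->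
  Rot (cj_a al m a b) (cj_b al m a b).
Hypothesis Rot_near : forall a b kap eta, cabs kap = 1 -> 0 <= eta -> eta <= 16^-1 ->
  (forall x, cabs (a x - kap) <= eta) -> (forall x, cabs (b x) <= eta) ->
  Rot a b -> cabs (u0 - kap) <= 40 * eta.
Hypothesis u01 : cabs u0 = 1.

(** [F] bounds the phase with N extra derivatives and [delta] bounds both [z] and [b]. [L] is the
    bandwidth and, with [Ci], the loss in the equation for psi; [D] is a lower bound for the
    divisors of the equation for m on |k| <= Ns, and [gt] is the gain of passing from [w] to [w']
    beyond that window. The new errors are products of two of delta, mu, beta, or of [gt] and
    beta. *)
Lemma kam_step (w w' : int -> R) (N T Ns q : nat) (X gt C0 L Ci D F delta : R)
    (kap : C) (f : R -> R) (z a b : R -> C) :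
  let CV := 20 * C0 * L in let om k := brk k ^+ N * w k in let om' k := brk k ^+ N * w' k in
  let phi := F / q%:R ^+ N + 2 * delta in let F' := F + X * (2 * delta) in
  let mu := 4 * CV ^+ 2 * delta / D in let beta := 2 * CV ^+ 2 * delta in
  weight w -> weight w' -> (forall k, w' k <= w k) ->
  (forall k, brk k ^+ N * w' k <= X * w k) ->
  (forall k, (`|k| < q)%N -> brk k ^+ N <= X) ->
  (forall k, (Ns < `|k|)%N -> w' k <= gt * w k) -> 0 < gt -> 0 <= X ->
  (forall k, w k <= C0 * expR (`|k%:~R : R| / (4 * L))) -> 1 <= L -> q%:R <= L -> (0 < q)%N ->
  (T < N)%N -> 0 < Ci ->
  (forall l, l != 0 -> (`|l| < q)%N ->
     1 <= Ci * L * `|l%:~R : R| ^+ T * cabs (e (l%:~R * al) - 1)) ->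
  (forall l, (`|l| <= Ns)%N -> 2 * D <= cabs (e (l%:~R * al) - u0 ^+ 2)) -> 0 < D ->
  delta <= 64^-1 -> Ci * F' <= 16^-1 -> F' <= 64^-1 -> F + 2 * delta <= 64^-1 -> 8 * phi <= D ->
  2 * phi + 32 * delta ^+ 2 + beta <= 16^-1 ->
  80 * (2 * phi + 32 * delta ^+ 2 + beta) <= D -> mu <= 2^-1 ->
  cabs kap = 1 -> wle om (fun x => (f x)%:C) F -> wle w z delta -> wle w b delta ->
  (forall x, a x = kap * (cis (f x) + z x)) -> Rot a b ->
  exists (h psi : R -> R) (m : R -> C) (kap' : C) (f' : R -> R) (z' : R -> C),
    let a2 := cj_a al m (rt_a al h psi a) (rt_b al h psi b) in
    let b2 := cj_b al m (rt_a al h psi a) (rt_b al h psi b) in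
    [/\ forall x, 0 < h x, trig (fun x => (psi x)%:C), trig m,
        wle w (fun x => cis (psi x)) CV & wle w m mu] /\
    cabs kap' = 1 /\
    [/\ forall x, a2 x = kap' * (cis (f' x) + z' x),
        wle om' (fun x => (f' x)%:C) F',
        wle w' z' (32 * delta ^+ 2 + 2 * mu * beta + 2 * mu ^+ 2),
        wle w' b2 (3 * gt * beta + 64 * delta ^+ 2 * mu + mu ^+ 2 * beta) &
        Rot a2 b2].
Proof.
move=> CV om om' phi F' mu beta W W' ww' hX qX tail gt0 X0 big L1 qL q0 TN Ci0 sd1 sd2 D0
  d64 CF F64 F2 phiD eta16 etaD mu2 kap1 hf hz hb aE hRot.
have w0 k := weight_ge0 k W; have w'0 k := weight_ge0 k W'.
have ws k : w (- k) = w k by case: W.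
have w's k : w' (- k) = w' k by case: W'.
have w1 k : 1 <= w k by case: W.
have brN1 k : 1 <= brk k ^+ N by rewrite exprn_ege1// brk_ge1.
have brN0 k : 0 <= brk k ^+ N by exact: le_trans (brN1 k).
have om0 k : 0 <= om k by rewrite mulr_ge0.
have om'0 k : 0 <= om' k by rewrite mulr_ge0.
have oms k : om (- k) = om k by rewrite /om brkN ws.
have om's k : om' (- k) = om' k by rewrite /om' brkN w's.
have wom k : w k <= om k by rewrite /om ler_peMl.
have delta0 := wle_ge0 W hz.
have fw : wle w (fun x => (f x)%:C) F := wle_weight_le wom hf.
have F0 := wle_ge0 W fw.
have FF' : F <= F' by rewrite /F' lerDl !mulr_ge0.
have CVd0 (c : R) : 0 <= c -> 0 <= c * CV ^+ 2 * delta.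
  by move=> c0; apply: mulr_ge0 => //; apply: mulr_ge0 => //; exact: sqr_ge0.
have beta0 : 0 <= beta by exact: CVd0.
have phi0 : 0 <= phi by rewrite /phi addr_ge0 ?mulr_ge0// invr_ge0 exprn_ge0.
have mu0 : 0 <= mu by rewrite /mu divr_ge0 ?(ltW D0)// CVd0.
have dd : delta ^+ 2 <= delta / 64 by rewrite expr2; nra.
have d20 : 0 <= delta ^+ 2 by exact: sqr_ge0.
(* modulus and phase corrections *)
pose y x := cis (- f x) * z x.
have hy : wle w y (2 * delta).
  apply: (@wle_mono _ _ _ ((1 + 2 * F) * delta)); first by nra.
  apply: wle_mul => //; apply: wle_cis => //; last by lra.
  by apply: (@eq_wle _ _ (fun x => - (f x)%:C)); [move=> x; rewrite rcN|exact: wle_opp].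
pose yR x := complex.Re (y x); pose yI x := complex.Im (y x).
have hyR : wle w (fun x => (yR x)%:C) (2 * delta) by exact: wle_Re.
have hyI : wle w (fun x => (yI x)%:C) (2 * delta) by exact: wle_Im.
(* Here a = kap cis(f) (1 + y). To first order, multiplying by 1 - Re y removes the real part of y,
   and the imaginary part joins the phase. *)
pose h x := 1 - yR x.
have h0 x : 0 < h x.
  have := wle_sup x W hyR; rewrite cabs_real ler_norml /h => /andP[_ H]; lra.
have yE x : y x = (yR x)%:C + 'i * (yI x)%:C.
  exact: complexE.
(* frequency splitting *)
have [lf [hlf hif]] := wle_split_real q om0 oms hf.
have [ly [hly hiy]] := wle_split_real q w0 ws hyI.
pose lo x := lf x + ly x.
(* Only frequencies q and above are left in the phase. On them the N extra derivatives are worth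
   q^N, so the part coming from [f] has [w]-norm at most F/q^N. *)
pose f' x := (f x - lf x) + (yI x - ly x).
have qN0 : 0 < q%:R ^+ N :> R by rewrite exprn_gt0// ltr0n.
have hf'w : wle w (fun x => (f' x)%:C) phi.
  apply: (@eq_wle _ _ (fun x => (f x - lf x)%:C + (yI x - ly x)%:C)).
    by move=> x; rewrite /f' [RHS]rcD.
  apply: wle_add; last by rewrite -[2 * delta]mul1r; apply: hiy => // k _; rewrite mul1r.
  rewrite mulrC; apply: hif => // k qk.
  rewrite /om mulrA ler_peMl// mulrC ler_pdivlMr// mul1r lerXn2r ?nnegrE//.
    by apply: le_trans (brk_ge1 k).
  by apply: le_trans (brk_gek k); rewrite -intr_norm -natr_absz ler_nat.
have hf'om : wle om' (fun x => (f' x)%:C) F'.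
  apply: (@eq_wle _ _ (fun x => (f x - lf x)%:C + (yI x - ly x)%:C)).
    by move=> x; rewrite /f' [RHS]rcD.
  apply: wle_add; last by apply: hiy => // k _; exact: hX.
  rewrite -[F]mul1r; apply: hif => // k _; rewrite mul1r ler_wpM2l//.
have hlow : wle w (fun x => (lo x)%:C) (F + 2 * delta).
  apply: (@eq_wle _ _ (fun x => (lf x)%:C + (ly x)%:C)); first by move=> x; rewrite /lo rcD.
  by apply: wle_add; [apply: wle_weight_le wom _; exact: wfin_wle hlf|exact: wfin_wle hly].
have hlobr : wfin (fun k => `|k| < q)%N (fun k => brk k ^+ N) (fun x => (lf x)%:C + (ly x)%:C) F'.
  apply: wfin_add.
    rewrite -[F]mul1r; apply: wfin_weight hlf => // k _.
    by rewrite mul1r /om ler_peMr.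
  apply: wfin_weight hly => // k qk; apply: le_trans (qX k qk) _.
  by rewrite ler_peMr.
have [g0 [rm [hg0 hrm lorm]]] := wfin_filter (pred1 0) brN0 hlobr.
(* The mean of the low part cannot be removed by a rotation psi(x + al) - psi(x); it is absorbed
   into the constant kap' = kap cis(c0). *)
pose c0 := complex.Re (g0 0); pose rem x := complex.Re (rm x).
have g0c x : complex.Re (g0 x) = c0.
  rewrite /c0; case: hg0 => t [g0t _ tS]; rewrite !g0t /ev big_seq [in RHS]big_seq.
  congr complex.Re; apply: eq_bigr => p /tS /andP[_ /eqP ->]; by rewrite !mul0r.
have loE x : lo x = c0 + rem x.
  have := congr1 (@complex.Re _) (lorm x); rewrite /lo ReD /= => ->.
  by rewrite ReD g0c.
pose S1 k := (`|k| < q)%N && (k != 0).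
have S1s k : S1 k -> S1 (- k) by rewrite /S1 abszN oppr_eq0.
have hrem : wfin S1 (fun k => brk k ^+ N) (fun x => (rem x)%:C) F'.
  apply: wfin_Re => // [k|]; first by rewrite brkN.
  by apply: wfin_sub hrm => k /andP[/= k0 kq]; rewrite /S1 kq.
(* Since T < N, the extra derivatives pay both for the |k|^T of the divisors and for the weight |k|
   of the solution; only the factor Ci L remains. This is the first-moment bound that
   [wle_cis_bandwidth] asks for. *)
have [m0 hm0 Em0] : exists2 m, wfin S1 (fun k => `|k%:~R|) m (Ci * L * F') &
    forall x, 1 * m (x + al) - 1 * m x = (rem x)%:C.
  apply: wfin_cohom hrem => [|k /andP[kq k0]]; first by rewrite !mulr_ge0 ?(ltW Ci0)//; lra.
  have H := sd1 k k0 kq; rewrite mul1r; split; last first.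
    by apply/eqP => E; move: H; rewrite E cabs0 mulr0 ler10.
  apply: le_trans (ler_peMr (normr_ge0 _) H) _.
  move: (cabs (_ - 1)) (cabs_ge0 (e (k%:~R * al) - 1)) => c c00.
  have -> (t : R) : t * (Ci * L * t ^+ T * c) = Ci * L * c * t ^+ T.+1 by rewrite exprS; ring.
  rewrite [leRHS](mulrAC (Ci * L)); apply: ler_wpM2l; first by rewrite !mulr_ge0 ?(ltW Ci0)//; lra.
  apply: (@le_trans _ _ (brk k ^+ T.+1)).
    by apply: lerXn2r; rewrite ?nnegrE ?brk_gek// (le_trans ler01 (brk_ge1 k)).
  by rewrite ler_weXn2l// brk_ge1.
pose psi x := - complex.Re (m0 x).
have psiE x : psi (x + al) - psi x = - rem x.
  have := congr1 (@complex.Re _) (Em0 x); rewrite !mul1r ReD ReN /= => <-.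
  by rewrite /psi; ring.
have hpsi : wfin S1 (fun k => `|k%:~R : R|) (fun x => (psi x)%:C) (Ci * L * F').
  have : wfin S1 (fun k => `|k%:~R : R|) (fun x => (complex.Re (m0 x))%:C) (Ci * L * F').
    by apply: wfin_Re => // k; rewrite mulrNz normrN.
  move=> [t [ft tB tS]]; exists (tmap (fun=> -1) t); split.
  - by move=> x; rewrite ev_scale -ft /psi rcN mulN1r.
  - rewrite -[leRHS]mul1r; apply: le_trans (ler_wpM2l ler01 tB); apply: nw_map => // p _.
    by rewrite cabsN cabs1.
  - by move=> p /mapP[p' /tS ? ->].
have hv : wle w (fun x => cis (psi x)) CV.
  apply: (wle_cis_bandwidth L1 w0 big).
  apply: wfin_mono (wfin_sub _ hpsi).
    rewrite (_ : Ci * L * F' = L * (Ci * F')); last by ring.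
    by rewrite ler_pM2l//; lra.
  move=> k /andP[kq _]; apply: le_trans qL.
  by rewrite -intr_norm -natr_absz ler_nat ltnW.
(* the rotated cocycle *)
pose z1 x := cis (f x) * (1 + 'i * (yI x)%:C - cis (yI x) - y x * (yR x)%:C).
pose z2 x := cis (- lo x) * z1 x.
pose kap' := kap * cis c0.
pose a1 := rt_a al h psi a; pose b1 := rt_b al h psi b.
have kap'1 : cabs kap' = 1 by rewrite /kap' cabsM kap1 cabs_cis mulr1.
have a1E x : a1 x = kap' * (cis (f' x) + z2 x).
  rewrite /a1 /rt_a psiE aE /z2 /z1 /h rcB.
  have -> : z x = cis (f x) * y x by rewrite /y mulrA cisMN mul1r.
  have -> : cis (- rem x) = cis c0 * cis (- lo x).
    by rewrite -cisD; congr cis; rewrite loE; ring.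
  have -> : cis (f' x) = cis (- lo x) * (cis (f x) * cis (yI x)).
    by rewrite -!cisD; congr cis; rewrite /f' /lo; ring.
  have yRE : (yR x)%:C = y x - 'i * (yI x)%:C by rewrite [X in _ = X - _]yE; ring.
  rewrite /kap' yRE; ring.
have hz1 : wle w z1 (16 * delta ^+ 2).
  apply: (@wle_mono _ _ _ ((1 + 2 * F) * ((2 * delta) ^+ 2 + (2 * delta) * (2 * delta)))).
    rewrite (_ : (2 * delta) ^+ 2 + _ = 8 * delta ^+ 2); last by ring.
    by rewrite mulrA ler_wpM2r//; lra.
  apply: wle_mul => //; first by apply: wle_cis => //; lra.
  apply: (@eq_wle _ _ (fun x => - (cis (yI x) - 1 - 'i * (yI x)%:C) - y x * (yR x)%:C)).
    by move=> x; ring.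
  apply: wle_sub => //; last exact: wle_mul.
  by apply: wle_opp => //; apply: wle_cisB1B => //; lra.
have hz2 : wle w z2 (32 * delta ^+ 2).
  apply: (@wle_mono _ _ _ ((1 + 2 * (F + 2 * delta)) * (16 * delta ^+ 2))).
    by rewrite mulrA ler_wpM2r//; lra.
  apply: wle_mul => //; apply: wle_cis => //; last by lra.
  by apply: (@eq_wle _ _ (fun x => - (lo x)%:C)); [move=> x; rewrite rcN|exact: wle_opp].
have phi1 : phi <= 1 by lra.
have hcf' : wle w (fun x => cis (f' x) - 1) (2 * phi) by exact: wle_cisB1.
have hb1 : wle w b1 beta.
  apply: (@wle_mono _ _ _ (CV * CV * (1 + 2 * delta) * delta)).
    rewrite /beta (_ : 2 * CV ^+ 2 * delta = CV * CV * 2 * delta); last by ring.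
    apply: ler_wpM2r => //; apply: ler_wpM2l; last by lra.
    by rewrite -expr2 sqr_ge0.
  apply: (@eq_wle _ _ (fun x => cis (psi (x + al)) * cis (psi x) * (1 - (yR x)%:C) * b x)).
    by move=> x; rewrite /b1 /rt_b cisD /h rcB.
  apply: wle_mul => //; apply: wle_mul => //.
    by apply: wle_mul => //; exact: (@wle_shift _ w (fun x => cis (psi x))).
  apply: wle_sub => //; rewrite -[X in wle _ _ X](@cabs1 R); apply: wle_cst.
  by case: W.
have hRot1 : Rot a1 b1 by apply: Rot_rt => //; exact: wfin_trig hpsi.
pose eta := 2 * phi + 32 * delta ^+ 2 + beta.
(* The rotation number enters here: the rotated cocycle is eta-close to the constant kap', so kap'
   is close to u0 and the divisors e(l al) - u0^2 are comparable with e(l al) - kap'^2. *)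
have near : cabs (u0 - kap') <= 40 * eta.
  apply: (@Rot_near a1 b1) => //; first by rewrite /eta; lra.
    move=> x; rewrite a1E (_ : _ - _ = kap' * ((cis (f' x) - 1) + z2 x)); last by ring.
    rewrite cabsM kap'1 mul1r /eta -[leRHS]addrA; apply: cabs_add_le; first exact: (wle_sup x W hcf').
    by apply: le_trans (wle_sup x W hz2) _; rewrite lerDl.
  by move=> x; apply: le_trans (wle_sup x W hb1) _; rewrite /eta lerDr; lra.
have sdk l : (`|l| <= Ns)%N -> D <= cabs (conjc kap' * e (l%:~R * al) - kap').
  move=> lN; have H := sd2 l lN.
  have kk : kap' * conjc kap' = 1 by rewrite mulcJ kap'1 expr1n.
  have -> : cabs (conjc kap' * e (l%:~R * al) - kap') = cabs (e (l%:~R * al) - kap' ^+ 2).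
    have E : conjc kap' * (e (l%:~R * al) - kap' ^+ 2) = conjc kap' * e (l%:~R * al) - kap'.
      by rewrite mulrBr expr2 mulrA (mulrC (conjc kap') kap') kk mul1r.
    by rewrite -E cabsM cabsJ kap'1 mul1r.
  have H2 : cabs (u0 ^+ 2 - kap' ^+ 2) <= D.
    rewrite subr_sqr; apply: le_trans (cabs_mul_le near (cabs_add_le (lexx _) (lexx _))) _.
    by rewrite u01 kap'1; rewrite /eta in near *; lra.
  have := cabsD (e (l%:~R * al) - kap' ^+ 2) (kap' ^+ 2 - u0 ^+ 2).
  by rewrite addrA subrK (cabs_dist (kap' ^+ 2)); lra.
(* Enough Neumann iterations for the unsolved low-frequency residue to drop below the unavoidable
   tail. *)
have [n0 hn0] : exists n : nat, beta / 2 ^+ n <= gt * beta.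
  have [n n0 hn] := archi_small 1 gt0; exists n; rewrite mulrC ler_wpM2r//.
  apply: le_trans hn; rewrite mul1r lef_pV2 ?posrE ?exprn_gt0 ?ltr0n//.
  by rewrite -natrX ler_nat ltnW// ltn_expl.
have [m [lo' [hi [hm hlo' hhi Em]]]] := linear_solve W W' (fun k h => h : (`|k| <= Ns)%N)
  (fun k h => tail k (ltac:(by rewrite ltnNge)))
  (ltW gt0) kap'1 D0 sdk hcf' (ltac:(lra)) hb1 n0.
have muE : 2 * beta / D = mu by rewrite /mu /beta; field; rewrite gt_eqF.
rewrite muE in hm.
have hmw := wfin_wle hm.
have hms := wle_shift al w0 hmw.
have hbc : wle w (fun x => conjc (b1 x)) beta by exact: wle_conj.
have hmc : wle w (fun x => conjc (m x)) mu by exact: wle_conj.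
have ha1 : wle w a1 2.
  apply: (@eq_wle _ _ (fun x => kap' * (cis (f' x) + z2 x))) => [x|]; first by rewrite a1E.
  apply: wle_unit => //; apply: (@wle_mono _ _ _ ((1 + 2 * phi) + 32 * delta ^+ 2)); first by lra.
  by apply: wle_add => //; exact: wle_cis.
have ha1c : wle w (fun x => conjc (a1 x)) 2 by exact: wle_conj.
pose z3 x := z2 x + conjc kap' * (b1 x * conjc (m x) - m (x + al) * conjc (b1 x) -
  m (x + al) * conjc (m x) * conjc (a1 x)).
exists h, psi, m, kap', f', z3; split.
  by split => //; [exact: wfin_trig hpsi|exact: wfin_trig hm].
split => //; split => //.
- move=> x; have kk : kap' * conjc kap' = 1 by rewrite mulcJ kap'1 expr1n.
  rewrite /cj_a -/a1 -/b1 /z3 mulrDr mulrDr (mulrA kap' (conjc kap')) kk mul1r.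
  by rewrite {1}a1E; ring.
- apply: wle_weight_le ww' _; rewrite /z3 -addrA; apply: wle_add => //.
  apply: wle_unit; rewrite ?cabsJ//.
  apply: (@wle_mono _ _ _ (beta * mu + mu * beta + mu * mu * 2)).
    by rewrite le_eqVlt; apply/orP; left; apply/eqP; ring.
  apply: wle_sub => //; first by apply: wle_sub => //; exact: wle_mul.
  by apply: wle_mul => //; exact: wle_mul.
- apply: (@eq_wle _ _ (fun x => (lo' x + hi x) + (kap' * (z2 x * m x) -
    conjc kap' * (conjc (z2 x) * m (x + al)) - m (x + al) * m x * conjc (b1 x)))).
    move=> x; rewrite -Em /cj_b -/a1 -/b1 a1E (conjcM kap') (conjcD (cis (f' x))); ring.
  apply: (@wle_mono _ _ _ ((gt * beta + 2 * gt * beta) +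
    (32 * delta ^+ 2 * mu + 32 * delta ^+ 2 * mu + mu * mu * beta))).
    by rewrite le_eqVlt; apply/orP; left; apply/eqP; ring.
  apply: wle_add.
    by apply: wle_add => //; apply: wle_weight_le ww' _; exact: wle_mono hn0 hlo'.
  apply: wle_weight_le ww' _; apply: wle_sub => //; last first.
    by apply: wle_mul => //; exact: wle_mul.
  apply: wle_sub => //; apply: wle_unit; rewrite ?cabsJ//; apply: wle_mul => //.
  exact: wle_conj.
- apply: Rot_cj => //; first exact: wfin_trig hm.
  by move=> x; have := wle_sup x W hmw; lra.
Qed.

End KamStep.

(** * Continuity and integration on the two-torus *)

Lemma continuous_pair_for (T U V : topologicalType) (f : T -> U) (g : T -> V) (x : T) :
  {for x, continuous f} -> {for x, continuous g} -> {for x, continuous (fun z => (f z, g z))}.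
Proof. by move=> cf cg; apply: (cvg_pair (G := nbhs (f x)) (H := nbhs (g x))). Qed.

Section PointwiseContinuity.
Context {R : realType} {T : topologicalType}.
Implicit Types f g : T -> R.

Lemma cont_cst (c : R) : continuous ((fun=> c) : T -> R).
Proof. by move=> z; exact: cst_continuous. Qed.
Lemma contD f g : continuous f -> continuous g -> continuous (fun z => f z + g z).
Proof. by move=> cf cg z; exact: (continuousD (cf z) (cg z)). Qed.
Lemma contB f g : continuous f -> continuous g -> continuous (fun z => f z - g z).
Proof. by move=> cf cg z; exact: (continuousB (cf z) (cg z)). Qed.
Lemma contM f g : continuous f -> continuous g -> continuous (fun z => f z * g z).
Proof. by move=> cf cg z; exact: (continuousM (cf z) (cg z)). Qed.
Lemma contV f : (forall z, f z != 0) -> continuous f -> continuous (fun z => (f z)^-1).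
Proof. by move=> f0 cf z; exact: (continuousV (f0 z) (cf z)). Qed.
Lemma cont_comp (U V : topologicalType) (k : U -> V) (f : T -> U) :
  continuous k -> continuous f -> continuous (fun z => k (f z)).
Proof. by move=> ck cf z; exact: (continuous_comp (cf z) (ck (f z))). Qed.
Lemma cont_id : continuous (fun z : T => z).
Proof. by move=> z; exact: cvg_id. Qed.
End PointwiseContinuity.

Section Torus.
Variable R : realType.
Local Notation Z := (circle R * circle R)%type.
Implicit Types (g psi : Z -> R) (mu : probability (borel_torus2 R) R).

Lemma toT_int (y : R) (k : int) : toT (y + k%:~R) = toT y.
Proof. by apply/toT_eq; rewrite addrAC subrr add0r; exact: intr_int. Qed.

Lemma toT_open (U : set R) : open U -> open (@toT R @` U : set (circle R)).
Proof.
move=> oU; rewrite /open /= /quotient_open.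
have -> : \pi_(circle R)%qT @^-1` (@toT R @` U) = \bigcup_(k in [set: int]) ((fun y : R => y - k%:~R) @^-1` U).
  rewrite eqEsubset; split => y /=.
    move=> [u Uu] /esym/toT_eq/intrP [k hk]; exists k => //=.
    by rewrite -hk opprB addrC subrK.
  by move=> [k _ /= Uy]; exists (y - k%:~R) => //; rewrite -mulrNz toT_int.
apply: bigcup_open => k _; apply: open_comp => // y _.
by apply: continuousB; [exact: id|exact: cst_continuous].
Qed.

Lemma open_borel (U : set Z) : open U -> measurable (U : set (borel_torus2 R)).
Proof. by move=> oU; apply: sub_sigma_algebra. Qed.

Lemma continuous_borel g : continuous g -> measurable_fun [set: borel_torus2 R] (g : borel_torus2 R -> R).
Proof.
move=> cg; apply: (measurability _ (RGenOInfty.measurableE R)).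
move=> /= _ [_ [a ->]] <-; rewrite setTI; apply: open_borel.
by apply: open_comp; [move=> z _; exact: cg|exact: interval_open].
Qed.

Lemma torus_bounded g : continuous g -> exists B, forall z, `|g z| <= B.
Proof.
move=> cg; pose F (p : R * R) : Z := (toT p.1, toT p.2).
have cF : continuous F.
  move=> p; apply: (@continuous_pair_for _ _ _ (@toT R \o fst) (@toT R \o snd) p).
    by apply: (@continuous_comp _ _ _ fst (@toT R) p); [exact: cvg_fst|exact: toT_continuous].
  by apply: (@continuous_comp _ _ _ snd (@toT R) p); [exact: cvg_snd|exact: toT_continuous].
have cK : compact (`[0, 1]%classic `*` `[0, 1]%classic : set (R * R)).
  by apply: compact_setX; exact: segment_compact.
have : compact ((g \o F) @` (`[0, 1]%classic `*` `[0, 1]%classic)).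
  apply: continuous_compact => //; apply: continuous_subspaceT => p.
  by apply: continuous_comp; [exact: cF|exact: cg].
move=> /compact_bounded [M [_ hM]]; exists (M + 1) => -[x y].
have fr (c : circle R) : exists2 t : R, 0 <= t <= 1 & toT t = c.
  have [t <-] := toT_surj c; exists (t - (Num.floor t)%:~R).
    have := floor_itv t; rewrite intrD => /andP[h1 h2]; apply/andP; split; lra.
  by rewrite -mulrNz toT_int.
have [s s01 <-] := fr x; have [t t01 <-] := fr y.
have M1 : M < M + 1 by rewrite ltrDl.
apply: (hM _ M1).
by exists (s, t) => //; split => /=; rewrite in_itv.
Qed.

Lemma torus_integrable mu g : continuous g -> mu.-integrable setT (EFin \o (g : borel_torus2 R -> R)).
Proof.
move=> cg; apply: measurable_bounded_integrable => //.
- exact: (@eq_ind_r _ 1%E (fun t => (t < +oo)%E) (ltry 1) _ (@probability_setT _ _ _ mu)).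
- exact: continuous_borel.
- have [B hB] := torus_bounded cg; exists B; split; first exact: num_real.
  by move=> x Bx z _ /=; rewrite (le_trans (hB z))// ltW.
Qed.

Variables (al : R) (psi0 : Z -> R).
Hypothesis cpsi : continuous psi0.
Definition torus_map (z : Z) : Z := (z.1 + toT al, z.2 + toT (psi0 z)).

Lemma torus_map_continuous : continuous torus_map.
Proof.
move=> z; apply: (@continuous_pair_for _ _ _ (fun z : Z => z.1 + toT al)
  (fun z : Z => z.2 + toT (psi0 z)) z).
  apply: (@continuous_comp _ _ _ fst (fun x : circle R => x + toT al) z); first exact: cvg_fst.
  move: (z.1); apply/quotient_continuous.
  rewrite (_ : _ \o _ = @toT R \o (fun y => y + al)); last by apply/funext => y /=; rewrite toTD.
  move=> y; apply: continuous_comp; last exact: toT_continuous.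
  by apply: continuousD; [exact: id|exact: cst_continuous].
have [y0 y0E] := toT_surj z.2.
move=> U /=; rewrite -y0E -toTD => nU.
have := @toT_continuous R (y0 + psi0 z) U nU; move=> /nbhs_ballP [d d0 hd].
have d20 : 0 < d / 2 by rewrite divr_gt0.
(* [toT] is open, so a neighbourhood of z.2 is the image of a ball, and continuity of the sum is
   checked on real lifts. *)
have n2 : nbhs z.2 (@toT R @` ball y0 (d / 2)).
  rewrite -y0E; apply: open_nbhs_nbhs; split; first by apply: toT_open; exact: ball_open.
  by exists y0 => //; exact: ballxx.
have A1 : \forall w \near z, (@toT R @` ball y0 (d / 2)) w.2 by apply: (cvg_snd n2).
have A2 : \forall w \near z, ball (psi0 z) (d / 2) (psi0 w).
  by apply: cpsi; exact: nbhsx_ballx.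
suff : \forall w \near z, U (w.2 + toT (psi0 w)) by [].
apply: filterS2 A1 A2 => w [y By <-] Bp; rewrite /= -toTD; apply: hd.
rewrite /ball /= opprD addrACA (splitr d) (le_lt_trans (ler_normD _ _))// ltrD//.
Qed.

Lemma torus_map_measurable :
  measurable_fun [set: borel_torus2 R] (torus_map : borel_torus2 R -> borel_torus2 R).
Proof.
apply: (measurability (@open Z : set (set (borel_torus2 R)))) => //.
move=> _ [U oU <-]; rewrite setTI; apply: open_borel.
by apply: open_comp => // z _; exact: torus_map_continuous.
Qed.

(** Change of variables: the image of [mu] under the torus map agrees with [mu] on measurable
    sets. *)
Lemma torus_integral_invariant mu g :
  (forall E : set (borel_torus2 R), measurable E -> mu (torus_map @^-1` E) = mu E) ->
  continuous g -> \int[mu]_z g (torus_map z) = \int[mu]_z g z.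
Proof.
move=> inv cg; rewrite /Rintegral; congr fine.
have cgT : continuous (g \o torus_map).
  by move=> z; apply: continuous_comp; [exact: torus_map_continuous|exact: cg].
pose T : borel_torus2 R -> borel_torus2 R := torus_map.
have mT : measurable_fun setT T := torus_map_measurable.
have mg : measurable_fun setT (EFin \o (g : borel_torus2 R -> R)).
  by apply/measurable_EFinP; exact: continuous_borel.
have E := integral_pushforward mT mg (torus_integrable mu cgT) measurableT.
transitivity (\int[pushforward mu T]_(z in setT) (EFin \o g) z)%E; first by rewrite E.
by apply: eq_measure_integral => A mA _; exact: inv.
Qed.
End Torus.

(** * Conjugation invariance of the rotation number *)

Section RotationNumber.
Variable R : realType.
Local Open Scope complex_scope.
Local Notation C := R[i].
Local Notation Z := (circle R * circle R)%type.

Lemma ev_continuous (t : seq (int * C)) :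
  continuous (fun x => complex.Re (ev t x)) /\ continuous (fun x => complex.Im (ev t x)).
Proof.
have cl (k : int) : continuous (fun x : R => 2 * pi * (k%:~R * x)).
  by do 2 (apply: contM; first exact: cont_cst); exact: cont_id.
elim: t => [|p t [IH1 IH2]].
  rewrite (_ : (fun x => complex.Re (ev [::] x)) = fun=> 0); last by apply/funext => x; rewrite ev_nil.
  rewrite (_ : (fun x => complex.Im (ev [::] x)) = fun=> 0); last by apply/funext => x; rewrite ev_nil.
  by split; exact: cont_cst.
have cc : continuous (fun x : R => cos (2 * pi * (p.1%:~R * x))).
  exact: (cont_comp (@continuous_cos R) (cl p.1)).
have cs : continuous (fun x : R => sin (2 * pi * (p.1%:~R * x))).
  exact: (cont_comp (@continuous_sin R) (cl p.1)).
split.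
  rewrite (_ : (fun x => _) = fun x => (complex.Re p.2 * cos (2 * pi * (p.1%:~R * x)) -
    complex.Im p.2 * sin (2 * pi * (p.1%:~R * x))) + complex.Re (ev t x)); last first.
    by apply/funext => x; rewrite /ev big_cons ReD ReM.
  apply: contD => //.
  by apply: contB; apply: contM => //; exact: cont_cst.
rewrite (_ : (fun x => _) = fun x => (complex.Re p.2 * sin (2 * pi * (p.1%:~R * x)) +
    complex.Im p.2 * cos (2 * pi * (p.1%:~R * x))) + complex.Im (ev t x)); last first.
  by apply/funext => x; rewrite /ev big_cons ImD ImM.
apply: contD => //.
by apply: contD; apply: contM => //; exact: cont_cst.
Qed.

(** Functions on the circle are built as f(repr c) with f of period 1; this computes them on
    lifts. *)
Lemma repr_toT (V : Type) (f : R -> V) (x : R) : (forall y, f (y + 1) = f y) ->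
  f (repr (toT x)) = f x.
Proof.
move=> fp; have : toT (repr (toT x)) = toT x by rewrite /toT reprK.
move=> /toT_eq/intrP [k hk].
have fn (q : nat) y : f (y + q%:R) = f y.
  by elim: q => [|q IH]; rewrite ?addr0// -natr1 addrA fp IH.
have -> : repr (toT x) = x + k%:~R by rewrite -hk addrC subrK.
case: (k) => q; first exact: fn.
by rewrite NegzE mulrNz -pmulrn; have := fn q.+1 (x - q.+1%:R); rewrite subrK => ->.
Qed.

Lemma circle_continuous (f : R -> R) : continuous f -> (forall y, f (y + 1) = f y) ->
  continuous (fun c : circle R => f (repr c)).
Proof.
move=> cf fp; apply/quotient_continuous.
rewrite (_ : _ \o _ = f) //; apply/funext => x /=; exact: repr_toT.
Qed.

Lemma torus_fst_continuous (f : R -> R) : continuous f -> (forall y, f (y + 1) = f y) ->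
  continuous (fun z : Z => f (repr z.1)).
Proof.
move=> cf fp z; apply: (@continuous_comp _ _ _ fst (fun c : circle R => f (repr c)) z).
  exact: cvg_fst.
exact: circle_continuous.
Qed.

(** Along a segment joining lifts of z0 and z, [g] never takes the values 1/2 and -1/2, which are
    too far from the integers; by the intermediate value theorem it stays near 0. *)
Lemma near_integer_connected (g : Z -> R) (z0 : Z) : continuous g -> g z0 = 0 ->
  (forall z, exists k : int, `|g z - k%:~R| <= 4^-1) -> forall z, `|g z| <= 4^-1.
Proof.
move=> cg g0 hg z.
have [s0 s0E] := toT_surj z0.1; have [t0 t0E] := toT_surj z0.2.
have [s sE] := toT_surj z.1; have [t tE] := toT_surj z.2.
pose k (l : R) := g (toT (s0 + l * (s - s0)), toT (t0 + l * (t - t0))).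
have ck : continuous k.
  have ca (a b : R) : continuous (fun l : R => toT (a + l * b)).
    apply: (cont_comp (@toT_continuous R)).
    by apply: contD; [exact: cont_cst|apply: contM; [exact: cont_id|exact: cont_cst]].
  exact: (cont_comp cg (fun l => continuous_pair_for (ca s0 (s - s0) l) (ca t0 (t - t0) l))).
have k0 : k 0 = 0 by rewrite /k !mul0r !addr0 s0E t0E -surjective_pairing.
have k1 : k 1 = g z by rewrite /k !mul1r !(addrC _ (_ - _)) !subrK sE tE -surjective_pairing.
have half (v : R) : (v = 2^-1 \/ v = - 2^-1) -> forall l, k l <> v.
  move=> hv l kl; have [m] := hg (toT (s0 + l * (s - s0)), toT (t0 + l * (t - t0))).
  rewrite -/(k l) kl ler_norml => /andP[h1 h2].
  have [h3 h4] : m%:~R < (1 : int)%:~R :> R /\ (-1 : int)%:~R < m%:~R :> R.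
    by case: hv h1 h2 => -> h1 h2; rewrite mulrNz; split; lra.
  have m0 : m = 0 by rewrite !ltr_int in h3 h4; lia.
  by case: hv h1 h2 => ->; rewrite m0; lra.
have [m] := hg z; rewrite ler_norml => /andP[h1 h2].
rewrite leNgt; apply/negP => hz.
have cw : {within `[0, 1], continuous k} by exact: continuous_subspaceT.
have [gp|gn] := leP 0 (g z).
  rewrite ger0_norm// in hz.
  have m1 : 0 < m by rewrite -(ltr_int R); lra.
  have : 1%:~R <= m%:~R :> R by rewrite ler_int.
  move=> m2; have [|c _ kc] := @IVT _ k 0 1 2^-1 ler01 cw.
    rewrite k0 k1 min_l// max_r//; apply/andP; split; lra.
  exact: (half 2^-1 (or_introl erefl) c).
rewrite ltr0_norm// in hz.
have m1 : m < 0 by rewrite -(ltr_int R); lra.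
have : m%:~R <= (- 1)%:~R :> R by rewrite ler_int; lia.
rewrite mulrNz => m2; have [|c _ kc] := @IVT _ k 0 1 (- 2^-1) ler01 cw.
  rewrite k0 k1 min_r ?max_l ?(ltW gn)//; apply/andP; split; lra.
exact: (half (- 2^-1) (or_intror erefl) c).
Qed.

Lemma rcV (x : R) : (x^-1)%:C = x%:C^-1.
Proof. exact: fmorphV. Qed.

Variables (al : R) (psi0 : Z -> R) (mu : probability (borel_torus2 R) R) (I0 : R).
Hypothesis cpsi : continuous psi0.
Local Notation T := (torus_map al psi0).
Hypothesis inv : forall E : set (borel_torus2 R), measurable E -> mu (T @^-1` E) = mu E.

(* [W] is a moving frame of directions along the invariant measure, in which
   the cocycle acts with the lift [ps]. *)
Definition rotates (a b : R -> C) := exists (W : Z -> C) (ps : Z -> R),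
  [/\ continuous (fun z => complex.Re (W z)), continuous (fun z => complex.Im (W z)),
      forall z, cabs (W z) = 1 & continuous ps] /\
  [/\ forall x y, exists2 u : R, 0 < u & a x * W (toT x, y) + b x * conjc (W (toT x, y)) =
        u%:C * e (ps (toT x, y)) * W (toT x, y),
      forall z, W (T z) = e (ps z) * W z & \int[mu]_z ps z = I0].

Lemma rotates_ext a b a' b' : (forall x, a x = a' x) -> (forall x, b x = b' x) ->
  rotates a b -> rotates a' b'.
Proof.
move=> ha hb [W [ps [h [h1 h2 h3]]]]; exists W, ps; split => //; split => // x y.
by rewrite -ha -hb.
Qed.

(** General conjugation by w -> p w + s conj(w). The direction W is sent to e(be) W, so the lift
    becomes ps + be o T - be; the added coboundary has zero integral because [mu] is invariant. The
    inverse of the conjugacy is w -> conj(p) w - s conj(w) up to a positive factor. *)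
Lemma rotates_step (h : R -> R) (p s a b : R -> C) : (forall x, 0 < h x) ->
  (forall x, exists2 d : R, 0 < d & p x * conjc (p x) - s x * conjc (s x) = d%:C) ->
  (forall W : Z -> C, continuous (fun z => complex.Re (W z)) ->
     continuous (fun z => complex.Im (W z)) -> (forall z, cabs (W z) = 1) ->
     exists2 be : Z -> R, continuous be & forall x y, exists2 u : R, 0 < u &
       p x * W (toT x, y) + s x * conjc (W (toT x, y)) = u%:C * e (be (toT x, y)) * W (toT x, y)) ->
  rotates a b ->
  rotates (fun x => (h x)%:C * ((p (x + al) * a x + s (x + al) * conjc (b x)) * conjc (p x) -
                      (p (x + al) * b x + s (x + al) * conjc (a x)) * conjc (s x)))
          (fun x => (h x)%:C * ((p (x + al) * b x + s (x + al) * conjc (a x)) * p x -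
                      (p (x + al) * a x + s (x + al) * conjc (b x)) * s x)).
Proof.
move=> h0 hd hbe [W [ps [[c1 c2 W1 cps] [hA hT hI]]]].
have [be cbe hP] := hbe W c1 c2 W1.
have cbeT : continuous (fun z => be (T z)).
  exact: (cont_comp cbe (torus_map_continuous cpsi)).
have ce : continuous (fun z => cos (2 * pi * be z)).
  by apply: (cont_comp (@continuous_cos R)); apply: contM => //; exact: cont_cst.
have se : continuous (fun z => sin (2 * pi * be z)).
  by apply: (cont_comp (@continuous_sin R)); apply: contM => //; exact: cont_cst.
exists (fun z => e (be z) * W z), (fun z => ps z + be (T z) - be z); split; split.
- rewrite (_ : (fun z => _) = fun z => cos (2 * pi * be z) * complex.Re (W z) -
    sin (2 * pi * be z) * complex.Im (W z)); last by apply/funext => z; rewrite ReM.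
  by apply: contB; apply: contM.
- rewrite (_ : (fun z => _) = fun z => cos (2 * pi * be z) * complex.Im (W z) +
    sin (2 * pi * be z) * complex.Re (W z)); last by apply/funext => z; rewrite ImM.
  by apply: contD; apply: contM.
- by move=> z; rewrite cabsM cabs_e W1 mulr1.
- by apply: contB => //; exact: contD.
- move=> x y; have [u0 u00 E0] := hA x y; have [u1 u10 E1] := hP x y.
  have [d d0 Ed] := hd x; set z := (toT x, y) in E0 E1 *.
  have [u2 u20 E2] := hP (x + al) (T z).2.
  have TzE : (toT (x + al), (T z).2) = T z by rewrite /torus_map /= toTD.
  rewrite TzE hT in E2.
  exists (h x * d * u0 * u2 / u1); first by rewrite divr_gt0// !mulr_gt0.
  have u1n : u1%:C != 0 :> C by rewrite eq_complex /= eqxx andbT gt_eqF.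
  have E1' : e (be z) * W z = u1%:C^-1 * (p x * W z + s x * conjc (W z)).
    by rewrite E1 -mulrA mulKf.
  have cc (r : R) (v : C) : conjc (r%:C^-1 * v) = r%:C^-1 * conjc v.
    by rewrite conjcM -rcV conjc_realC.
  have Aw : conjc (a x * W z + b x * conjc (W z)) = conjc (a x) * conjc (W z) + conjc (b x) * W z.
    by rewrite conjcD !conjcM conjcc.
  rewrite E1' cc conjcD !conjcM conjcc.
  set L := (X in X = _).
  have -> : L = (h x)%:C * u1%:C^-1 * ((p x * conjc (p x) - s x * conjc (s x)) *
     (p (x + al) * (a x * W z + b x * conjc (W z)) +
      s (x + al) * (conjc (a x) * conjc (W z) + conjc (b x) * W z))).
    by rewrite /L; ring.
  have cr (r : R) (v : C) : conjc (r%:C * v) = r%:C * conjc v by rewrite conjcM conjc_realC.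
  rewrite -Aw Ed E0 -[u0%:C * _ * _]mulrA cr.
  have -> : p (x + al) * (u0%:C * (e (ps z) * W z)) + s (x + al) * (u0%:C * conjc (e (ps z) * W z)) =
    u0%:C * (p (x + al) * (e (ps z) * W z) + s (x + al) * conjc (e (ps z) * W z)) by ring.
  rewrite E2 -E1' !eD eN !rcM (_ : u1^-1%:C = u1%:C^-1); last by rewrite -rcV.
  have eb : conjc (e (be z)) * e (be z) = 1 by rewrite mulrC mulcJ cabs_e expr1n.
  rewrite [RHS](_ : _ = (h x)%:C * d%:C * u0%:C * u2%:C * u1%:C^-1 * (e (ps z) * e (be (T z))) * W z *
    (conjc (e (be z)) * e (be z))); last by ring.
  by rewrite eb; ring.
- move=> z; rewrite hT.
  have eb : conjc (e (be z)) * e (be z) = 1 by rewrite mulrC mulcJ cabs_e expr1n.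
  rewrite !eD eN [RHS](_ : _ = e (ps z) * e (be (T z)) * W z * (conjc (e (be z)) * e (be z)));
    last by ring.
  by rewrite eb; ring.
- have ips := torus_integrable mu cps; have ibe := torus_integrable mu cbe.
  have ibeT := torus_integrable mu cbeT.
  have ipb : mu.-integrable setT (EFin \o ((fun z => ps z + be (T z)) : borel_torus2 R -> R)).
    by apply: torus_integrable; exact: contD.
  rewrite (@RintegralB _ _ _ mu setT (fun z => ps z + be (T z)) be measurableT ipb ibe).
  rewrite (@RintegralD _ _ _ mu setT ps (fun z => be (T z)) measurableT ips ibeT).
  by rewrite (torus_integral_invariant cpsi inv cbe) addrK.
Qed.

Lemma rotates_rt (h psi : R -> R) a b : (forall x, 0 < h x) -> trig (fun x => (psi x)%:C) ->
  rotates a b -> rotates (rt_a al h psi a) (rt_b al h psi b).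
Proof.
move=> h0 [t ht] hab; have psip x : psi (x + 1) = psi x.
  by have := ht (x + 1); rewrite ev_period -ht => /(congr1 (@complex.Re _)).
have cps : continuous psi.
  have [c _] := ev_continuous t; rewrite (_ : psi = fun x => complex.Re (ev t x))//.
  by apply/funext => x; rewrite -ht.
have pi0 : 2 * (pi : R) != 0 by rewrite mulf_neq0// gt_eqF// pi_gt0.
have eps x : e (psi x / (2 * pi)) = cis (psi x) by rewrite /e mulrC divfK.
apply: rotates_ext (@rotates_step h (fun x => cis (psi x)) (fun=> 0) a b h0 _ _ hab).
- by move=> x; rewrite conjc0 mulr0 !mul0r addr0 subr0 /rt_a cisD cisN; ring.
- by move=> x; rewrite mulr0 mul0r addr0 subr0 /rt_b cisD; ring.
- by move=> x; exists 1; rewrite // mulcJ cabs_cis mul0r subr0 expr1n.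
- move=> W _ _ W1; exists (fun z => psi (repr z.1) / (2 * pi)).
    by apply: contM; [exact: torus_fst_continuous|exact: cont_cst].
  move=> x y; exists 1 => //=; rewrite mul0r addr0 mul1r.
  by rewrite (@repr_toT _ psi) // eps.
Qed.

(** On a unit direction, W - m conj(W) = (1 - m conj(W)^2) W. As |m| < 1 the factor lies in the
    right half-plane, where the arctangent is a continuous choice of the argument. *)
Lemma rotates_cj m a b : trig m -> (forall x, cabs (m x) < 1) ->
  rotates a b -> rotates (cj_a al m a b) (cj_b al m a b).
Proof.
move=> [t ht] m1 hab.
have mp x : m (x + 1) = m x by rewrite !ht ev_period.
have [c1 c2] := ev_continuous t.
apply: rotates_ext (@rotates_step (fun=> 1) (fun=> 1) (fun x => - m x) a b (fun=> ltr01) _ _ hab).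
- by move=> x; rewrite /cj_a conjc1 !conjcN; ring.
- by move=> x; rewrite /cj_b; ring.
- move=> x; exists (1 - cabs (m x) ^+ 2).
    by rewrite subr_gt0 expr_lt1 ?cabs_ge0.
  by rewrite conjc1 mul1r conjcN mulrNN mulcJ rcB.
move=> W cR cI W1.
pose q (z : Z) : C := 1 - m (repr z.1) * (conjc (W z) ^+ 2).
have qRe z : 0 < complex.Re (q z).
  rewrite /q ReD ReN /= subr_gt0; apply: le_lt_trans (m1 (repr z.1)).
  apply: le_trans (ler_norm _) _; apply: le_trans (Re_le_cabs _) _.
  by rewrite cabsM cabsX cabsJ W1 expr1n mulr1.
have cmR : continuous (fun z : Z => complex.Re (m (repr z.1))).
  apply: (@torus_fst_continuous (fun x => complex.Re (m x))); last by move=> y; rewrite mp.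
  rewrite (_ : (fun x => complex.Re (m x)) = fun x => complex.Re (ev t x))//.
  by apply/funext => x; rewrite ht.
have cmI : continuous (fun z : Z => complex.Im (m (repr z.1))).
  apply: (@torus_fst_continuous (fun x => complex.Im (m x))); last by move=> y; rewrite mp.
  rewrite (_ : (fun x => complex.Im (m x)) = fun x => complex.Im (ev t x))//.
  by apply/funext => x; rewrite ht.
have cqR : continuous (fun z => complex.Re (q z)).
  rewrite (_ : (fun z => _) = fun z => 1 - (complex.Re (m (repr z.1)) *
     (complex.Re (W z) * complex.Re (W z) - complex.Im (W z) * complex.Im (W z)) +
     complex.Im (m (repr z.1)) * (complex.Re (W z) * complex.Im (W z) * 2))); last first.
    apply/funext => z; rewrite /q expr2 ReD ReN ReM ReM ImM.
    by case: (W z) => u v /=; ring.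
  apply: contB; first exact: cont_cst.
  apply: contD; apply: contM => //; first by apply: contB; apply: contM.
  by apply: contM; [exact: contM|exact: cont_cst].
have cqI : continuous (fun z => complex.Im (q z)).
  rewrite (_ : (fun z => _) = fun z => complex.Re (m (repr z.1)) *
       (complex.Re (W z) * complex.Im (W z) * 2) - complex.Im (m (repr z.1)) *
     (complex.Re (W z) * complex.Re (W z) - complex.Im (W z) * complex.Im (W z))); last first.
    apply/funext => z; rewrite /q expr2 ImD ImN ImM ReM ImM.
    by case: (W z) => u v /=; ring.
  apply: contB; apply: contM => //; last by apply: contB; apply: contM.
  by apply: contM; [exact: contM|exact: cont_cst].
have pi0 : 2 * (pi : R) != 0 by rewrite mulf_neq0// gt_eqF// pi_gt0.
exists (fun z => atan (complex.Im (q z) / complex.Re (q z)) / (2 * pi)).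
  apply: contM; last exact: cont_cst.
  apply: (cont_comp (@continuous_atan R)); apply: contM => //.
  by apply: contV => // z; rewrite gt_eqF.
move=> x y; set z := (toT x, y).
pose tt := complex.Im (q z) / complex.Re (q z).
have ct : 0 < cos (atan tt).
  by rewrite cos_atan invr_gt0 sqrtr_gt0 ltr_pwDl// sqr_ge0.
exists (complex.Re (q z) / cos (atan tt)); first by rewrite divr_gt0.
have mz : m x = m (repr z.1) by rewrite /z /= repr_toT.
have st : sin (atan tt) = tt * cos (atan tt).
  have H : sin (atan tt) / cos (atan tt) = tt by exact: atanK.
  by rewrite -{2}H divfK// gt_eqF.
have -> : 1 * W z + - m x * conjc (W z) = q z * W z.
  rewrite /q mz expr2 mulrBl mul1r -!mulrA (mulrC _ (W z)) (mulrA (conjc _)).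
  by rewrite (mulrC (conjc _) (W z)) mulcJ W1 expr1n mulNr mul1r.
have ee : e (atan tt / (2 * pi)) = cis (atan tt) by rewrite /e mulrC divfK.
congr (_ * _); rewrite ee; apply: complexP => /=.
  by rewrite mul0r subr0 divfK// gt_eqF.
have cn : cos (atan tt) != 0 by rewrite gt_eqF.
have rn : complex.Re (q z) != 0 by rewrite gt_eqF.
rewrite mul0r addr0 st; move: cn; move: (cos _) => c cn; rewrite /tt; field.
by rewrite rn cn.
Qed.

(** At every point e(ps) is within 4 eta of kap, so [ps] is constant up to 4 eta modulo the
    integers. By connectedness it is so as a real function, and its mean I0 is close to any of its
    values. *)
Lemma rotates_near a b kap eta : cabs kap = 1 -> 0 <= eta -> eta <= 16^-1 ->
  (forall x, cabs (a x - kap) <= eta) -> (forall x, cabs (b x) <= eta) ->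
  rotates a b -> cabs (e I0 - kap) <= 40 * eta.
Proof.
move=> k1 eta0 eta16 ha hb [W [ps [[c1 c2 W1 cps] [hA hT hI]]]].
have near z : cabs (e (ps z) - kap) <= 4 * eta.
  have [x xE] := toT_surj z.1; have [u u0 E] := hA x z.2.
  rewrite xE -surjective_pairing in E.
  have WW : W z * conjc (W z) = 1 by rewrite mulcJ W1 expr1n.
  have E2 : a x + b x * conjc (W z) ^+ 2 = u%:C * e (ps z).
    have := congr1 (fun v => v * conjc (W z)) E.
    by rewrite mulrDl -!mulrA WW -expr2 !mulr1.
  have E3 : cabs (u%:C * e (ps z) - kap) <= 2 * eta.
    rewrite -E2 addrAC mulr2n mulrDl mul1r; apply: cabs_add_le => //.
    by rewrite cabsM cabsX cabsJ W1 expr1n mulr1.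
  have E4 : `|u - 1| <= 2 * eta.
    have h1 := cabs_sub_ge (u%:C * e (ps z)) kap; have h2 := cabs_sub_ge kap (u%:C * e (ps z)).
    rewrite (cabs_dist kap) in h2.
    rewrite cabsM cabs_e cabs_real k1 mulr1 gtr0_norm// in h1 h2.
    by rewrite ler_norml; apply/andP; split; lra.
  have -> : e (ps z) - kap = (u%:C * e (ps z) - kap) - (u - 1)%:C * e (ps z).
    by rewrite rcB; ring.
  rewrite (_ : 4 * eta = 2 * eta + 2 * eta); last by ring.
  by apply: cabs_sub_le => //; rewrite cabsM cabs_real cabs_e mulr1.
pose z0 : Z := point; pose g z := ps z - ps z0.
(* The finer bound 4 eta is kept next to the 1/4 that [near_integer_connected] asks for; the integer
   k is shown to be 0 afterwards. *)
have gint z : exists2 k : int, `|g z - k%:~R| <= 4 * eta & `|g z - k%:~R| <= 4^-1.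
  have [k hk] := nearest_int (g z); exists k; have := cabs_eB1_ge hk.
    have -> : e (g z) - 1 = conjc (e (ps z0)) * ((e (ps z) - kap) - (e (ps z0) - kap)).
      rewrite /g eD eN -[1](_ : conjc (e (ps z0)) * e (ps z0) = 1); first by ring.
      by rewrite mulrC mulcJ cabs_e expr1n.
    rewrite cabsM cabsJ cabs_e mul1r => h.
    by have := cabs_sub_le (near z) (near z0); lra.
  have -> : e (g z) - 1 = conjc (e (ps z0)) * ((e (ps z) - kap) - (e (ps z0) - kap)).
    rewrite /g eD eN -[1](_ : conjc (e (ps z0)) * e (ps z0) = 1); first by ring.
    by rewrite mulrC mulcJ cabs_e expr1n.
  rewrite cabsM cabsJ cabs_e mul1r => h.
  by have := cabs_sub_le (near z) (near z0); lra.
have cg : continuous g.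
  by apply: contB => //; exact: cont_cst.
have g0 : g z0 = 0 by rewrite /g subrr.
have gsmall z : `|g z| <= 4 * eta.
  have := near_integer_connected cg g0 (fun z => let: ex_intro2 k _ h := gint z in ex_intro _ k h) z.
  have [k h1 h2] := gint z => h3.
  suff k0 : k = 0 by move: h1; rewrite k0 subr0.
  move: h2 h3; rewrite !ler_norml => /andP[h4 h5] /andP[h6 h7].
  have h8 : k%:~R < (1 : int)%:~R :> R by lra.
  have h9 : (-1 : int)%:~R < k%:~R :> R by rewrite mulrNz; lra.
  by rewrite !ltr_int in h8 h9; lia.
have Ib : `|I0 - ps z0| <= 4 * eta.
  have m1 : fine (mu setT) = 1 by rewrite (@probability_setT _ _ _ mu).
  have cI (c : R) : \int[mu]_(z in setT) c = c.
    by rewrite (Rintegral_cst mu measurableT) m1 mulr1.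
  have ips := torus_integrable mu cps.
  have ic (c : R) : mu.-integrable setT (EFin \o ((fun=> c) : borel_torus2 R -> R)).
    by apply: torus_integrable; exact: cont_cst.
  have h1 : ps z0 - 4 * eta <= I0.
    rewrite -hI -(cI (ps z0 - 4 * eta)).
    apply: (@le_Rintegral _ _ _ mu setT (fun=> _) ps measurableT (ic _) ips) => z _.
    by have := gsmall z; rewrite /g ler_norml => /andP[h1 h2]; lra.
  have h2 : I0 <= ps z0 + 4 * eta.
    rewrite -hI -(cI (ps z0 + 4 * eta)).
    apply: (@le_Rintegral _ _ _ mu setT ps (fun=> _) measurableT ips (ic _)) => z _.
    by have := gsmall z; rewrite /g ler_norml => /andP[h2 h3]; lra.
  by rewrite ler_norml; apply/andP; split; lra.
rewrite (_ : e I0 - kap = (e I0 - e (ps z0)) + (e (ps z0) - kap)); last by ring.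
rewrite (_ : 40 * eta = 36 * eta + 4 * eta); last by ring.
apply: cabs_add_le (near z0).
by apply: le_trans (cabs_eB_le _ _) _; lra.
Qed.

End RotationNumber.

(** * Scales adapted to alpha and rho *)

Section Arithmetic.
Variable R : realType.
Implicit Types (l p j : int) (k n r q m : nat).
Variables (al rho gam : R) (T : nat).
Hypothesis gam0 : 0 < gam.
Hypothesis dioph : forall l j, gam <= `|l%:~R * al - 2 * rho - j%:~R| * brk R l ^+ T.

Local Notation c := (gam / 8).

(** For q > 0 this says that [al] is within c / (q^(T+1) 2^m) of a fraction of denominator q: a
    quantified form of being Liouville at q. *)
Definition near_rational q m := exists p, `|q%:R * al - p%:~R| * (q%:R ^+ T * 2 ^+ m) < c.

Lemma near_rational_le q m m' : (m' <= m)%N -> near_rational q m -> near_rational q m'.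
Proof.
move=> mm [p hp]; exists p; apply: le_lt_trans hp; apply: ler_wpM2l => //.
by apply: ler_wpM2l; [rewrite exprn_ge0|rewrite ler_weXn2l// ler1n].
Qed.

Lemma not_near_rational q m l p : l != 0 -> (`|l| < q)%N ->
  (forall q', (0 < q')%N -> (q' < q)%N -> ~ near_rational q' m) ->
  c <= `|l%:~R * al - p%:~R| * (`|l%:~R| ^+ T * 2 ^+ m).
Proof.
move=> l0 lq h; rewrite leNgt; apply/negP => H.
have l00 : (0 < `|l|)%N by rewrite absz_gt0.
apply: (h _ l00 lq); case: (leP 0 l) => hl.
  by exists p; rewrite natr_absz intr_norm; move: H; rewrite ger0_norm ?ler0z.
exists (- p); rewrite natr_absz intr_norm; move: H.
by rewrite ltr0_norm ?ltrz0// mulNr !mulrNz -opprD normrN.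
Qed.

(** Write l = u q + l' with 0 <= l' < q. As q al is very close to the integer p, l al differs from
    l' al + u p by little, and the condition on rho is used only at l', where it costs q^T instead
    of |l|^T. *)
Lemma resonance_Liouville q r l j : (0 < q)%N -> (q <= 2 ^ r)%N -> near_rational q r ->
  (`|l| <= 2 ^ r)%N -> gam / 2 <= `|l%:~R * al - 2 * rho - j%:~R| * q%:R ^+ T.
Proof.
move=> q0 qr [p hp] lr; pose u := (l %/ q%:Z)%Z; pose l' := (l %% q%:Z)%Z.
have lE : l = u * q%:Z + l' by exact: divz_eq.
have l'0 : 0 <= l' by apply: modz_ge0; lia.
have l'q : l' < q%:Z by apply: ltz_pmod; lia.
have ur : `|u%:~R : R| <= 2 * 2 ^+ r.
  have : (`|u| <= 2 * 2 ^ r)%N.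
    have : (`|u| * q <= 2 ^ r + q)%N by lia.
    move=> h1; have : (`|u| * q <= 2 ^ r * q + q)%N by nia.
    by rewrite -mulSnr leq_pmul2r//; nia.
  by move=> h; rewrite -intr_norm -natr_absz; move: h; rewrite -(ler_nat R) natrM natrX.
have qT0 : 0 < q%:R ^+ T :> R by rewrite exprn_gt0// ltr0n.
have h1 : gam <= `|l'%:~R * al - 2 * rho - (j - u * p)%:~R| * q%:R ^+ T.
  apply: le_trans (dioph l' (j - u * p)) _; apply: ler_wpM2l => //.
  apply: lerXn2r; rewrite ?nnegrE// ?(le_trans ler01 (brk_ge1 _ _))// /brk ge_max ler1n q0 /=.
  by rewrite ger0_norm ?ler0z// -[q%:R]/(q%:Z%:~R) ler_int ltW.
have h2 : `|u%:~R * (q%:R * al - p%:~R)| * q%:R ^+ T <= gam / 4.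
  rewrite normrM -mulrA; apply: le_trans (ler_wpM2r _ ur) _; first by rewrite mulr_ge0// ltW.
  rewrite mulrACA; move: hp; rewrite mulrCA => hp; have := ltW hp; lra.
have -> : l%:~R * al - 2 * rho - j%:~R = (l'%:~R * al - 2 * rho - (j - u * p)%:~R) +
    u%:~R * (q%:R * al - p%:~R).
  by rewrite [in LHS]lE intrB !intrD !intrM -[q%:Z%:~R]/(q%:R); ring.
have := lerB_normD (l'%:~R * al - 2 * rho - (j - u * p)%:~R) (u%:~R * (q%:R * al - p%:~R)).
move=> h3; have := ler_wpM2r (ltW qT0) h3; rewrite mulrBl; move: h1 h2.
have K (A B X : R) : gam <= A -> B <= gam / 4 -> A - B <= X -> gam / 2 <= X.
  by move=> *; have := gam0; lra.
exact: K.
Qed.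

(** [n] measures the divisors below the cutoff [q], and [r] the window on which the condition on rho
    costs only a power of [q]. If no denominator below Y = 2^(k/2) is near rational at [k], then n =
    k and the cutoff Y works directly. Otherwise take the least such q. If it is still near rational
    at 6k/5, the window is extended by [resonance_Liouville] with cutoff q; if not, n is raised to
    6k/5 and the cutoff is Y again. *)
Lemma scale_step k : (20 <= k)%N -> exists n r q : nat,
  [/\ (k <= n)%N, (5 * n <= 6 * k + 4)%N, (6 * n <= 5 * r)%N & (2 * r <= 3 * k + 2)%N] /\
  [/\ (0 < q)%N, (q <= 2 ^ n)%N,
    forall l p, l != 0 -> (`|l| < q)%N -> c <= `|l%:~R * al - p%:~R| * (`|l%:~R| ^+ T * 2 ^+ n) &
    forall l j, (`|l| <= 2 ^ r)%N -> gam / 2 <= `|l%:~R * al - 2 * rho - j%:~R| * q%:R ^+ (4 * T)].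
Proof.
move=> k20; pose y := ((k + 1) %/ 2)%N; pose Y := (2 ^ y)%N.
pose n1 := ((6 * k + 4) %/ 5)%N; pose rm := ((3 * k + 1) %/ 2)%N.
have Y0 : (0 < Y)%N by rewrite expn_gt0.
have Yk m : (k <= m)%N -> (Y <= 2 ^ m)%N by move=> km; rewrite leq_exp2l// /y; lia.
have resY l j : (`|l| <= 2 ^ rm)%N ->
    gam / 2 <= `|l%:~R * al - 2 * rho - j%:~R| * Y%:R ^+ (4 * T).
  move=> lr; apply: (@le_trans _ _ gam); first by have := gam0; lra.
  apply: le_trans (dioph l j) _; apply: ler_wpM2l => //.
  apply: (@le_trans _ _ ((2 ^ rm)%N%:R ^+ T)).
    apply: lerXn2r; rewrite ?nnegrE// ?(le_trans ler01 (brk_ge1 _ _))//.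
    by rewrite /brk ge_max ler1n expn_gt0 /= -intr_norm -natr_absz ler_nat.
  rewrite -!natrX ler_nat -!expnM leq_exp2l//.
  have h : (rm <= y * 4)%N by rewrite /rm /y; lia.
  by rewrite mulnA leq_mul2r h orbT.
have [|none] := pselect (exists q, [&& (0 < q)%N, (q < Y)%N & `[< near_rational q k >]]); last first.
  exists k, rm, Y; do !split => //; rewrite ?/rm ?Yk//; try lia.
    move=> l p l0 lY. apply: (not_near_rational p l0 lY) => q' q0 qY hq; apply: none.
    by exists q'; rewrite q0 qY; apply/asboolP.
move=> ex; have [q /and3P[q0 qY /asboolP hq] qmin] := ex_minnP ex.
have qlow q' : (0 < q')%N -> (q' < q)%N -> ~ near_rational q' k.
  move=> q'0 q'q hq'; have := qmin q'; rewrite q'0 (ltn_trans q'q qY)/=.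
  by move=> /(_ (introT (asboolP _) hq')); lia.
have [hn1|hn1] := pselect (near_rational q n1).
  have ex2 : exists m, (m <= rm)%N && `[< near_rational q m >].
    by exists n1; apply/andP; split; [rewrite /n1 /rm; lia|exact/asboolP].
  have ub m : (m <= rm)%N && `[< near_rational q m >] -> (m <= rm)%N by case/andP.
  have [r /andP[rrm /asboolP hr] rmax] := ex_maxnP ex2 ub.
  have n1r : (n1 <= r)%N.
    by apply: rmax; apply/andP; split; [rewrite /n1 /rm; lia|exact/asboolP].
  have kr : (k <= r)%N by apply: leq_trans n1r; rewrite /n1; lia.
  exists k, r, q; do !split => //; rewrite ?(leq_trans (ltnW qY) (Yk _ _))//.
  - lia.
  - by move: n1r; rewrite /n1; lia.
  - by move: rrm; rewrite /rm; lia.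
  - by move=> l p l0 lq; exact: (not_near_rational p l0 lq).
  - move=> l j lr; apply: le_trans (resonance_Liouville _ q0 _ hr lr) _.
      by rewrite (leq_trans (ltnW qY))// Yk.
    by apply: ler_wpM2l => //; rewrite ler_weXn2l ?ler1n//; lia.
(* A q' < Y near rational at [n1] satisfies q <= q' by minimality. Two distinct fractions p/q and
   p'/q' with such denominators could not both be that close to [al], so they coincide; then q is
   near rational at [n1], contrary to the case assumption. *)
exists n1, rm, Y; do !split => //; rewrite /n1 /rm /=; try lia.
- by apply: Yk; lia.
- move=> l p l0 lY; apply: (not_near_rational p l0 lY) => q' q'0 q'Y [p' hp'].
  apply: hn1; have hk' : near_rational q' k.
    by apply: near_rational_le (ex_intro _ p' hp'); lia.
  have qq' : (q <= q')%N by rewrite leqNgt; apply/negP => h; exact: (qlow _ q'0 h hk').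
  have [pq hpq] := hq.
  have sm (a b m : nat) pp : (0 < a)%N -> (a < Y)%N -> (b < Y)%N -> (k <= m)%N ->
      `|a%:R * al - pp%:~R| * (a%:R ^+ T * 2 ^+ m) < c -> b%:R * `|a%:R * al - pp%:~R| * 8 < gam.
    move=> a0 aY bY km ha; apply: (@le_lt_trans _ _ (`|a%:R * al - pp%:~R| * (a%:R ^+ T * 2 ^+ m) * 8)); last by lra.
    apply: ler_wpM2r => //; rewrite mulrC; apply: ler_wpM2l => //.
    have bm : b%:R <= 2 ^+ m :> R.
      by rewrite -natrX ler_nat (leq_trans (ltnW bY))// Yk.
    apply: le_trans bm _; rewrite ler_peMl ?exprn_ge0//.
    by rewrite exprn_ege1// ler1n.
  (* Frequency 0 compares gam with the distance of 2 rho to the integers. *)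
  have g1 : gam <= 2^-1.
    have [j hj] := nearest_int (- (2 * rho)); apply: le_trans hj.
    by have := dioph 0 j; rewrite mul0r sub0r /brk normr0 max_l// expr1n mulr1.
  have s1 := sm q q' k pq q0 qY q'Y (leqnn _) hpq.
  have s2 := sm q' q n1 p' q'0 q'Y qY (_ : (k <= n1)%N) hp'.
  have {}s2 := s2 ltac:(rewrite /n1; lia).
  have Eq : (p' * q%:Z - pq * q'%:Z)%:~R =
      q'%:R * (q%:R * al - pq%:~R) - q%:R * (q'%:R * al - p'%:~R) :> R.
    by rewrite intrB !intrM /=; ring.
  have pr : p' * q%:Z - pq * q'%:Z = 0.
    apply/eqP; rewrite -normr_le0 -ltzD1 add0r -(ltr_int R) intr_norm Eq.
    apply: le_lt_trans (ler_normB _ _) _; rewrite !normrM !normr_nat; lra.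
  exists pq; apply: le_lt_trans hp'; apply: ler_pM => //; last first.
    apply: ler_wpM2r => //.
    by apply: lerXn2r; rewrite ?nnegrE ?ler_nat.
  move: Eq; rewrite pr => /esym/eqP; rewrite subr_eq0 => /eqP Eq.
  have q'R : (0 : R) < q'%:R by rewrite ltr0n.
  have := congr1 (fun x : R => `|x|) Eq; rewrite !normrM !normr_nat => E1.
  by rewrite -(ler_pM2l q'R) E1 ler_wpM2r ?ler_nat.
Qed.

(** Each scale is started from the previous [r]. Then n_(i+1) is about at most (6/5)(3/2) k = 9k/5
    with k <= n_i, and k >= 20 lets the bound 19/10 absorb the roundings. *)
Lemma scale_sequence k0 : (20 <= k0)%N -> exists n r q : nat -> nat,
  [/\ (k0 <= n 0%N)%N, (n 0%N <= 2 * k0)%N,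
      forall i, (6 * n i <= 5 * r i)%N, forall i, (r i <= n i.+1)%N &
      forall i, (10 * n i.+1 <= 19 * n i)%N] /\
  [/\ forall i, (0 < q i)%N, forall i, (q i <= 2 ^ n i)%N,
    forall i l p, l != 0 -> (`|l| < q i)%N ->
      c <= `|l%:~R * al - p%:~R| * (`|l%:~R| ^+ T * 2 ^+ n i) &
    forall i l j, (`|l| <= 2 ^ r i)%N ->
      gam / 2 <= `|l%:~R * al - 2 * rho - j%:~R| * (q i)%:R ^+ (4 * T)].
Proof.
move=> k20.
have [F hF] : {F : nat -> nat * nat * nat & forall k, (20 <= k)%N ->
  let: (n, r, q) := F k in
  [/\ (k <= n)%N, (5 * n <= 6 * k + 4)%N, (6 * n <= 5 * r)%N & (2 * r <= 3 * k + 2)%N] /\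
  [/\ (0 < q)%N, (q <= 2 ^ n)%N,
    forall l p, l != 0 -> (`|l| < q)%N -> c <= `|l%:~R * al - p%:~R| * (`|l%:~R| ^+ T * 2 ^+ n) &
    forall l j, (`|l| <= 2 ^ r)%N -> gam / 2 <= `|l%:~R * al - 2 * rho - j%:~R| * q%:R ^+ (4 * T)]}.
  apply: (@choice _ _ (fun k F => (20 <= k)%N -> let: (n, r, q) := F in _)) => k.
  have [k2|k2] := leqP 20 k; last by exists (0, 0, 0)%N.
  by have [n [r [q H]]] := scale_step k2; exists (n, r, q).
pose ks i := iter i (fun k => (F k).1.2) k0.
have ks20 i : (20 <= ks i)%N.
  elim: i => [//|i IH]; rewrite /ks iterS -/(ks i).
  by move: (hF _ IH); case: (F _) => -[n r] q /= [[? ? ? ?] _]; lia.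
have H i := hF _ (ks20 i).
exists (fun i => (F (ks i)).1.1), (fun i => (F (ks i)).1.2), (fun i => (F (ks i)).2).
have ksS i : ks i.+1 = (F (ks i)).1.2 by [].
split; [split => [||i|i|i]|split].
- by have := H 0%N; rewrite /ks /=; case: (F _) => -[n r] q /= [[? ? ? ?] _].
- by have := H 0%N; rewrite /ks /=; case: (F _) => -[n r] q /= [[? ? ? ?] _]; lia.
- by have := H i; case: (F _) => -[n r] q /= [[? ? ? ?] _].
- by rewrite -ksS; have := H i.+1; case: (F _) => -[n r] q /= [[? ? ? ?] _].
- have := H i; have := H i.+1; have := ks20 i; rewrite ksS.
  case: (F (ks i)) => -[n r] q /=; case: (F r) => -[n' r'] q' /= h0 [[h1 h2 h3 h4] _] [[h5 h6 h7 h8] _].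
  by lia.
- by move=> i; have := H i; case: (F _) => -[n r] q /= [_ []].
- by move=> i; have := H i; case: (F _) => -[n r] q /= [_ []].
- by move=> i; have := H i; case: (F _) => -[n r] q /= [_ []].
- by move=> i; have := H i; case: (F _) => -[n r] q /= [_ []].
Qed.
End Arithmetic.

(** * The decreasing family of weights *)

Section Weights.
Variable R : realType.
Implicit Types (i j J t : nat) (k l : int).
Variables (n s : nat -> nat).
Hypothesis s1 : forall i, (0 < s i)%N.
Hypothesis growth : forall i, (16 * s i.+1 * 2 ^ n i <= 2 ^ n i.+1)%N.

Definition wfac i k : R := (1 + `|k%:~R| / 2 ^+ n i) ^+ s i.
Definition wprod j J k : R := \prod_(j <= i < J) wfac i k.
(** The supremum is the infinite product: partial products increase with [J] and [wprod_le] bounds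
    them. The factor [i] is a polynomial weight of order s_i acting beyond the scale 2^(n_i);
    passing from [j] to [j.+1] spends the factor [j]. *)
Definition wgt j k : R := sup [set wprod j J k | J in [set: nat]].

Lemma wfac_ge1 i k : 1 <= wfac i k.
Proof. by rewrite exprn_ege1// lerDl divr_ge0// exprn_ge0. Qed.

Lemma wprod_ge1 j J k : 1 <= wprod j J k.
Proof. by rewrite /wprod; elim/big_ind : _ => // [x y x1 y1|i _]; [exact: mulr_ege1|exact: wfac_ge1]. Qed.

(** The quotients s_i / 2^(n_i) decay geometrically, starting an eighth below 2^(-n_j). *)
Lemma scale_gap j i : (j < i)%N -> (s i * 2 ^ (n j + (i - j) + 3) <= 2 ^ n i)%N.
Proof.
elim: i => // i IH; rewrite ltnS leq_eqVlt => /orP[/eqP->|ji].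
  have -> : (n i + (i.+1 - i) + 3 = n i + 4)%N by lia.
  by rewrite expnD; have := growth i; lia.
have := IH ji; have -> : (n j + (i.+1 - j) + 3 = (n j + (i - j) + 3).+1)%N by lia.
rewrite expnS => h; have := growth i; have := s1 i => h1 h2; apply: leq_trans h2.
have h3 : (2 ^ (n j + (i - j) + 3) <= 2 ^ n i)%N by apply: leq_trans h; rewrite leq_pmull.
apply: (@leq_trans (s i.+1 * (16 * 2 ^ n i))); last by rewrite mulnCA mulnA.
apply: leq_mul => //; apply: leq_mul => //; lia.
Qed.

(** By 1 + x <= exp x and [scale_gap], the later factors contribute exponents |k| 2^(-n_j) / 8 times
    1/2, 1/4, and so on. *)
Lemma wprod_tail j J k : wprod j.+1 J k <= expR (`|k%:~R| / 2 ^+ n j / 8).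
Proof.
have H : forall d, wprod j.+1 (j.+1 + d) k <=
    expR (`|k%:~R| / 2 ^+ n j / 8 * (1 - (2 ^+ d)^-1)).
  elim=> [|d IH]; first by rewrite /wprod addn0 big_geq// expr0 invr1 subrr mulr0 expR0.
  rewrite /wprod addnS big_nat_recr /=; last by rewrite leq_addr.
  have h : wfac (j.+1 + d) k <= expR (`|k%:~R| / 2 ^+ n j / 8 * (2 ^+ d.+1)^-1).
    have := @scale_gap j (j.+1 + d) (leq_addr _ _).
    have -> : (n j + (j.+1 + d - j) + 3 = n j + d.+1 + 3)%N by lia.
    rewrite -(ler_nat R) natrM !natrX => h.
    apply: (@le_trans _ _ (expR (`|k%:~R| / 2 ^+ n (j.+1 + d)) ^+ s (j.+1 + d))).
      by apply: lerXn2r; rewrite ?nnegrE ?expR_ge0 ?expR_ge1Dx// addr_ge0// divr_ge0// exprn_ge0.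
    rewrite -expRM_natl ler_expR mulrCA -!mulrA; apply: ler_wpM2l => //.
    rewrite ler_pdivrMr ?exprn_gt0//.
    rewrite (_ : 8^-1 = (2 ^+ 3)^-1); last by congr (_^-1); rewrite -natrX.
    rewrite -!invfM mulrC ler_pdivlMr ?mulr_gt0 ?exprn_gt0// -!exprD.
    by rewrite (_ : (n j + (3 + d.+1) = n j + d.+1 + 3)%N)//; lia.
  apply: le_trans (ler_pM _ _ IH h) _.
  - by apply: le_trans (wprod_ge1 _ _ _).
  - by apply: le_trans (wfac_ge1 _ _).
  rewrite -expRD ler_expR -mulrDr; apply: ler_wpM2l; first by rewrite !divr_ge0// exprn_ge0.
  by rewrite exprS invfM; lra.
have H2 d : wprod j.+1 (j.+1 + d) k <= expR (`|k%:~R| / 2 ^+ n j / 8).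
  apply: le_trans (H d) _; rewrite ler_expR -[leRHS]mulr1; apply: ler_wpM2l.
    by rewrite !divr_ge0// exprn_ge0.
  by rewrite gerBl invr_ge0 exprn_ge0.
have [jJ|jJ] := leqP j.+1 J; first by rewrite -(subnKC jJ).
by have := H2 0%N; rewrite addn0 /wprod !big_geq// ltnW.
Qed.

Lemma wprod_le j J k : wprod j J k <= wfac j k * expR (`|k%:~R| / 2 ^+ n j / 8).
Proof.
have [jJ|jJ] := ltnP j J.
  rewrite /wprod big_ltn//; apply: ler_wpM2l; last exact: wprod_tail.
  by apply: le_trans (wfac_ge1 _ _).
rewrite /wprod big_geq//; apply: mulr_ege1; first exact: wfac_ge1.
by rewrite -expR0 ler_expR !divr_ge0// exprn_ge0.
Qed.

Lemma wprod_wgt j J k : wprod j J k <= wgt j k.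
Proof.
apply: ub_le_sup; last by exists J.
by exists (wfac j k * expR (`|k%:~R| / 2 ^+ n j / 8)) => _ [J' _ <-]; exact: wprod_le.
Qed.

Lemma wgt_le j k B : (forall J, wprod j J k <= B) -> wgt j k <= B.
Proof.
move=> h; apply: ge_sup; first by exists (wprod j 0 k), 0%N.
by move=> _ [J _ <-].
Qed.

Lemma wgt_ub j k : wgt j k <= wfac j k * expR (`|k%:~R| / 2 ^+ n j / 8).
Proof. by apply: wgt_le => J; exact: wprod_le. Qed.

Lemma wgt_ge1 j k : 1 <= wgt j k.
Proof. exact: le_trans (wprod_ge1 j 0 k) (wprod_wgt _ _ _). Qed.

Lemma wgt_weight j : weight (wgt j).
Proof.
split=> [|k|k|k l].
- apply/eqP; rewrite eq_le wgt_ge1 andbT; apply: wgt_le => J.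
  rewrite /wprod big1// => i _; by rewrite /wfac normr0 mul0r addr0 expr1n.
- exact: wgt_ge1.
- by rewrite /wgt; congr sup; apply: eq_imagel => J _; apply: eq_bigr => i _; rewrite /wfac mulrNz normrN.
- apply: wgt_le => J; apply: (@le_trans _ _ (wprod j J k * wprod j J l)); last first.
    by apply: ler_pM; rewrite ?wprod_wgt// (le_trans ler01)// wprod_ge1.
  rewrite /wprod -big_split /= big_seq [leRHS]big_seq; apply: ler_prod => i _.
  have c0 (m : int) : 0 <= `|m%:~R| / 2 ^+ n i :> R by rewrite divr_ge0// exprn_ge0.
  rewrite (le_trans ler01 (wfac_ge1 _ _))/= /wfac -exprMn; apply: lerXn2r.
  + by rewrite nnegrE addr_ge0.
  + by rewrite nnegrE mulr_ge0// addr_ge0.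
  + apply: (@le_trans _ _ (1 + (`|k%:~R| / 2 ^+ n i + `|l%:~R| / 2 ^+ n i))).
      rewrite lerD2l -mulrDl ler_pM2r ?invr_gt0 ?exprn_gt0// intrD; exact: ler_normD.
    by have := mulr_ge0 (c0 k) (c0 l); nra.
Qed.

Lemma wgtS j k : wfac j k * wgt j.+1 k <= wgt j k.
Proof.
have f0 : 0 < wfac j k by apply: lt_le_trans (wfac_ge1 _ _).
rewrite mulrC -ler_pdivlMr//; apply: wgt_le => J; rewrite ler_pdivlMr//.
have [jJ|jJ] := ltnP j J.
  by apply: le_trans (wprod_wgt j J k); rewrite mulrC /wprod [leRHS]big_ltn.
rewrite /wprod big_geq ?mul1r; last by apply: leq_trans jJ _.
by apply: le_trans (wprod_wgt j j.+1 k); rewrite /wprod big_nat1.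
Qed.

Lemma wgtS_le j k : wgt j.+1 k <= wgt j k.
Proof.
apply: le_trans (wgtS j k); rewrite ler_peMl ?wfac_ge1//.
by apply: le_trans (wgt_ge1 _ _).
Qed.

Lemma wgt_wfac j i k : (j <= i)%N -> wfac i k <= wgt j k.
Proof.
move=> ji; apply: le_trans (wprod_wgt j i.+1 k).
rewrite /wprod big_nat_recr //= ler_peMl//; last exact: wprod_ge1.
by apply: le_trans (wfac_ge1 _ _).
Qed.

Lemma brk_wfac j i t k : (t <= s i)%N -> brk R k ^+ t <= 2 ^+ (n i * t) * wfac i k.
Proof.
move=> ts; have p0 : (0 : R) < 2 ^+ n i by rewrite exprn_gt0.
apply: (@le_trans _ _ ((2 ^+ n i * (1 + `|k%:~R| / 2 ^+ n i)) ^+ t)).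
  apply: lerXn2r; rewrite ?nnegrE.
  - by rewrite (le_trans ler01 (brk_ge1 _ _)).
  - by rewrite mulr_ge0 ?addr_ge0 ?divr_ge0 ?(ltW p0).
  rewrite mulrDr mulr1 mulrCA divff ?gt_eqF// mulr1 /brk ge_max.
  by rewrite (@le_trans _ _ (2 ^+ n i)) ?lerDl ?lerDr ?exprn_ege1 ?ler1n ?(ltW p0).
rewrite exprMn exprM; apply: ler_wpM2l; first by rewrite exprn_ge0 ?(ltW p0).
by rewrite /wfac ler_weXn2l// lerDl divr_ge0// ltW.
Qed.

Lemma brk_wgt j i t k : (j <= i)%N -> (t <= s i)%N -> brk R k ^+ t <= 2 ^+ (n i * t) * wgt j k.
Proof.
move=> ji ts; apply: le_trans (brk_wfac j k ts) _.
by apply: ler_wpM2l; [rewrite exprn_ge0|exact: wgt_wfac].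
Qed.

Lemma brk_wgtS j t k : (t <= s j)%N -> brk R k ^+ t * wgt j.+1 k <= 2 ^+ (n j * t) * wgt j k.
Proof.
move=> ts; apply: le_trans (ler_wpM2l (exprn_ge0 _ (ler0n R 2)) (wgtS j k)).
rewrite mulrA; apply: ler_wpM2r; first by apply: le_trans (wgt_ge1 _ _).
exact: (brk_wfac j).
Qed.

(** Beyond 2^r the factor that is spent exceeds 2^((r - n_j) s_j): regularity is traded for
    smallness of the tail. *)
Lemma wgt_tail j r k : (n j <= r)%N -> (2 ^ r < `|k|)%N ->
  wgt j.+1 k <= (2 ^+ ((r - n j) * s j))^-1 * wgt j k.
Proof.
move=> nr kr; rewrite mulrC ler_pdivlMr ?exprn_gt0//.
apply: le_trans (wgtS j k); rewrite mulrC; apply: ler_wpM2r.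
  by apply: le_trans (wgt_ge1 _ _).
rewrite exprM /wfac; apply: lerXn2r; rewrite ?nnegrE ?exprn_ge0// ?addr_ge0 ?divr_ge0 ?exprn_ge0//.
apply: (@le_trans _ _ (`|k%:~R| / 2 ^+ n j)); last by rewrite lerDr.
rewrite ler_pdivlMr ?exprn_gt0// -exprD subnK// -natrX -intr_norm -natr_absz ler_nat.
exact: ltnW.
Qed.

(** From 1 + X <= 8s (1 + X/(8s)) <= 8s exp(X/(8s)), raised to the power s. This is the exponential
    bound on the weight that [wle_cis_bandwidth] needs, with bandwidth 2^(n_j). *)
Lemma wgt_exp j k :
  wgt j k <= (8 * (s j)%:R) ^+ s j * expR (`|k%:~R : R| / (4 * 2 ^+ n j)).
Proof.
apply: le_trans (wgt_ub j k) _; set X := `|k%:~R| / 2 ^+ n j.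
have X0 : 0 <= X by rewrite divr_ge0// exprn_ge0.
have s0 : (0 : R) < (s j)%:R by rewrite ltr0n.
have -> : `|k%:~R| / (4 * 2 ^+ n j) = X / 8 + X / 8 :> R.
  by rewrite /X; field; rewrite expf_neq0.
rewrite expRD mulrA; apply: ler_wpM2r; first exact: expR_ge0.
have -> : X / 8 = (s j)%:R * (X / (8 * (s j)%:R)) by field; rewrite gt_eqF.
rewrite expRM_natl -exprMn /wfac -/X; apply: lerXn2r; rewrite ?nnegrE ?addr_ge0 ?mulr_ge0 ?expR_ge0//.
have s11 : 1 <= (s j)%:R :> R by rewrite ler1n.
apply: (@le_trans _ _ (8 * (s j)%:R * (1 + X / (8 * (s j)%:R)))).
  rewrite mulrDr mulr1 mulrCA divff ?mulr1; last by rewrite mulf_neq0// gt_eqF.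
  by lra.
by apply: ler_wpM2l; [rewrite mulr_ge0|exact: expR_ge1Dx].
Qed.

End Weights.

(** * Frames and their quadratic forms *)

Section Frames.
Variable R : realType.
Local Open Scope complex_scope.
Local Notation C := R[i].
Variables (al : R) (a0 b0 : R -> C).
Implicit Types (h psi : R -> R) (p s a b m : R -> C).

(** For the frame P w = p w + s conj(w), the pair (tr_p, tr_s) is P(x + al) composed with the
    original cocycle. [framed] then says that (a, b) is that cocycle conjugated by P, with all
    positive factors gathered in [h]. *)
Definition tr_p p s x : C := p (x + al) * a0 x + s (x + al) * conjc (b0 x).
Definition tr_s p s x : C := p (x + al) * b0 x + s (x + al) * conjc (a0 x).
Definition framed h p s a b := forall x,
  a x = (h x)%:C * (tr_p p s x * conjc (p x) - tr_s p s x * conjc (s x)) /\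
  b x = (h x)%:C * (p x * tr_s p s x - s x * tr_p p s x).
(** Coefficients of the form |p w + s conj(w)|^2 = G |w|^2 + 2 Re(conj(c) w^2), and the determinant
    D of the frame; they satisfy G^2 = D^2 + 4 |c|^2. *)
Definition metG p s x : C := p x * conjc (p x) + s x * conjc (s x).
Definition metC p s x : C := conjc (p x) * s x.
Definition metD p s x : C := p x * conjc (p x) - s x * conjc (s x).

Definition next_p psi m p s x : C := cis (psi x) * p x - m x * conjc (cis (psi x) * s x).
Definition next_s psi m p s x : C := cis (psi x) * s x - m x * conjc (cis (psi x) * p x).

Lemma cisJ (t : R) : conjc (cis t) = cis (- t).
Proof. by rewrite /cis sinN cosN /conjc. Qed.

(** A polynomial identity, once each unit phase and its conjugate are treated as mutually inverse
    variables. *)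
Lemma framed_next h h' psi m p s a b : framed h p s a b ->
  framed (fun x => h' x * h x) (next_p psi m p s) (next_s psi m p s)
    (cj_a al m (rt_a al h' psi a) (rt_b al h' psi b))
    (cj_b al m (rt_a al h' psi a) (rt_b al h' psi b)).
Proof.
move=> H x; have [Ha Hb] := H x.
have E1 : cis (psi (x + al) - psi x) = cis (psi (x + al)) * conjc (cis (psi x)).
  by rewrite cisJ -cisD.
have E2 : cis (psi (x + al) + psi x) = cis (psi (x + al)) * cis (psi x) by rewrite -cisD.
rewrite /cj_a /cj_b /rt_a /rt_b Ha Hb E1 E2 /tr_p /tr_s /next_p /next_s rcM.
move: (psi x) (psi (x + al)) (m x) (m (x + al)) (p x) (p (x + al)) (s x) (s (x + al)) (a0 x) (b0 x) (h x) (h' x).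
move=> t t' M M' P P' S S' A B H1 H2.
rewrite ?(conjcD, conjcB, conjcN, conjcM, conjcc, conjc_realC).
have vv : cis t * conjc (cis t) = 1 by rewrite cisJ -cisD subrr cis0.
have vv' : cis t' * conjc (cis t') = 1 by rewrite cisJ -cisD subrr cis0.
move: (cis t) (cis t') (conjc (cis t)) (conjc (cis t')) vv vv' => v v' w w' vv vv'.
split; ring: vv vv'.
Qed.

Lemma cis_unit (t : R) : cis t * conjc (cis t) = 1.
Proof. by rewrite cisJ -cisD subrr cis0. Qed.

(** The rotation cis psi disappears at order zero in [m], so the increment of the form is small with
    [m], whatever psi is. This is why forms are followed instead of frames. *)
Lemma metG_next psi m p s x : metG (next_p psi m p s) (next_s psi m p s) x =
  metG p s x + (m x * conjc (m x) * metG (fun x => cis (psi x) * p x) (fun x => cis (psi x) * s x) x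
   - 2 * (m x * conjc (cis (psi x) * p x) * conjc (cis (psi x) * s x)
        + conjc (m x) * (cis (psi x) * p x) * (cis (psi x) * s x))).
Proof.
rewrite /metG /next_p /next_s; have := cis_unit (psi x).
rewrite ?(conjcD, conjcB, conjcN, conjcM, conjcc).
move: (cis _) (conjc (cis _)) => v w vw; ring: vw.
Qed.
Lemma metC_next psi m p s x : metC (next_p psi m p s) (next_s psi m p s) x =
  metC p s x + (m x * conjc (m x) * (cis (psi x) * s x * conjc (cis (psi x) * p x))
   - (m x * (conjc (cis (psi x) * p x) * conjc (cis (psi x) * p x))
        + conjc (m x) * ((cis (psi x) * s x) * (cis (psi x) * s x)))).
Proof.
rewrite /metC /next_p /next_s; have := cis_unit (psi x).
rewrite ?(conjcD, conjcB, conjcN, conjcM, conjcc).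
move: (cis _) (conjc (cis _)) => v w vw; ring: vw.
Qed.
Lemma metD_next psi m p s x : metD (next_p psi m p s) (next_s psi m p s) x =
  metD p s x - m x * conjc (m x) * metD (fun x => cis (psi x) * p x) (fun x => cis (psi x) * s x) x.
Proof.
rewrite /metD /next_p /next_s; have := cis_unit (psi x).
rewrite ?(conjcD, conjcB, conjcN, conjcM, conjcc).
move: (cis _) (conjc (cis _)) => v w vw; ring: vw.
Qed.
Lemma metD_unit psi p s x :
  metD (fun x => cis (psi x) * p x) (fun x => cis (psi x) * s x) x = metD p s x.
Proof.
rewrite /metD; have := cis_unit (psi x); rewrite ?(conjcM).
move: (cis _) (conjc (cis _)) => v w vw; ring: vw.
Qed.

End Frames.

(** * Numerical inequalities of the scheme *)

Section KamNumerics.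
Variable R : realType.
Implicit Types (gam t Q CV F delta : R).

(** [Q] stands for q^N. The leftover phase F/Q and the divisor bound D = gam/(2Q) carry the same
    power of q, so F <= gam/4096 makes the perturbation in the linear equation admissible for every
    q. *)
Lemma kam_smallness gam t Q CV F delta :
  let D := gam / (2 * Q) in let phi := F / Q + 2 * delta in
  let beta := 2 * CV ^+ 2 * delta in
  0 < gam -> gam <= 1 -> t <= gam / 4096 -> 1 <= Q -> 0 <= delta ->
  CV ^+ 2 * delta * Q <= t -> delta * Q <= t -> 0 <= F -> F <= gam / 4096 ->
  [/\ 0 < D, delta <= t, beta <= 2 * t, 8 * phi <= D & 80 * (2 * phi + 32 * delta ^+ 2 + beta) <= D] /\
  [/\ 2 * phi + 32 * delta ^+ 2 + beta <= 16^-1, 4 * CV ^+ 2 * delta / D <= 8 * t / gam & 0 <= beta].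
Proof.
move=> D phi beta g0 g1 tg Q1 d0 cv dq F0 Fg.
have Q0 : 0 < Q by apply: lt_le_trans Q1.
have DE : D = gam * Q^-1 / 2 by rewrite /D; field; rewrite gt_eqF.
have mE : 4 * CV ^+ 2 * delta / D = 8 * (CV ^+ 2 * delta * Q) / gam.
  by rewrite /D; field; rewrite !gt_eqF.
have bE : beta = 2 * (CV ^+ 2 * delta) by rewrite /beta mulrA.
have pE : phi = F * Q^-1 + 2 * delta by [].
have iQ0 : 0 < Q^-1 by rewrite invr_gt0.
have iQ1 : Q^-1 <= 1 by rewrite invf_le1.
have cd0 : 0 <= CV ^+ 2 * delta by rewrite mulr_ge0 ?sqr_ge0.
rewrite mE; clearbody D phi beta; clear mE.
move: (CV ^+ 2 * delta) cd0 cv bE => c cd0 cv bE.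
have dt : delta <= t by apply: le_trans dq; rewrite ler_peMr.
have ct : c <= t by apply: le_trans cv; rewrite ler_peMr.
have div_le (v : R) : v * Q <= t -> v <= gam * Q^-1 / 4096.
  move=> vt; rewrite -[v](mulfK (lt0r_neq0 Q0)) [leRHS]mulrAC ler_pM2r//.
  exact: le_trans tg.
have d1 := div_le _ dq; have c1 := div_le _ cv.
have F1 : F * Q^-1 <= gam * Q^-1 / 4096 by rewrite [leRHS]mulrAC ler_pM2r.
have gi : 0 < gam * Q^-1 by rewrite mulr_gt0.
have gi1 : gam * Q^-1 <= 1 by rewrite -[leRHS]mulr1; apply: ler_pM => //; exact: ltW.
have dd : 32 * delta ^+ 2 <= delta.
  by rewrite expr2 mulrA ler_piMl//; clear - d1 gi1; lra.
have m1 : 8 * (c * Q) / gam <= 8 * t / gam by rewrite ler_pM2r ?invr_gt0// ler_pM2l.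
have d20 : 0 <= delta ^+ 2 by exact: sqr_ge0.
rewrite bE pE DE; clear bE pE DE cv dq div_le iQ0 iQ1 tg Fg g0 g1.
move: (F * Q^-1) (gam * Q^-1) (delta ^+ 2) F1 gi gi1 dd d20 d1 c1 => f g d2 F1 gi gi1 dd d20 d1 c1.
by split; split => //; lra.
Qed.

Lemma kam_decay (x u t beta delta gt mu : R) :
  256 <= x -> x * x * t = u -> x * u <= 1 -> 0 <= delta -> delta <= t -> 0 <= beta -> beta <= 2 * t ->
  0 <= mu -> mu <= u -> 0 <= gt -> gt <= u ->
  32 * delta ^+ 2 + 2 * mu * beta + 2 * mu ^+ 2 <= x * u ^+ 2 /\
  3 * gt * beta + 64 * delta ^+ 2 * mu + mu ^+ 2 * beta <= x * u ^+ 2.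
Proof.
move=> x4 tu xu d0 dt b0 bt m0 mu_u g0 gu.
have t0 : 0 <= t by exact: le_trans dt.
have t2 : 2 * t <= u by rewrite -tu; apply: ler_wpM2r => //; clear - x4; nra.
have u0 : 0 <= u by apply: le_trans t2; rewrite mulr_ge0.
have u1 : u <= 1 by apply: le_trans xu; rewrite ler_peMl//; lra.
have bu : beta <= u by lra.
have du : delta <= u by lra.
have d2 : delta ^+ 2 <= u ^+ 2 by apply: lerXn2r.
have m2 : mu ^+ 2 <= u ^+ 2 by apply: lerXn2r.
have mb : mu * beta <= u ^+ 2 by rewrite expr2; apply: ler_pM.
have gb : gt * beta <= u ^+ 2 by rewrite expr2; apply: ler_pM.
have u20 : 0 <= u ^+ 2 by exact: sqr_ge0.
have big : 256 * u ^+ 2 <= x * u ^+ 2 by rewrite ler_wpM2r.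
split.
  rewrite -[2 * mu * beta]mulrA; lra.
have h1 : delta ^+ 2 * mu <= u ^+ 2 by rewrite -[leRHS]mulr1; apply: ler_pM => //; [exact: sqr_ge0|lra].
have h2 : mu ^+ 2 * beta <= u ^+ 2 by rewrite -[leRHS]mulr1; apply: ler_pM => //; [exact: sqr_ge0|lra].
rewrite -mulrA -[64 * _ * mu]mulrA; lra.
Qed.

Lemma kam_constants (gam F F' d mu y : R) : 0 < gam -> gam <= 1 -> F <= gam / 4096 ->
  F' <= gam / 4096 -> d <= gam / 4096 -> mu <= y -> y <= gam / 4096 ->
  [/\ 4 / gam * F' <= 16^-1, F' <= 64^-1, d <= 64^-1, F + 2 * d <= 64^-1 & mu <= 2^-1] /\ y <= 8^-1.
Proof.
move=> g0 g1 hF hF' hd hm hy; split; [split|]; try lra.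
rewrite mulrAC ler_pdivrMr//; lra.
Qed.

Lemma kam_det_bounds (j : nat) (d m2 : R) : m2 <= (2 ^+ j)^-1 / 4096 -> 0 <= m2 ->
  2^-1 + (2 ^+ j.+1)^-1 <= d -> d <= 1 ->
  2^-1 + (2 ^+ j.+2)^-1 <= d - m2 * d <= 1.
Proof.
have jp : 0 < (2 ^+ j)^-1 :> R by rewrite invr_gt0 exprn_gt0.
rewrite !exprS !invfM; move: ((2 ^+ j)^-1) jp => y jp my m0 dlo dhi.
have md : m2 * d <= m2 by rewrite ler_piMr.
have md0 : 0 <= m2 * d by apply: mulr_ge0 => //; lra.
apply/andP; split; lra.
Qed.

(** The determinant relation gives (h A)^2 - (h B)^2 <= h^2, whose left side is at least (1-d)^2 -
    d^2 = 1 - 2d. Hence h >= 1/2, and B is at most twice h B. *)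
Lemma defect_bound (h d y e1 ca cb A B d1 d2 : R) : 0 < h -> 0 <= d -> d <= y / 4096 -> 0 < y -> y <= 1 ->
  0 <= A -> 0 <= B -> ca = h * A -> cb = h * B -> A ^+ 2 - B ^+ 2 = d2 * d1 ->
  1 - d <= ca -> cb <= d -> 2^-1 + e1 <= d1 -> d1 <= 1 -> 2^-1 + e1 <= d2 -> d2 <= 1 ->
  0 <= e1 -> B <= 2 * d.
Proof.
move=> h0 d0 dy y0 y1 A0 B0 -> -> AB ha hb d1lo d1hi d2lo d2hi e10.
have dd : d2 * d1 <= 1 by rewrite -[leRHS]mulr1; apply: ler_pM; lra.
have d64 : d <= 64^-1 by lra.
have H2 : (h * A) ^+ 2 - (h * B) ^+ 2 <= h ^+ 2.
  by rewrite !exprMn -mulrBr AB ler_piMr ?sqr_ge0.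
have HA : (1 - d) ^+ 2 <= (h * A) ^+ 2 by apply: lerXn2r; rewrite ?nnegrE ?mulr_ge0 ?(ltW h0)//; lra.
have HB : (h * B) ^+ 2 <= d ^+ 2 by apply: lerXn2r; rewrite ?nnegrE ?mulr_ge0 ?(ltW h0).
have h14 : (2^-1) ^+ 2 <= h ^+ 2.
  have : (1 - d) ^+ 2 - d ^+ 2 = 1 - 2 * d by ring.
  by move: H2 HA HB; rewrite (_ : (2^-1) ^+ 2 = 4^-1); [lra|field].
have h2 : 2^-1 <= h by rewrite -(@ler_pXn2r _ 2) ?nnegrE ?(ltW h0) ?invr_ge0.
have : 2^-1 * B <= h * B by rewrite ler_wpM2r.
by lra.
Qed.

End KamNumerics.

(** * The KAM induction *)

Section KamInduction.
Variable R : realType.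
Local Open Scope complex_scope.
Local Notation C := R[i].
Implicit Types (k l : int) (i j t : nat).
Variables (al : R) (u0 : C) (Rot : (R -> C) -> (R -> C) -> Prop).
Hypothesis Rot_ext : forall a b a' b', (forall x, a x = a' x) -> (forall x, b x = b' x) ->
  Rot a b -> Rot a' b'.
Hypothesis Rot_rt : forall (h psi : R -> R) a b, (forall x, 0 < h x) ->
  trig (fun x => (psi x)%:C) -> Rot a b -> Rot (rt_a al h psi a) (rt_b al h psi b).
Hypothesis Rot_cj : forall m a b, trig m -> (forall x, cabs (m x) < 1) -> Rot a b ->
  Rot (cj_a al m a b) (cj_b al m a b).
Hypothesis Rot_near : forall a b kap eta, cabs kap = 1 -> 0 <= eta -> eta <= 16^-1 ->
  (forall x, cabs (a x - kap) <= eta) -> (forall x, cabs (b x) <= eta) ->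
  Rot a b -> cabs (u0 - kap) <= 40 * eta.
Hypothesis u01 : cabs u0 = 1.
Variables (a0 b0 : R -> C) (n r q : nat -> nat) (T N S : nat) (gam : R).
Let sJ i := (S * (i + 100))%N.
Let s i := (5 * sJ i)%N.
Hypothesis gam_gt0 : 0 < gam.
Hypothesis gam_le1 : gam <= 1.
Hypothesis TN : (T < N)%N.
Hypothesis NS : (N + 100 <= S)%N.
Hypothesis nr : forall i, (6 * n i <= 5 * r i)%N.
Hypothesis rn : forall i, (r i <= n i.+1)%N.
Hypothesis nn : forall i, (10 * n i.+1 <= 19 * n i)%N.
Hypothesis growth : forall i, (16 * s i.+1 * 2 ^ n i <= 2 ^ n i.+1)%N.
Hypothesis exps : forall i, ((8 * s i) ^ s i <= 2 ^ n i)%N.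
Hypothesis big : forall i, 2 ^+ (12 + i) <= gam * 2 ^+ n i.
Hypothesis q_gt0 : forall i, (0 < q i)%N.
Hypothesis q_le : forall i, (q i <= 2 ^ n i)%N.
Hypothesis sd1 : forall i l, l != 0 -> (`|l| < q i)%N ->
  gam / 4 <= cabs (e (l%:~R * al) - 1) * (`|l%:~R| ^+ T * 2 ^+ n i).
Hypothesis sd2 : forall i l, (`|l| <= 2 ^ r i)%N ->
  gam <= cabs (e (l%:~R * al) - u0 ^+ 2) * (q i)%:R ^+ N.

Let w j : int -> R := wgt R n s j.
Let om j k : R := brk R k ^+ N * w j k.
(** At stage j, [dl] bounds the errors z and b and [uu] the correction m. The budgets [Fb] for the
    phase and [Bt t] for the form increase geometrically to gam/4096 and 4 2^(t n_t). *)
Let X j : R := 2 ^+ n j.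
Let Y j : R := (X j)^-1.
Let dl j : R := Y j ^+ sJ j.
Let uu j : R := Y j ^+ (sJ j - N - 8).
Let Fb j : R := gam / 2 ^+ 12 * (1 - (2 ^+ j.+1)^-1).
Let Bt t j : R := 2 ^+ (t * n t) * (4 - 2 / 2 ^+ j).

(** The frame may grow like a power of 2^(n_j). Its determinant stays in [1/2, 1], and the
    coefficients of its form are bounded, in each polynomial weight, independently of j. *)
Definition kam_state j := exists (h : R -> R) (p s a b z : R -> C) (kap : C) (f : R -> R),
  [/\ forall x, 0 < h x, framed al a0 b0 h p s a b & Rot a b] /\
  [/\ forall x, exists2 d : R, metD p s x = d%:C & 2^-1 + (2 ^+ j.+1)^-1 <= d <= 1,
      wle (w j) p (X j ^+ 20) & wle (w j) s (X j ^+ 20)] /\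
  [/\ cabs kap = 1, forall x, a x = kap * (cis (f x) + z x), wle (om j) (fun x => (f x)%:C) (Fb j),
      wle (w j) z (dl j) & wle (w j) b (dl j)] /\
  forall t, let B := fun k => brk R k ^+ t in
   [/\ wle B (metG p s) (Bt t j), wle B (metC p s) (Bt t j) & wle B (metD p s) (Bt t j)].

Let s1 i : (0 < s i)%N. Proof. by rewrite /s /sJ; move: NS; nia. Qed.
Let Wt j : weight (w j). Proof. exact: wgt_weight. Qed.
Let X0 j : 0 < X j. Proof. by rewrite exprn_gt0. Qed.
Let pow12 : 4096 = 2 ^+ 12 :> R.
Proof. by rewrite -natrX; congr _%:R. Qed.
Let Xbig j : 2 ^+ 12 <= X j.
Proof.
have := big j; rewrite exprD => h.
have h2 : (2 : R) ^+ 12 <= 2 ^+ 12 * 2 ^+ j by rewrite ler_peMr// exprn_ege1// ler1n.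
have h3 : gam * 2 ^+ n j <= 2 ^+ n j by rewrite ler_piMl// exprn_ge0.
exact: le_trans h2 (le_trans h h3).
Qed.
Let Y0 j : 0 < Y j. Proof. by rewrite invr_gt0. Qed.
Let Yj j : Y j <= gam / 2 ^+ 12 / 2 ^+ j.
Proof.
rewrite !ler_pdivlMr ?exprn_gt0// -mulrA mulrC ler_pdivrMr//.
by apply: le_trans (big j); rewrite exprD mulrC.
Qed.
Let Y1 j : Y j <= 1. Proof. by rewrite invf_le1//; apply: le_trans (Xbig j); rewrite exprn_ege1// ler1n. Qed.
Let Yg j : Y j <= gam / 2 ^+ 12.
Proof. by apply: le_trans (Yj j) _; rewrite ler_piMr ?divr_ge0 ?exprn_ge0 ?(ltW gam_gt0)// invf_le1 ?exprn_gt0// exprn_ege1// ler1n. Qed.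
Let Y2 j : Y j <= (2 ^+ j)^-1 / 2 ^+ 12.
Proof.
apply: le_trans (Yj j) _; rewrite mulrAC ler_pM2r ?invr_gt0 ?exprn_gt0// ler_piMl ?invr_ge0 ?exprn_ge0//.
Qed.
Let XY j (m l : nat) : (l <= m)%N -> X j ^+ l * Y j ^+ m = Y j ^+ (m - l).
Proof.
move=> lm; rewrite -{1}(subnKC lm) exprD mulrA -exprMn /Y divff ?gt_eqF//.
by rewrite expr1n mul1r.
Qed.
Let Yle j (m l : nat) : (l <= m)%N -> Y j ^+ m <= Y j ^+ l.
Proof. by move=> lm; apply: ler_wiXn2l => //; apply: ltW. Qed.
Let YleS j (m : nat) : (0 < m)%N -> Y j ^+ m <= Y j.
Proof. by move=> m0; rewrite -[leRHS]expr1 Yle. Qed.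
Let sJ_big j : (N + 100 + N + j + 55 < sJ j)%N.
Proof. by rewrite /sJ; move: NS; nia. Qed.

Let s_big j : (j <= s j)%N.
Proof. by rewrite /s /sJ; move: NS; clear; nia. Qed.

(** Every increment carries a factor [m], of size uu, against at most two frame factors, of size
    X^23 each. The exponent of uu is so large that the polynomial weight of order t is paid as well,
    and the increments sum to at most 2 2^(t n_t). *)
Lemma next_metric_increments j (psi : R -> R) (m p g : R -> C) (P : R) :
  wle (w j) m (uu j) -> wle (w j) (fun x => cis (psi x) * p x) P ->
  wle (w j) (fun x => cis (psi x) * g x) P -> P <= X j ^+ 23 ->
  (forall t, let B := fun k => brk R k ^+ t in
   [/\ wle B (metG p g) (Bt t j), wle B (metC p g) (Bt t j) & wle B (metD p g) (Bt t j)]) ->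
  forall t, let B := fun k => brk R k ^+ t in
   [/\ wle B (metG (next_p psi m p g) (next_s psi m p g)) (Bt t j.+1),
       wle B (metC (next_p psi m p g) (next_s psi m p g)) (Bt t j.+1) &
       wle B (metD (next_p psi m p g) (next_s psi m p g)) (Bt t j.+1)].
Proof.
move=> hm hp hs PX H t B; have [HG HC HD] := H t.
have w0 k := weight_ge0 k (Wt j).
have ws k : w j (- k) = w j k by case: (Wt j).
set V := X j ^+ 46; have V0 : 0 <= V by rewrite exprn_ge0 ?(ltW (X0 j)).
have P0 := wle_ge0 (Wt j) hp.
have PP : P * P <= V.
  by rewrite /V (_ : 46 = 23 + 23)%N// exprD; apply: ler_pM.
have u0_ : 0 <= uu j by rewrite exprn_ge0 ?(ltW (Y0 j)).
have u1 : uu j <= 1 by rewrite exprn_ile1 ?(ltW (Y0 j)).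
have inc (F : R -> C) (c : R) : c <= 6 -> wle (w j) F (c * (uu j * V)) ->
    wle B F (2 ^+ (t * n t) / 2 ^+ j).
  move=> c6 hg.
  have hg2 : wle (w j) F (Y j ^+ (sJ j - N - 55)).
    apply: wle_mono hg; apply: (@le_trans _ _ (X j * (uu j * V))).
      by apply: ler_wpM2r; [rewrite mulr_ge0|apply: le_trans (Xbig j); apply: le_trans c6 _; rewrite -pow12 ler_nat].
    have -> : X j * (uu j * V) = X j ^+ 47 * uu j by rewrite /V exprS; ring.
    rewrite /uu XY; last by move: (sJ_big j); clear; lia.
    by apply: Yle; move: (sJ_big j); clear; lia.
  (* For t >= j the weight of order t is compared with the factor of index t, at the fixed cost 2^(t
     n_t). For t < j it is compared with the factor of index j, and the cost X_j^t is absorbed by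
     the smallness of the increment. *)
  have [jt|tj] := leqP j t.
    have : wle B F (2 ^+ (n t * t) * Y j ^+ (sJ j - N - 55)).
      apply: wle_weight hg2; first exact: exprn_ge0.
      by move=> k; exact: (brk_wgt R s1 growth k jt (s_big t)).
    apply: wle_mono; rewrite mulnC; apply: ler_wpM2l; first exact: exprn_ge0.
    apply: le_trans (YleS _ _) (le_trans (Y2 j) _); first by move: (sJ_big j); clear; lia.
    by rewrite ler_piMr ?invr_ge0 ?exprn_ge0// invf_le1 ?exprn_gt0// exprn_ege1// ler1n.
  have : wle B F (2 ^+ (n j * t) * Y j ^+ (sJ j - N - 55)).
    apply: wle_weight hg2; first exact: exprn_ge0.
    by move=> k; exact: (brk_wgt R s1 growth k (leqnn j) (leq_trans (ltnW tj) (s_big j))).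
  apply: wle_mono; rewrite exprM -/(X j) XY; last by move: (sJ_big j) tj; clear; lia.
  apply: (@le_trans _ _ (2 ^+ j)^-1); last first.
    by rewrite ler_peMl ?invr_ge0 ?exprn_ge0// exprn_ege1// ler1n.
  apply: le_trans (YleS _ _) (le_trans (Y2 j) _); first by move: (sJ_big j) tj; clear; lia.
  by rewrite ler_piMr ?invr_ge0 ?exprn_ge0// invf_le1 ?exprn_gt0// exprn_ege1// ler1n.
have BtS : Bt t j.+1 = Bt t j + 2 ^+ (t * n t) / 2 ^+ j.
  by rewrite /Bt exprS; field; rewrite expf_neq0.
have hmc := wle_conj ws hm; have hpc := wle_conj ws hp; have hsc := wle_conj ws hs.
have hmm := wle_mul (Wt j) hm hmc.
have uuV c : 0 <= c -> uu j * uu j * (c * (P * P)) <= c * (uu j * V).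
  move=> c0; rewrite mulrCA; apply: ler_wpM2l => //; rewrite -mulrA; apply: ler_wpM2l => //.
  by apply: le_trans PP; rewrite ler_piMl// mulr_ge0.
have uPP : uu j * P * P <= uu j * V by rewrite -mulrA ler_wpM2l.
rewrite BtS; split.
- apply: (eq_wle (fun x => esym (metG_next psi m p g x))).
  apply: wle_add => //; apply: (inc _ 6 (lexx _)).
  apply: (@wle_mono _ _ _ (uu j * uu j * (P * P + P * P) + 2 * (uu j * P * P + uu j * P * P))).
    have := uuV 2 (ler0n _ _); rewrite (_ : 2 * (P * P) = P * P + P * P); last by ring.
    by move: uPP; lra.
  apply: wle_sub => //.
    apply: wle_mul => //; apply: wle_add; exact: wle_mul.
  apply: wle_scale => //; first by rewrite cabs_nat.
  by apply: wle_add; apply: wle_mul => //; apply: wle_mul.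
- apply: (eq_wle (fun x => esym (metC_next psi m p g x))).
  apply: wle_add => //; apply: (inc _ 3); first by rewrite ler_nat.
  apply: (@wle_mono _ _ _ (uu j * uu j * (P * P) + (uu j * (P * P) + uu j * (P * P)))).
    by have := uuV 1 ler01; rewrite mul1r; move: uPP; rewrite -mulrA; lra.
  apply: wle_sub => //.
    by apply: wle_mul => //; apply: wle_mul.
  by apply: wle_add; apply: wle_mul => //; apply: wle_mul.
- apply: (eq_wle (fun x => esym (metD_next psi m p g x))).
  apply: wle_sub => //; first by move=> k; rewrite exprn_ge0// (le_trans ler01 (brk_ge1 _ _)).
  apply: (inc _ 2); first by rewrite ler_nat.
  apply: (@wle_mono _ _ _ (uu j * uu j * (P * P + P * P))).
    by have := uuV 2 (ler0n _ _); rewrite (_ : 2 * (P * P) = P * P + P * P); last by ring.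
  apply: wle_mul => //; apply: wle_sub => //; exact: wle_mul.
Qed.

Let sqb j : cabs (u0 ^+ 2) = 1. Proof. by rewrite cabsX u01 expr1n. Qed.

Lemma metD_real (p g : R -> C) x : metD p g x = (cabs (p x) ^+ 2 - cabs (g x) ^+ 2)%:C.
Proof. by rewrite /metD !mulcJ rcB. Qed.

(** [kam_step] is applied with L = 2^(n_j), Ci = 4/gam and D = gam/(2 q^N). As CV <= X_j^3 and q <=
    X_j, every loss is a fixed power of X_j, and the exponent sJ of the errors exceeds all of
    them. *)
Lemma kam_state_next j : kam_state j -> kam_state j.+1.
Proof.
move=> [h [p [g [a [b [z [kap [f [[h0 fr hRot] [[hd hp hg] [[kap1 aE hf hz hb] hmet]]]]]]]]]]].
have Wj := Wt j; have WS := Wt j.+1.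
have X1 : 1 <= X j by apply: le_trans (Xbig j); rewrite exprn_ege1// ler1n.
have X20 : 20 <= X j by apply: le_trans (Xbig j); rewrite -pow12 ler_nat.
have Fb0 i : 0 <= Fb i.
  by rewrite mulr_ge0 ?divr_ge0 ?exprn_ge0 ?(ltW gam_gt0)// subr_ge0 invf_le1 ?exprn_gt0// exprn_ege1// ler1n.
have Fbg i : Fb i <= gam / 4096.
  rewrite pow12 /Fb -[leRHS]mulr1; apply: ler_wpM2l.
    by rewrite divr_ge0 ?exprn_ge0 ?(ltW gam_gt0).
  by rewrite gerBl invr_ge0 exprn_ge0.
pose C0 : R := ((8 * s j) ^ s j)%N%:R.
have C0X : C0 <= X j by rewrite /C0 /X -natrX ler_nat.
have C00 : 0 <= C0 by exact: ler0n.
pose Q : R := (q j)%:R ^+ N.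
have q1 : 1 <= (q j)%:R :> R by rewrite ler1n.
have qX : (q j)%:R <= X j by rewrite /X -natrX ler_nat.
have Q1 : 1 <= Q by rewrite exprn_ege1.
have QX : Q <= X j ^+ N by apply: lerXn2r; rewrite ?nnegrE ?(ltW (X0 j)).
pose t := Y j ^+ (sJ j - N - 6).
have t0 : 0 <= t by rewrite exprn_ge0 ?(ltW (Y0 j)).
have tg : t <= gam / 4096.
  by rewrite pow12; apply: le_trans (Yg j); apply: YleS; move: (sJ_big j); clear; lia.
have dl0 : 0 <= dl j by rewrite exprn_ge0 ?(ltW (Y0 j)).
pose CV := 20 * C0 * X j.
have CV0 : 0 <= CV by rewrite !mulr_ge0 ?(ltW (X0 j)).
have CV3 : CV <= X j ^+ 3.
  by rewrite /CV !exprS expr0 mulr1 -mulrA; apply: ler_pM => //; [rewrite mulr_ge0 ?(ltW (X0 j))|rewrite ler_pM2r].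
have CVd : CV ^+ 2 * dl j * Q <= t.
  rewrite mulrAC; apply: (@le_trans _ _ (X j ^+ (6 + N) * dl j)).
    apply: ler_wpM2r => //; rewrite exprD; apply: ler_pM => //.
    - exact: sqr_ge0.
    - exact: le_trans Q1.
    - by rewrite (_ : 6 = 3 * 2)%N// exprM; apply: lerXn2r; rewrite ?nnegrE ?exprn_ge0 ?(ltW (X0 j)).
  rewrite /dl XY; last by move: (sJ_big j); clear; lia.
  by apply: Yle; move: (sJ_big j); clear; lia.
have dQ : dl j * Q <= t.
  rewrite mulrC; apply: (@le_trans _ _ (X j ^+ N * dl j)); first by apply: ler_wpM2r.
  rewrite /dl XY; last by move: (sJ_big j); clear; lia.
  by apply: Yle; move: (sJ_big j); clear; lia.
have [[D0 dt bt phiD etaD] [eta16 mut b0_]] :=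
  kam_smallness gam_gt0 gam_le1 tg Q1 dl0 CVd dQ (Fb0 j) (Fbg j).
pose gt : R := (2 ^+ ((r j - n j) * s j))^-1.
have gt0 : 0 < gt by rewrite invr_gt0 exprn_gt0.
have nrj : (n j <= r j)%N by move: (nr j); clear; lia.
(* This fixes s = 5 sJ: since r - n >= n/5, the tail gain 2^((r - n) s) is at least 2^(n sJ). *)
have gtd : gt <= dl j.
  rewrite /gt /dl /Y exprVn lef_pV2 ?posrE ?exprn_gt0// /X -exprM ler_weXn2l ?ler1n//.
  rewrite /s mulnA leq_mul2r; apply/orP; right.
  by move: (nr j) nrj; clear; lia.
have XXt : X j * X j * t = uu j.
  rewrite -expr2 XY; last by move: (sJ_big j); clear; lia.
  by congr (_ ^+ _); move: (sJ_big j); clear; lia.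
have uY : uu j <= Y j by apply: YleS; move: (sJ_big j); clear; lia.
have xu : X j * uu j <= 1.
  by rewrite -(divff (lt0r_neq0 (X0 j))); apply: ler_wpM2l => //; exact: ltW.
have tu : t <= uu j.
  by apply: Yle; move: (sJ_big j); clear; lia.
have X8 : 8 / gam <= X j.
  rewrite ler_pdivrMr// mulrC; apply: le_trans (big j).
  rewrite exprD; apply: (@le_trans _ _ (2 ^+ 12)); first by rewrite -pow12 ler_nat.
  by rewrite ler_peMr ?exprn_ge0// exprn_ege1// ler1n.
set mu := 4 * CV ^+ 2 * dl j / (gam / (2 * Q)) in mut.
have mu_u : mu <= uu j.
  apply: le_trans mut _; rewrite -XXt mulrAC; apply: ler_wpM2r => //.
  by apply: le_trans X8 _; rewrite ler_peMl ?(ltW (X0 j)).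
have mu0 : 0 <= mu by rewrite /mu divr_ge0 ?(ltW D0)// mulr_ge0// mulr_ge0// sqr_ge0.
have X256 : 256 <= X j by apply: le_trans (Xbig j); rewrite -pow12 ler_nat.
have [zb bb] := kam_decay X256 XXt xu dl0 dt b0_ bt mu0 mu_u (ltW gt0)
  (le_trans gtd (le_trans dt tu)).
(* Quadratic convergence against the growth of scales: 2 (sJ_j - N - 8) - 1 must exceed 19/10 of
   sJ_(j+1) = sJ_j + S. The shift by 100 in sJ gives sJ_j / 10 >= 10 S, which covers the
   constants. *)
have dec : X j * uu j ^+ 2 <= dl j.+1.
  rewrite /uu -exprM -[X j]expr1 XY; last by move: (sJ_big j); clear; lia.
  rewrite /dl /Y !exprVn lef_pV2 ?posrE ?exprn_gt0// /X -!exprM ler_weXn2l ?ler1n//.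
  rewrite /sJ; move: (nn j) NS; clear; nia.
have ww k : w j.+1 k <= w j k by exact: wgtS_le.
have hXN k : brk R k ^+ N * w j.+1 k <= X j ^+ N * w j k.
  rewrite -exprM; apply: (brk_wgtS R s1 growth).
  by rewrite /s; move: (sJ_big j); clear; lia.
have hqX k : (`|k| < q j)%N -> brk R k ^+ N <= X j ^+ N.
  move=> kq; apply: lerXn2r; rewrite ?nnegrE ?(ltW (X0 j)) ?(le_trans ler01 (brk_ge1 _ _))//.
  rewrite /brk ge_max X1/=; apply: le_trans qX.
  by rewrite -intr_norm -natr_absz ler_nat ltnW.
have htail k : (2 ^ r j < `|k|)%N -> w j.+1 k <= gt * w j k by exact: (wgt_tail R s1 growth nrj).
have hexp k : w j k <= C0 * expR (`|k%:~R : R| / (4 * X j)).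
  by rewrite /C0 natrX natrM; exact: (wgt_exp R s1 growth).
have h4g : 0 < 4 / gam by rewrite divr_gt0.
have hsd1 l : l != 0 -> (`|l| < q j)%N ->
    1 <= 4 / gam * X j * `|l%:~R : R| ^+ T * cabs (e (l%:~R * al) - 1).
  move=> l0 lq; have H := sd1 l0 lq.
  rewrite [leLHS](_ : 1 = 4 / gam * (gam / 4)); last by field; rewrite gt_eqF.
  rewrite (_ : 4 / gam * X j * _ * _ = 4 / gam * (cabs (e (l%:~R * al) - 1) * (`|l%:~R| ^+ T * X j))).
    by rewrite ler_pM2l.
  by move: (cabs _) (_ ^+ T) (X j) => ? ? ?; ring.
have hsd2 l : (`|l| <= 2 ^ r j)%N -> 2 * (gam / (2 * Q)) <= cabs (e (l%:~R * al) - u0 ^+ 2).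
  move=> /sd2 H; rewrite (_ : 2 * _ = gam / Q); last by field; rewrite gt_eqF// (lt_le_trans ltr01 Q1).
  by rewrite ler_pdivrMr// (lt_le_trans ltr01 Q1).
have Yg' : Y j <= gam / 4096 by rewrite pow12.
have [_ Y8] := kam_constants gam_gt0 gam_le1 (Fbg j) (Fbg j) tg (lexx _) Yg'.
have hF : Fb j + X j ^+ N * (2 * dl j) <= Fb j.+1.
  have -> : Fb j.+1 = Fb j + gam / 2 ^+ 12 / 2 ^+ j * 4^-1.
    by rewrite /Fb !exprS; field; rewrite expf_neq0.
  rewrite lerD2l mulrCA {1}/dl XY; last by move: (sJ_big j); clear; lia.
  apply: (@le_trans _ _ (2 * (Y j * Y j))).
    by rewrite -expr2 ler_pM2l//; apply: Yle; move: (sJ_big j); clear; lia.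
  rewrite mulrA mulrC; apply: ler_pM => //; rewrite ?mulr_ge0 ?(ltW (Y0 j))//.
  apply: (@le_trans _ _ (2 * 8^-1)); first by rewrite ler_pM2l.
  by rewrite -[2]/(2%:R) -[8]/((2 * 4)%:R) natrM invfM mulrA divff ?mul1r// pnatr_eq0.
have F'g : Fb j + X j ^+ N * (2 * dl j) <= gam / 4096 by exact: le_trans hF (Fbg _).
have [[CF F64 d64 F2 mu2] _] := kam_constants gam_gt0 gam_le1 (Fbg j) F'g (le_trans dt tg)
  (le_trans mu_u uY) Yg'.
have uj : uu j <= (2 ^+ j)^-1 / 4096 by rewrite pow12; apply: le_trans uY (Y2 j).
have [h2 [psi [m [kap' [f' [z' [[h20 hpsi trm hv hm] [kap'1 [aE' hf' hz' hb' hRot']]]]]]]]] :=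
  kam_step Rot_rt Rot_cj Rot_near u01 Wj WS ww hXN hqX htail gt0 (exprn_ge0 N (ltW (X0 j))) hexp X1 qX
   (q_gt0 j) TN h4g hsd1 hsd2 D0 d64 CF F64 F2 phiD eta16 etaD mu2 kap1 hf hz hb aE hRot.
have hmu : wle (w j) m (uu j) by exact: wle_mono hm.
have X23 : CV * X j ^+ 20 <= X j ^+ 23.
  by rewrite (_ : 23 = 3 + 20)%N// exprD ler_pM2r ?exprn_gt0.
have hvp := wle_mul Wj hv hp; have hvg := wle_mul Wj hv hg.
have ws k : w j (- k) = w j k by case: Wj.
have bound (P1 P2 : R -> C) : wle (w j) P1 (CV * X j ^+ 20) -> wle (w j) P2 (CV * X j ^+ 20) ->
    wle (w j.+1) (fun x => P1 x - m x * conjc (P2 x)) (X j.+1 ^+ 20).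
  move=> hP1 hP2; apply: wle_weight_le ww _.
  apply: (@wle_mono _ _ _ (CV * X j ^+ 20 + mu * (CV * X j ^+ 20))); last first.
    apply: wle_sub => //; first by move=> k; exact: weight_ge0 Wj.
    by apply: wle_mul => //; exact: wle_conj.
  (* The exponent 20 reproduces itself: 24 n_j <= 20 n_(j+1), because n_(j+1) >= r_j >= 6 n_j /
     5. *)
  apply: (@le_trans _ _ (X j * X j ^+ 23)); last first.
    rewrite -exprS /X -!exprM ler_weXn2l ?ler1n//.
    by move: (nr j) (rn j); clear; lia.
  rewrite -[X in X + _]mul1r -mulrDl; apply: ler_pM => //.
  - by rewrite addr_ge0.
  - by rewrite mulr_ge0// exprn_ge0// ltW.
  - by apply: le_trans X20; apply: (@le_trans _ _ (1 + 1)); [rewrite lerD2l; apply: le_trans mu2 _; rewrite invf_le1// ler1n|rewrite -(natrD _ 1 1) ler_nat].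
exists (fun x => h2 x * h x), (next_p psi m p g), (next_s psi m p g).
exists (cj_a al m (rt_a al h2 psi a) (rt_b al h2 psi b)), (cj_b al m (rt_a al h2 psi a) (rt_b al h2 psi b)).
exists z', kap', f'; split; [|split; [|split]].
- by split => //; [move=> x; rewrite mulr_gt0|exact: framed_next].
- split; [|exact: bound|exact: bound].
  move=> x; have [d dE /andP[dlo dhi]] := hd x.
  have mm : cabs (m x) ^+ 2 <= (2 ^+ j)^-1 / 4096.
    have m0 : cabs (m x) <= uu j := wle_sup x Wj hmu.
    apply: le_trans uj; apply: (@le_trans _ _ (cabs (m x))) => //.
    rewrite expr2 ler_piMl ?cabs_ge0//; apply: le_trans m0 (le_trans uY _); exact: Y1.
  exists (d - cabs (m x) ^+ 2 * d); first by rewrite metD_next metD_unit dE mulcJ -rcM -rcB.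
  exact: kam_det_bounds mm (sqr_ge0 _) dlo dhi.
- split => //.
  + exact: wle_mono hf'.
  + exact: wle_mono (le_trans zb dec) hz'.
  + exact: wle_mono (le_trans bb dec) hb'.
- exact: next_metric_increments hmu hvp hvg X23 hmet.
Qed.

Lemma kam_state0 (kap0 : C) (z0 : R -> C) : cabs kap0 = 1 ->
  (forall x, a0 x = kap0 * (1 + z0 x)) -> wle (w 0) z0 (dl 0) -> wle (w 0) b0 (dl 0) ->
  Rot a0 b0 -> kam_state 0.
Proof.
move=> k1 aE hz hb hR; exists (fun=> 1), (fun=> 1), (fun=> 0), a0, b0, z0, kap0, (fun=> 0).
have c1 (u : int -> R) : u 0 = 1 -> wle u (fun=> 1 : C) 1.
  by move=> u0E; have := wle_cst (1 : C) u0E; rewrite cabs1.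
have c0 (u : int -> R) : u 0 = 1 -> wle u (fun=> 0 : C) 0.
  by move=> u0E; have := wle_cst (0 : C) u0E; rewrite cabs0.
have brk0 t : brk R 0 ^+ t = 1 by rewrite /brk normr0 max_l// expr1n.
have w00 : w 0 0 = 1 by case: (Wt 0).
split; [|split; [|split]].
- split => // x; rewrite /tr_p /tr_s conjc0 conjc1 !mul1r !mul0r !mulr0 !mulr1 !addr0 !subr0.
  by split.
- split; last 2 first.
  + by apply: wle_mono (c1 _ w00); rewrite exprn_ege1//; apply: le_trans (Xbig 0); rewrite exprn_ege1// ler1n.
  + by apply: wle_mono (c0 _ w00); rewrite exprn_ge0// ltW.
  move=> x; exists 1; first by rewrite /metD conjc1 conjc0 mulr1 mulr0 subr0.
  by rewrite expr1 lexx andbT; lra.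
- split => //.
  + by move=> x; rewrite aE cis0.
  + apply: (@wle_mono _ _ _ 0); last by apply: c0; rewrite /om brk0 w00 mulr1.
    rewrite mulr_ge0 ?divr_ge0 ?exprn_ge0 ?(ltW gam_gt0)// subr_ge0 invf_le1 ?exprn_gt0//.
    by rewrite exprn_ege1// ler1n.
- move=> t B; have B0 : B 0 = 1 by exact: brk0.
  have e1 : 1 <= 2 ^+ (t * n t) :> R by rewrite exprn_ege1// ler1n.
  have b1 : 1 <= Bt t 0 by rewrite /Bt expr0 divr1; move: e1; lra.
  split.
  + apply: (@eq_wle _ _ (fun=> 1)); first by move=> x; rewrite /metG conjc1 conjc0 mulr1 mulr0 addr0.
    exact: wle_mono b1 (c1 _ B0).
  + apply: (@eq_wle _ _ (fun=> 0)); first by move=> x; rewrite /metC mulr0.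
    by apply: wle_mono (c0 _ B0); apply: le_trans b1.
  + apply: (@eq_wle _ _ (fun=> 1)); first by move=> x; rewrite /metD conjc1 conjc0 mulr1 mulr0 subr0.
    exact: wle_mono b1 (c1 _ B0).
Qed.

(** [pull_G] and [pull_C] are the coefficients of the form (G, c) at x + al pulled back by w -> a0 w
    + b0 conj(w). *)
Definition pull_G (G c : R -> C) x : C :=
  G (x + al) * (a0 x * conjc (a0 x) + b0 x * conjc (b0 x))
  + 2 * (conjc (c (x + al)) * (a0 x * b0 x) + c (x + al) * (conjc (a0 x) * conjc (b0 x))).
Definition pull_C (G c : R -> C) x : C :=
  G (x + al) * (conjc (a0 x) * b0 x) + c (x + al) * conjc (a0 x) ^+ 2 + conjc (c (x + al)) * b0 x ^+ 2.

(** If b vanished, the form divided by D would be exactly invariant. Both defects are linear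
    combinations of [be] and its conjugate, where b = h be, with bounded coefficients;
    [defect_bound] gives |be| <= 2 dl. *)
Lemma kam_invariant_defect j : (forall x, cabs (a0 x) ^+ 2 - cabs (b0 x) ^+ 2 = 1) ->
  (forall x, cabs (a0 x) <= 2) -> (forall x, cabs (b0 x) <= 1) -> kam_state j ->
  exists G c d : R -> C,
  [/\ forall t, let B := fun k => brk R k ^+ t in let b := 4 * 2 ^+ (t * n t) in
       [/\ wle B G b, wle B c b & wle B d b],
      forall x, complex.Im (G x) = 0 /\ complex.Im (d x) = 0,
      forall x, [/\ 0 <= complex.Re (G x), 2^-1 <= complex.Re (d x) & G x ^+ 2 = d x ^+ 2 + 4 * (c x * conjc (c x))],
      forall x, cabs (d (x + al) * G x - d x * pull_G G c x) <= 100 / 2 ^+ j &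
      forall x, cabs (d (x + al) * c x - d x * pull_C G c x) <= 100 / 2 ^+ j].
Proof.
move=> detA ha hb0 [h [p [g [a [b [z [kap [f [[h0 fr _] [[hd hp hg] [[kap1 aE hf hz hb] hmet]]]]]]]]]]].
exists (metG p g), (metC p g), (metD p g).
have Bt4 t : Bt t j <= 4 * 2 ^+ (t * n t).
  by rewrite /Bt mulrC ler_pM2r ?exprn_gt0// gerBl divr_ge0 ?exprn_ge0.
have brk0 t : brk R 0 ^+ t = 1 by rewrite /brk normr0 max_l// expr1n.
have hB t : let B := fun k => brk R k ^+ t in let b := 4 * 2 ^+ (t * n t) in
   [/\ wle B (metG p g) b, wle B (metC p g) b & wle B (metD p g) b].
  by move=> B b'; have [? ? ?] := hmet t; split; exact: wle_mono (Bt4 t) _.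
have W0 : weight (fun k => brk R k ^+ 0).
  by split => [|k|k|k l]; rewrite ?expr0 ?mulr1.
have GE x : metG p g x = (cabs (p x) ^+ 2 + cabs (g x) ^+ 2)%:C by rewrite /metG !mulcJ rcD.
(* The form bound for t = 0 is a sup bound, so the frame is pointwise bounded by 2 although its
   weighted norm grows. *)
have sq4 x : cabs (p x) ^+ 2 + cabs (g x) ^+ 2 <= 4.
  have [/(wle_sup x W0) hG _ _] := hB 0.
  by move: hG; rewrite mul0n expr0 mulr1 GE cabs_real; apply: le_trans; exact: ler_norm.
have p2 x : cabs (p x) <= 2.
  by rewrite -(@ler_pXn2r _ 2) ?nnegrE ?cabs_ge0//; have := sq4 x; have := sqr_ge0 (cabs (g x)); lra.
have g2 x : cabs (g x) <= 2.
  by rewrite -(@ler_pXn2r _ 2) ?nnegrE ?cabs_ge0//; have := sq4 x; have := sqr_ge0 (cabs (p x)); lra.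
have tp6 x : cabs (tr_p al a0 b0 p g x) <= 6.
  apply: le_trans (cabs_add_le (cabs_mul_le (p2 _) (ha x)) (cabs_mul_le (g2 _) _)) _.
    by rewrite cabsJ; exact: hb0.
  by lra.
have ts6 x : cabs (tr_s al a0 b0 p g x) <= 6.
  apply: le_trans (cabs_add_le (cabs_mul_le (p2 _) (hb0 x)) (cabs_mul_le (g2 _) _)) _.
    by rewrite cabsJ; exact: ha.
  by lra.
pose be x := p x * tr_s al a0 b0 p g x - g x * tr_p al a0 b0 p g x.
have detAc x : a0 x * conjc (a0 x) - b0 x * conjc (b0 x) = 1 by rewrite !mulcJ -rcB detA.
have dtr x : tr_p al a0 b0 p g x * conjc (tr_p al a0 b0 p g x) -
    tr_s al a0 b0 p g x * conjc (tr_s al a0 b0 p g x) = metD p g (x + al).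
  rewrite -[RHS]mulr1 -(detAc x) /tr_p /tr_s /metD !(conjcD, conjcM, conjcc); ring.
have dj : dl j <= (2 ^+ j)^-1 / 4096.
  by rewrite pow12; apply: le_trans (Y2 j); apply: YleS; move: (sJ_big j); clear; lia.
have dl0 : 0 <= dl j by rewrite exprn_ge0 ?(ltW (Y0 j)).
have jp : 0 < (2 ^+ j)^-1 :> R by rewrite invr_gt0 exprn_gt0.
have j1 : (2 ^+ j)^-1 <= 1 :> R by rewrite invf_le1 ?exprn_gt0// exprn_ege1// ler1n.
have hbe x : cabs (be x) <= 2 * dl j.
  have [Ea Eb] := fr x; have hx := h0 x.
  have bx : cabs (b x) <= dl j := wle_sup x (Wt j) hb.
  have zx : cabs (z x) <= dl j := wle_sup x (Wt j) hz.
  have ax : 1 - dl j <= cabs (a x).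
    rewrite aE cabsM kap1 mul1r; have := cabs_add_ge (cis (f x)) (z x).
    by rewrite cabs_cis; apply: le_trans; rewrite lerD2l lerN2.
  set A := tr_p al a0 b0 p g x * conjc (p x) - tr_s al a0 b0 p g x * conjc (g x) in Ea.
  have [d1 d1E /andP[d1lo d1hi]] := hd x; have [d2 d2E /andP[d2lo d2hi]] := hd (x + al).
  have AB : cabs A ^+ 2 - cabs (be x) ^+ 2 = d2 * d1.
    apply: (@complexI R); rewrite rcB -!mulcJ rcM -d1E -d2E -dtr /A /be /metD.
    by rewrite !(conjcB, conjcM, conjcc); ring.
  have ca : cabs (a x) = h x * cabs A by rewrite Ea cabsM cabs_real ger0_norm// ltW.
  have cb : cabs (b x) = h x * cabs (be x) by rewrite Eb cabsM cabs_real ger0_norm// ltW.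
  exact: defect_bound hx dl0 dj jp j1 (cabs_ge0 _) (cabs_ge0 _) ca cb AB ax bx d1lo d1hi d2lo d2hi (ltac:(by rewrite invr_ge0 exprn_ge0)).
have dl2 : dl j <= (2 ^+ j)^-1 by apply: le_trans dj _; rewrite pow12 ler_piMr ?(ltW jp)// invf_le1 ?exprn_gt0// exprn_ege1// ler1n.
have d96 : 2 * (2 * dl j * 12 + 12 * (2 * dl j)) <= 100 / 2 ^+ j.
  by rewrite (_ : 2 * _ = 96 * dl j); [apply: ler_pM => //; rewrite ler_nat|ring].
have d48 : 2 * 2 * 6 * 0 + 2 * 6 * (2 * dl j) + 2 * 6 * (2 * dl j) <= 100 / 2 ^+ j.
  by rewrite (_ : _ + _ = 48 * dl j); [apply: ler_pM => //; rewrite ler_nat|ring].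
have hps x : cabs (p x * tr_s al a0 b0 p g x) <= 12.
  by apply: le_trans (cabs_mul_le (p2 x) (ts6 x)) _; rewrite -natrM ler_nat.
have hgp x : cabs (g x * tr_p al a0 b0 p g x) <= 12.
  by apply: le_trans (cabs_mul_le (g2 x) (tp6 x)) _; rewrite -natrM ler_nat.
split => //.
- move=> x; have [d -> _] := hd x; by rewrite GE.
- move=> x; have [d dE /andP[dlo _]] := hd x; split.
  + by rewrite GE /= addr_ge0 ?sqr_ge0.
  + by rewrite dE /=; apply: le_trans dlo; rewrite lerDl invr_ge0 exprn_ge0.
  + by rewrite /metG /metD /metC !(conjcM, conjcc); ring.
- move=> x.
  rewrite (_ : _ - _ = - (2 * (be x * conjc (p x * tr_s al a0 b0 p g x)
      + g x * tr_p al a0 b0 p g x * conjc (be x)))).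
    rewrite cabsN; apply: le_trans d96; apply: cabs_mul_le; first by rewrite cabs_nat.
    by apply: cabs_add_le; apply: cabs_mul_le; rewrite ?cabsJ.
  rewrite /be -dtr /pull_G /metG /metC /metD /tr_p /tr_s !(conjcB, conjcD, conjcM, conjcc); ring.
- move=> x.
  rewrite (_ : _ - _ = - (conjc (p x) * conjc (tr_p al a0 b0 p g x) * be x
      + g x * tr_s al a0 b0 p g x * conjc (be x))).
    rewrite cabsN; apply: le_trans d48; rewrite mulr0 add0r; apply: cabs_add_le; apply: cabs_mul_le; rewrite ?cabsJ//.
      by apply: cabs_mul_le; rewrite cabsJ.
    by apply: cabs_mul_le.
  rewrite /be -dtr /pull_C /metG /metC /metD /tr_p /tr_s !(conjcB, conjcD, conjcM, conjcc); ring.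
Qed.

End KamInduction.

(** * Limits of rapidly decaying Fourier series *)

Section SmoothLimits.
Variable R : realType.
Local Open Scope complex_scope.
Local Notation C := R[i].
Implicit Types (k l : int) (x h : R) (f g : R -> C).
#[local] Existing Instance ufilter_ultra.
#[local] Existing Instance ufilter_proper.

Definition bw (t : nat) k : R := brk R k ^+ t.

Lemma bw_ge0 t k : 0 <= bw t k.
Proof. by rewrite exprn_ge0// (le_trans ler01 (brk_ge1 _ _)). Qed.
Lemma bw_le t t' k : (t <= t')%N -> bw t k <= bw t' k.
Proof. by move=> tt; apply: ler_weXn2l => //; exact: brk_ge1. Qed.
Lemma bw_even t k : bw t (- k) = bw t k.
Proof. by rewrite /bw brkN. Qed.

Lemma wle_approx w f (B : R) : wle w f B -> exists p : nat -> seq (int * C),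
  forall n, nw w (p n) <= B /\ forall x, cabs (f x - ev (p n) x) <= n.+1%:R^-1.
Proof.
move=> hf; have H n : exists t, nw w t <= B /\ forall x, cabs (f x - ev t x) <= n.+1%:R^-1.
  by have [t tB th] := hf n.+1%:R^-1 (ltac:(by rewrite invr_gt0 ltr0n)); exists t.
have [p hp] := choice H; by exists p.
Qed.

Lemma small_le (a c K : R) : (forall eta, 0 < eta -> a <= c + K * eta) -> a <= c.
Proof.
move=> H; apply/ler_addgt0Pr => eta e0.
have K0 : 0 < `|K| + 1 by rewrite ltr_wpDl.
have h0 : 0 < eta / (`|K| + 1) by rewrite divr_gt0.
apply: le_trans (H _ h0) _; rewrite lerD2l mulrA ler_pdivrMr// mulrC ler_pM2l//.
by apply: le_trans (ler_norm _) _; rewrite lerDl.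
Qed.

Lemma wle_period w f (B : R) : wle w f B -> forall x, f (x + 1) = f x.
Proof.
move=> hf x; apply/eqP; rewrite -subr_eq0; apply/eqP/cabs_eq0/eqP; rewrite eq_le cabs_ge0 andbT.
apply: (@small_le _ _ 2) => eta /hf [t _ ht]; rewrite add0r.
rewrite (_ : _ - _ = (f (x + 1) - ev t (x + 1)) - (f x - ev t x)); last by rewrite ev_period; ring.
by rewrite mulrC mulr2n mulrDr mulr1; apply: cabs_sub_le.
Qed.

Lemma ev_lip t x h : cabs (ev t (x + h) - ev t x) <= 8 * nw (bw 1) t * `|h|.
Proof.
rewrite /ev -sumrB; apply: le_trans (cabs_sum _ _ _) _; rewrite /nw big_distrr big_distrl /=.
apply: ler_sum => p _; rewrite -mulrBr cabsM.
apply: le_trans (ler_wpM2l (cabs_ge0 _) (cabs_eB_le _ _)) _.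
rewrite mulrDr [_ * x + _]addrC addrK normrM /bw expr1.
rewrite (_ : 8 * _ * _ = cabs p.2 * (8 * (brk R p.1 * `|h|))); last by ring.
apply: ler_wpM2l; first exact: cabs_ge0.
by apply: ler_wpM2l => //; apply: ler_wpM2r => //; exact: brk_gek.
Qed.

Lemma wle_lip f (B : R) : wle (bw 1) f B -> forall x h, cabs (f (x + h) - f x) <= 8 * B * `|h|.
Proof.
move=> hf x h; apply: (@small_le _ _ 2) => eta /hf [t tB ht].
rewrite (_ : _ - _ = (ev t (x + h) - ev t x) + ((f (x + h) - ev t (x + h)) - (f x - ev t x))); last by ring.
apply: cabs_add_le.
  apply: le_trans (ev_lip _ _ _) _; apply: ler_wpM2r => //; exact: ler_wpM2l.
by rewrite mulrC mulr2n mulrDr mulr1; apply: cabs_sub_le.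
Qed.

Definition der (t : seq (int * C)) := tmap (fun k => 'i * (2 * pi * k%:~R)%:C) t.

Lemma nw_der j t : nw (bw j) (der t) <= 8 * nw (bw j.+1) t.
Proof.
apply: nw_map => // p _; rewrite cabsM cabsi mul1r cabs_real normrM ger0_norm ?mulr_ge0 ?pi_ge0//.
rewrite /bw exprS mulrA; apply: ler_wpM2r; first exact: bw_ge0.
apply: ler_pM => //; rewrite ?mulr_ge0 ?pi_ge0//; last exact: brk_gek.
by have := pi_le4 R; lra.
Qed.

Lemma ev_der t x h : cabs (ev t (x + h) - ev t x - h%:C * ev (der t) x) <= 192 * nw (bw 2) t * h ^+ 2.
Proof.
rewrite /der /tmap /ev big_map big_distrr /= -!sumrB; apply: le_trans (cabs_sum _ _ _) _.
rewrite /nw big_distrr big_distrl /=; apply: ler_sum => p _.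
rewrite (_ : _ - _ - _ = p.2 * e (p.1%:~R * x) * (cis (2 * pi * (p.1%:~R * h)) - 1
   - 'i * (2 * pi * (p.1%:~R * h))%:C)); last first.
  by rewrite mulrDr eD -/(e (p.1%:~R * h)) !rcM /=; ring.
rewrite cabsM cabsM cabs_e mulr1 -!mulrA [leRHS]mulrCA; apply: ler_wpM2l; first exact: cabs_ge0.
apply: le_trans (cabs_cisB1B_le _) _.
rewrite (_ : 192 = 3 * 64); last by ring.
rewrite -mulrA ler_pM2l// [leRHS](_ : _ = 64 * bw 2 p.1 * h ^+ 2); last by rewrite /bw; ring.
rewrite (_ : (2 * (pi * (p.1%:~R * h))) ^+ 2 = (2 * pi) ^+ 2 * p.1%:~R ^+ 2 * h ^+ 2); last by ring.
apply: ler_wpM2r; first exact: sqr_ge0.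
have P : (2 * pi) ^+ 2 <= 64 :> R by have := pi_le4 R; have := pi_ge0 R; nra.
have K2 : p.1%:~R ^+ 2 <= bw 2 p.1.
  by rewrite -(real_normK (num_real (p.1%:~R : R))) /bw; apply: lerXn2r; rewrite ?nnegrE ?(le_trans ler01 (brk_ge1 _ _))// brk_gek.
by apply: ler_pM => //; exact: sqr_ge0.
Qed.

Definition ulimC (z : nat -> C) : C :=
  ulim (fun n => complex.Re (z n)) +i* ulim (fun n => complex.Im (z n)).

Lemma ulimC_near (z : nat -> C) (B eta : R) : (forall n, cabs (z n) <= B) -> 0 < eta ->
  ufilter (fun n => cabs (z n - ulimC z) <= eta).
Proof.
move=> zB e0; have e20 : 0 < eta / 2 by lra.
have reB n : `|complex.Re (z n)| <= B by exact: le_trans (Re_le_cabs _) _.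
have imB n : `|complex.Im (z n)| <= B by exact: le_trans (Im_le_cabs _) _.
have /cvgrPdist_le /(_ _ e20) h1 := ulim_cvg reB.
have /cvgrPdist_le /(_ _ e20) h2 := ulim_cvg imB.
apply: filterS2 h1 h2 => n h1 h2; rewrite (_ : eta = eta / 2 + eta / 2); last by lra.
by apply: cabs_ReIm_le; rewrite (ReD,ImD) (ReN,ImN) /= distrC.
Qed.

Section Uniform.
Variables (f : nat -> R -> C) (B L : R).
Hypothesis fB : forall n x, cabs (f n x) <= B.
Hypothesis fL : forall n x h, cabs (f n (x + h) - f n x) <= L * `|h|.
Hypothesis fp : forall n x, f n (x + 1) = f n x.
Let F x := ulimC (fun n => f n x).

Lemma ulimC_lip x h : cabs (F (x + h) - F x) <= L * `|h|.
Proof.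
apply: (@small_le _ _ 2) => eta e0.
have [n [h1 h2]] := filter_ex (filterI (ulimC_near (fun n => fB n (x + h)) e0) (ulimC_near (fun n => fB n x) e0)).
rewrite (_ : _ - _ = (f n (x + h) - f n x) - ((f n (x + h) - F (x + h)) - (f n x - F x))); last by ring.
apply: cabs_sub_le; first exact: fL.
by rewrite mulrC mulr2n mulrDr mulr1; apply: cabs_sub_le.
Qed.

Lemma ulimC_period x : F (x + 1) = F x.
Proof. by rewrite /F; congr ulimC; apply/funext => n; rewrite fp. Qed.

(** Equi-Lipschitz periodic functions are controlled by their values at finitely many nodes, and a
    filter is closed under finite intersections; pointwise limits are therefore uniform. *)
Lemma ulimC_uniform eta : 0 < eta -> ufilter (fun n => forall x, cabs (f n x - F x) <= eta).
Proof.
move=> e0; have e30 : 0 < eta / 3 by lra.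
have L0 : 0 <= L by have := fL 0 0 1; rewrite normr1 mulr1; apply: le_trans; exact: cabs_ge0.
have [N N0 hN] := archi_small L e30.
have Np : (0 : R) < N%:R by rewrite ltr0n.
have H : ufilter (fun n => forall i : 'I_N, cabs (f n (i%:R / N%:R) - F (i%:R / N%:R)) <= eta / 3).
  by apply: filter_forall => i; exact: ulimC_near e30.
apply: filterS H => n H x.
have per (g : R -> C) : (forall y, g (y + 1) = g y) -> forall y (k : int), g (y + k%:~R) = g y.
  move=> gp; have pn y (m : nat) : g (y + m%:R) = g y.
    by elim: m y => [|m IH] y; rewrite ?addr0// -natr1 addrA gp IH.
  by move=> y [m|m]; rewrite ?pn// NegzE mulrNz -[in RHS](subrK m.+1%:R y) pn.
pose y := x - (Num.floor x)%:~R.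
have xE : x = y + (Num.floor x)%:~R by rewrite /y subrK.
have y01 : 0 <= y < 1.
  by have := floor_itv x; rewrite /y intrD; move=> /andP[h1 h2]; apply/andP; split; lra.
have /andP[y0 y1] := y01.
have yN : 0 <= y * N%:R by rewrite mulr_ge0.
have iN : (Num.trunc (y * N%:R) < N)%N.
  rewrite -(ltr_nat R); apply: le_lt_trans (_ : y * N%:R < _); first by rewrite truncn_le.
  by rewrite gtr_pMl.
pose i := Ordinal iN; pose d := y - i%:R / N%:R.
have dN : `|d| <= N%:R^-1.
  have /andP[i1 i2] := truncn_itv yN.
  rewrite /d /= ger0_norm; last by rewrite subr_ge0 ler_pdivrMr.
  by rewrite lerBlDl -[X in _ + X]mul1r -mulrDl ler_pdivlMr// natr1 ltW.
have Ld : L * `|d| <= eta / 3 by apply: le_trans (ler_wpM2l L0 dN) hN.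
have yE : y = i%:R / N%:R + d by rewrite /d addrC subrK.
rewrite xE (per _ (fp n)) (per _ ulimC_period) yE.
rewrite (_ : _ - _ = ((f n (i%:R / N%:R + d) - f n (i%:R / N%:R)) + (f n (i%:R / N%:R) - F (i%:R / N%:R)))
  - (F (i%:R / N%:R + d) - F (i%:R / N%:R))); last by ring.
rewrite (_ : eta = eta / 3 + eta / 3 + eta / 3); last by field.
apply: cabs_sub_le; last exact: le_trans (ulimC_lip _ _) Ld.
by apply: cabs_add_le; [exact: le_trans (fL _ _ _) Ld|exact: H].
Qed.

Lemma ulimC_wle w (W : R) : (forall n, wle w (f n) W) -> wle w F W.
Proof.
move=> hf; apply: wle_lim => eta e0; have [n hn] := filter_ex (ulimC_uniform e0).
by exists (f n) => // x; rewrite cabs_dist.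
Qed.
End Uniform.

(** Smoothness on the Fourier side: membership in the Wiener class of every polynomial weight. *)
Definition rapid f := forall t, exists B, wle (bw t) f B.

Lemma wle_bw t t' f B : (t <= t')%N -> wle (bw t') f B -> wle (bw t) f B.
Proof. by move=> tt; apply: wle_weight_le => k; exact: bw_le. Qed.

Lemma weight_bw0 : weight (bw 0).
Proof. by split => [|k|k|k l]; rewrite /bw ?expr0 ?mulr1. Qed.

Lemma wle_bw_sup t f B x : wle (bw t) f B -> cabs (f x) <= B.
Proof. by move=> h; apply: (wle_sup x weight_bw0); exact: wle_bw h. Qed.

(** The derivative is the ultrafilter limit of the termwise derivatives of approximants. One power
    of the weight pays for differentiation; a second one for the equicontinuity of these derivatives
    and for the quadratic remainder. *)
Lemma wle_derive t f B : wle (bw t.+2) f B -> exists2 g, wle (bw t) g (8 * B) &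
  forall x h, cabs (f (x + h) - f x - h%:C * g x) <= 192 * B * h ^+ 2.
Proof.
move=> /wle_approx [p hp].
have B0 n j : (j <= t.+2)%N -> nw (bw j) (p n) <= B.
  move=> jt; apply: le_trans (hp n).1; apply: ler_sum => q _; apply: ler_wpM2l; first exact: cabs_ge0.
  exact: bw_le.
have dB n j : (j < t.+2)%N -> wle (bw j) (ev (der (p n))) (8 * B).
  move=> jt; apply: wle_ev; apply: le_trans (nw_der _ _) _; apply: ler_wpM2l => //; exact: B0.
pose D n := ev (der (p n)).
have DB n x : cabs (D n x) <= 8 * B by apply: (wle_bw_sup (t := 0)); exact: dB.
have DL n x h : cabs (D n (x + h) - D n x) <= 8 * (8 * B) * `|h|.
  by apply: wle_lip; exact: dB.
have Dp n x : D n (x + 1) = D n x by exact: ev_period.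
exists (fun x => ulimC (fun n => D n x)).
  by apply: (ulimC_wle DB DL Dp) => n; apply: dB; rewrite ltnS leqnSn.
move=> x h; apply: (@small_le _ _ (2 + `|h|)) => eta e0.
have [m m0 hm] := archi_small 1 e0.
have U : ufilter (fun n => (m <= n)%N).
  by apply: eventually_ufilter; exists m.
have [n [h1 h2]] := filter_ex (filterI (ulimC_near (DB ^~ x) e0) U).
set g := ulimC _ in h1 *.
have pe y : cabs (f y - ev (p n) y) <= eta.
  apply: le_trans ((hp n).2 y) _; apply: le_trans hm; rewrite mul1r lef_pV2 ?posrE ?ltr0n// ler_nat.
  by rewrite ltnW// ltnS.
rewrite (_ : _ - _ - _ = (ev (p n) (x + h) - ev (p n) x - h%:C * D n x)
  + ((f (x + h) - ev (p n) (x + h)) - (f x - ev (p n) x) + h%:C * (D n x - g))); last by ring.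
apply: cabs_add_le.
  apply: le_trans (ev_der _ _ _) _; apply: ler_wpM2r; first exact: sqr_ge0.
  by apply: ler_wpM2l => //; exact: B0.
rewrite (_ : (2 + `|h|) * eta = (eta + eta) + `|h| * eta); last by ring.
apply: cabs_add_le; first exact: cabs_sub_le.
by apply: cabs_mul_le => //; rewrite cabs_real.
Qed.

Lemma quadratic_unique f (x : R) (g1 g2 : C) (K1 K2 : R) :
  (forall h, cabs (f (x + h) - f x - h%:C * g1) <= K1 * h ^+ 2) ->
  (forall h, cabs (f (x + h) - f x - h%:C * g2) <= K2 * h ^+ 2) -> g1 = g2.
Proof.
move=> h1 h2; apply/eqP; rewrite -subr_eq0; apply/eqP/cabs_eq0/eqP; rewrite eq_le cabs_ge0 andbT.
apply: (@small_le _ _ (K1 + K2)) => h h0; rewrite add0r -(ler_pM2l h0).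
have -> : h * cabs (g1 - g2) = cabs (h%:C * (g1 - g2)) by rewrite cabsM cabs_real gtr0_norm.
rewrite (_ : h%:C * _ = (f (x + h) - f x - h%:C * g2) - (f (x + h) - f x - h%:C * g1)); last by ring.
rewrite (_ : h * _ = K2 * h ^+ 2 + K1 * h ^+ 2); last by ring.
exact: cabs_sub_le.
Qed.

(** The derivatives produced for different [t] coincide by [quadratic_unique], so a single function
    has every decay. *)
Lemma rapid_derive f : rapid f -> exists2 g, rapid g &
  exists K, forall x h, cabs (f (x + h) - f x - h%:C * g x) <= K * h ^+ 2.
Proof.
move=> hf; have [B0 /wle_derive [g hg Kg]] := hf 2%N.
exists g; last by exists (192 * B0).
move=> t; have [B /wle_derive [g' hg' Kg']] := hf t.+2.
exists (8 * B); apply: eq_wle hg' => x; exact: quadratic_unique (Kg' x) (Kg x).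
Qed.

End SmoothLimits.

(** * Calculus of repeatedly differentiable functions *)

Section SmoothCalculus.
Variable R : realType.
Local Open Scope complex_scope.
Implicit Types (n : nat) (f g v : R -> R) (x : R).

(** Naming the successive derivatives as witnesses makes closure under products and composition an
    induction on [n]; [cdiff_derivable] and [derivable_cdiff] translate to and from [derive1n]. *)
Fixpoint cdiff n f : Prop := if n is n'.+1 then
  exists2 f', (forall x, is_derive x 1 f (f' x)) & cdiff n' f' else True.

Lemma cdiff_pred n f : cdiff n.+1 f -> cdiff n f.
Proof. by elim: n f => // n IH f [f' hf /IH ?]; exists f'. Qed.

Lemma cdiff_cst n (a : R) : cdiff n (fun=> a).
Proof.
elim: n a => // n IH a; exists (fun=> 0); last exact: IH.
by move=> x; exact: is_derive_cst.
Qed.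

Lemma cdiff_add n f g : cdiff n f -> cdiff n g -> cdiff n (fun x => f x + g x).
Proof.
elim: n f g => // n IH f g [f' hf cf] [g' hg cg].
by exists (fun x => f' x + g' x); [move=> x; exact: is_deriveD|exact: IH].
Qed.

Lemma cdiff_mul n f g : cdiff n f -> cdiff n g -> cdiff n (fun x => f x * g x).
Proof.
elim: n f g => // n IH f g hf hg.
have cf0 := cdiff_pred hf; have cg0 := cdiff_pred hg.
case: hf => f' hf cf; case: hg => g' hg cg.
exists (fun x => f x * g' x + g x * f' x); last by apply: cdiff_add; exact: IH.
by move=> x; exact: is_deriveM.
Qed.

Lemma cdiff_scale n (a : R) f : cdiff n f -> cdiff n (fun x => a * f x).
Proof. by move=> h; apply: cdiff_mul => //; exact: cdiff_cst. Qed.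

Lemma cdiff_opp n f : cdiff n f -> cdiff n (fun x => - f x).
Proof.
move=> /(cdiff_scale (- 1)); congr cdiff; apply/funext => x; exact: mulN1r.
Qed.

Lemma cdiff_sub n f g : cdiff n f -> cdiff n g -> cdiff n (fun x => f x - g x).
Proof. by move=> hf hg; apply: cdiff_add => //; exact: cdiff_opp. Qed.

Lemma is_derive_shift_comp f (a x d : R) : is_derive (x + a) 1 f d -> is_derive x 1 (fun y => f (y + a)) d.
Proof.
move=> h; rewrite -[d]mulr1; apply: (@is_derive1_comp _ f (fun y => y + a)) => //.
have := is_deriveD (is_derive_id x (1 : R)) (is_derive_cst a x (1 : R)); by rewrite addr0.
Qed.

Lemma cdiff_shift n f (a : R) : cdiff n f -> cdiff n (fun x => f (x + a)).
Proof.
elim: n f => // n IH f [f' hf cf]; exists (fun x => f' (x + a)); last exact: IH.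
by move=> x; exact: is_derive_shift_comp.
Qed.

Definition isqrt (u : R) : R := expR (- 2^-1 * ln u).

Lemma isqrt_sq (u : R) : 0 < u -> isqrt u * isqrt u = u^-1.
Proof.
move=> u0; rewrite /isqrt -expRD -mulrDl (_ : - 2^-1 + - 2^-1 = -1 :> R); last by field.
by rewrite mulN1r expRN lnK.
Qed.

(* The derivative of [u ^ (-1/2)] is expressed by its cube, so that no quotient occurs. *)
Lemma cdiff_isqrt n v : (forall x, 0 < v x) -> cdiff n v -> cdiff n (fun x => isqrt (v x)).
Proof.
move=> v0; elim: n => // n IH hv; have cy := IH (cdiff_pred hv); case: hv => v' hv cv.
exists (fun x => - 2^-1 * (v' x * (isqrt (v x) * (isqrt (v x) * isqrt (v x))))); last first.
  by apply: cdiff_scale; apply: cdiff_mul => //; apply: cdiff_mul => //; exact: cdiff_mul.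
move=> x.
have h1 : is_derive (v x) 1 (fun u : R => - 2^-1 * ln u) (- 2^-1 * (v x)^-1).
  have := is_derive1_ln (v0 x) => h; apply: (@is_deriveZ _ _ _ _ (- 2^-1)).
have h2 := @is_derive1_comp _ _ _ (v x) _ _ (is_derive_expR (- 2^-1 * ln (v x))) h1.
have h3 := @is_derive1_comp _ _ v x _ _ h2 (hv x).
apply: (is_derive_eq h3); rewrite isqrt_sq// /isqrt; ring.
Qed.

Lemma cdiff_derivable f : (forall n, cdiff n f) -> forall n x, derivable (derive1n n f) x 1.
Proof.
suff H n : forall f, cdiff n.+1 f -> forall x, derivable (derive1n n f) x 1 by move=> h n; exact: H.
elim: n => [|n IH] {}f [f' hf cf] x; first by rewrite derive1n0; exact: (@ex_derive _ _ _ _ _ _ _ (hf x)).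
rewrite derive1Sn (_ : f^`()%classic = f'); first exact: IH.
by apply/funext => y; rewrite derive1E; exact: (@derive_val _ _ _ _ _ _ _ (hf y)).
Qed.

Lemma derivable_cdiff f : (forall n x, derivable (derive1n n f) x 1) -> forall n, cdiff n f.
Proof.
move=> h n; elim: n f h => // n IH f h; exists (f^`()%classic).
  by move=> x; rewrite derive1E; apply: derivableP; exact: (h 0%N).
by apply: IH => m x; rewrite -derive1Sn; exact: h.
Qed.

Lemma derive1n_mx (M : R -> 'M[R]_2) n (i j : 'I_2) :
  (forall m x, (m < n)%N -> derivable (derive1n m M) x 1) ->
  (fun x => derive1n n M x i j) = derive1n n (fun x => M x i j).
Proof.
elim: n => // n IH h; rewrite !derive1nS -IH; last by move=> m x mn; apply: h; exact: ltnW.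
by apply/funext => x; rewrite !derive1E derive_mx ?mxE//; exact: h.
Qed.

Lemma smooth_mx_entries (M : R -> 'M[R]_2) :
  (forall n x, derivable (derive1n n M) x 1) <-> (forall i j n, cdiff n (fun x => M x i j)).
Proof.
split=> [h i j|h].
  apply: derivable_cdiff => n x; rewrite -derive1n_mx//.
  by have /derivable_mxP := h n x; exact.
move=> n; elim/ltn_ind: n => n IH x; apply/derivable_mxP => i j.
rewrite (@derive1n_mx M n i j) => [|m y mn]; last exact: IH.
exact: cdiff_derivable.
Qed.

Lemma quadratic_is_derive f x (d K : R) :
  (forall h, `|f (x + h) - f x - h * d| <= K * h ^+ 2) -> is_derive x 1 f d.
Proof.
move=> H.
have cv : h^-1 *: (f (h *: 1 + x) - f x) @[h --> 0^'] --> d.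
  apply/cvgrPdist_le => eta e0; near=> h.
  have hn0 : h != 0 by near: h; exact: nbhs_dnbhs_neq.
  have E : d - h^-1 *: (f (h *: 1 + x) - f x) = - (h^-1 * (f (x + h) - f x - h * d)).
    rewrite /GRing.scale /= mulr1 (addrC h x); field; exact: hn0.
  rewrite E normrN normrM normfV ler_pdivrMl ?normr_gt0//; apply: le_trans (H h) _.
  rewrite -(real_normK (num_real h)) expr2 mulrA mulrC; apply: ler_wpM2l => //.
  apply: (@le_trans _ _ (`|K| * `|h|)); first by apply: ler_wpM2r => //; exact: ler_norm.
  have K0 : 0 < `|K| + 1 by rewrite ltr_wpDl.
  apply: (@le_trans _ _ ((`|K| + 1) * `|h|)); first by apply: ler_wpM2r => //; rewrite lerDl.
  rewrite -ler_pdivlMl// mulrC; near: h.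
  by apply: dnbhs0_le; rewrite divr_gt0.
by apply: DeriveDef; [apply: cvgP cv|apply: cvg_lim].
Unshelve. all: by end_near. Qed.

Lemma rapid_cdiff (f : R -> R[i]) : rapid f -> forall n,
  cdiff n (fun x => complex.Re (f x)) /\ cdiff n (fun x => complex.Im (f x)).
Proof.
move=> hf n; elim: n f hf => // n IH f /rapid_derive [g /IH [c1 c2] [K hK]].
split; [exists (fun x => complex.Re (g x)) => // x|exists (fun x => complex.Im (g x)) => // x];
  apply: (@quadratic_is_derive _ _ _ K) => h; apply: le_trans (hK x h).
  by apply: le_trans (Re_le_cabs _); rewrite !(ReD, ReN) ReM /= mul0r subr0.
by apply: le_trans (Im_le_cabs _); rewrite !(ImD, ImN) ImM /= mul0r addr0.
Qed.

End SmoothCalculus.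

(** * The limiting invariant form *)

Section MetricLimit.
Variable R : realType.
Local Open Scope complex_scope.
Local Notation C := R[i].
#[local] Existing Instance ufilter_ultra.
#[local] Existing Instance ufilter_proper.
Implicit Types (z w : nat -> C) (l m : C).

Definition ucvg z l := forall eta : R, 0 < eta -> ufilter (fun n => cabs (z n - l) <= eta).

Lemma ucvg_cst l : ucvg (fun=> l) l.
Proof. by move=> eta e0; apply: filterE => n; rewrite subrr cabs0 ltW. Qed.

Lemma ucvg_add z w l m : ucvg z l -> ucvg w m -> ucvg (fun n => z n + w n) (l + m).
Proof.
move=> hz hw eta e0; have e2 : 0 < eta / 2 by rewrite divr_gt0.
apply: filterS2 (hz _ e2) (hw _ e2) => n h1 h2.
rewrite (_ : _ - _ = (z n - l) + (w n - m)); last by ring.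
by rewrite (_ : eta = eta / 2 + eta / 2); [exact: cabs_add_le|field].
Qed.

Lemma ucvg_mul z w l m : ucvg z l -> ucvg w m -> ucvg (fun n => z n * w n) (l * m).
Proof.
move=> hz hw eta e0; pose K := 1 + cabs l + cabs m.
have K0 : 0 < K by rewrite /K -addrA ltr_pwDl// addr_ge0 ?cabs_ge0.
pose e1 := Num.min 1 (eta / K).
have e10 : 0 < e1 by rewrite /e1 lt_min ltr01 divr_gt0.
apply: filterS2 (hz _ e10) (hw _ e10) => n h1 h2.
rewrite (_ : _ - _ = (z n - l) * (w n - m) + (l * (w n - m) + (z n - l) * m)); last by ring.
apply: (@le_trans _ _ (e1 * 1 + (cabs l * e1 + e1 * cabs m))).
  apply: cabs_add_le; first by apply: cabs_mul_le => //; apply: le_trans h2 _; rewrite /e1 ge_min lexx.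
  by apply: cabs_add_le; apply: cabs_mul_le.
rewrite (_ : _ + _ = e1 * K); last by rewrite /K; ring.
by rewrite -ler_pdivlMr// /e1 ge_min lexx orbT.
Qed.

Lemma ucvg_opp z l : ucvg z l -> ucvg (fun n => - z n) (- l).
Proof. by move=> h eta /h; apply: filterS => n; rewrite -opprD cabsN. Qed.

Lemma ucvg_conj z l : ucvg z l -> ucvg (fun n => conjc (z n)) (conjc l).
Proof. by move=> h eta /h; apply: filterS => n; rewrite -conjcB cabsJ. Qed.

Lemma ucvg_unique z l m : ucvg z l -> ucvg z m -> l = m.
Proof.
move=> hl hm; apply/eqP; rewrite -subr_eq0; apply/eqP/cabs_eq0/eqP; rewrite eq_le cabs_ge0 andbT.
apply: (@small_le _ _ _ 2) => eta e0; rewrite add0r.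
have [n [h1 h2]] := filter_ex (filterI (hl _ e0) (hm _ e0)).
rewrite (_ : l - m = (z n - m) - (z n - l)); last by ring.
by rewrite mulrC mulr2n mulrDr mulr1; apply: cabs_sub_le.
Qed.

Lemma ucvg_bound z l (B : nat -> R) : (forall n, cabs (z n) <= B n) ->
  B n @[n --> \oo] --> (0 : R) -> ucvg z l -> l = 0.
Proof.
move=> hB B0 hz; apply: ucvg_unique hz _ => eta e0; apply: eventually_ufilter.
move/cvgrPdist_le : B0 => /(_ _ e0); apply: filterS => n; rewrite sub0r normrN subr0 => h.
exact: le_trans (hB n) (le_trans (ler_norm _) h).
Qed.

Lemma ucvg_Re z l : ucvg z l -> ucvg (fun n => (complex.Re (z n))%:C) (complex.Re l)%:C.
Proof.
move=> h eta /h; apply: filterS => n; rewrite -rcB cabs_real; apply: le_trans.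
by apply: le_trans (Re_le_cabs _); rewrite ReD ReN.
Qed.

Lemma ucvg_ge0 z l : ucvg z l -> (forall n, 0 <= complex.Re (z n)) -> 0 <= complex.Re l.
Proof.
move=> h hz; rewrite -oppr_le0; apply: (@small_le _ _ _ 1) => eta e0.
have [n hn] := filter_ex (h _ e0); rewrite add0r mul1r.
have : `|complex.Re (z n - l)| <= eta by apply: le_trans (Re_le_cabs _) hn.
by rewrite ReD ReN ler_norml => /andP[_]; apply: le_trans; rewrite lerDr.
Qed.

Variables (al : R) (a0 b0 : R -> C) (K : nat -> R).

(** The bounds [K t] do not depend on j, so the ultrafilter limits are rapid. The algebraic
    relations are polynomial in the values and pass to pointwise limits, and the defects have limit
    0. *)
Lemma metric_limit :
  (forall j, exists G c d : R -> C,
  [/\ forall t, [/\ wle (bw R t) G (K t), wle (bw R t) c (K t) & wle (bw R t) d (K t)],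
      forall x, complex.Im (G x) = 0 /\ complex.Im (d x) = 0,
      forall x, [/\ 0 <= complex.Re (G x), 2^-1 <= complex.Re (d x) & G x ^+ 2 = d x ^+ 2 + 4 * (c x * conjc (c x))],
      forall x, cabs (d (x + al) * G x - d x * pull_G al a0 b0 G c x) <= 100 / 2 ^+ j &
      forall x, cabs (d (x + al) * c x - d x * pull_C al a0 b0 G c x) <= 100 / 2 ^+ j]) ->
  exists G c d : R -> C,
  [/\ [/\ rapid G, rapid c & rapid d],
      forall x, complex.Im (G x) = 0 /\ complex.Im (d x) = 0,
      forall x, [/\ 0 <= complex.Re (G x), 2^-1 <= complex.Re (d x) & G x ^+ 2 = d x ^+ 2 + 4 * (c x * conjc (c x))],
      forall x, d (x + al) * G x = d x * pull_G al a0 b0 G c x &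
      forall x, d (x + al) * c x = d x * pull_C al a0 b0 G c x].
Proof.
move=> /choice [G /choice [c /choice [d H]]].
pose lim (f : nat -> R -> C) x := ulimC (fun n => f n x).
have P (f : nat -> R -> C) : (forall n t, wle (bw R t) (f n) (K t)) ->
    rapid (lim f) /\ forall x, ucvg (fun n => f n x) (lim f x).
  move=> hf; have fB n x : cabs (f n x) <= K 0%N by apply: wle_bw_sup (hf n 0%N).
  have fL n x h : cabs (f n (x + h) - f n x) <= 8 * K 1%N * `|h| by apply: wle_lip.
  have fp n x : f n (x + 1) = f n x by apply: wle_period (hf n 0%N) x.
  split; last by move=> x eta e0; exact: ulimC_near e0.
  by move=> t; exists (K t); exact: (ulimC_wle fB fL fp).
have [rG uG] : rapid (lim G) /\ forall x, ucvg (fun n => G n x) (lim G x).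
  by apply: P => n t; have [h _ _ _ _] := H n; have [] := h t.
have [rc uc] : rapid (lim c) /\ forall x, ucvg (fun n => c n x) (lim c x).
  by apply: P => n t; have [h _ _ _ _] := H n; have [] := h t.
have [rd ud] : rapid (lim d) /\ forall x, ucvg (fun n => d n x) (lim d x).
  by apply: P => n t; have [h _ _ _ _] := H n; have [] := h t.
have cv0 : 100 / 2 ^+ n @[n --> \oo] --> (0 : R).
  rewrite (_ : (fun n => 100 / 2 ^+ n) = geometric 100 2^-1).
    by apply: cvg_geometric; rewrite ger0_norm ?invf_lt1 ?ltr1n.
  by apply/funext => n; rewrite /geometric /= exprVn.
have real (f : nat -> R -> C) x : (forall n, complex.Im (f n x) = 0) -> ucvg (fun n => f n x) (lim f x) ->
    complex.Im (lim f x) = 0.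
  move=> h hf; have := ucvg_unique hf (_ : ucvg _ (complex.Re (lim f x))%:C) => E.
  rewrite E //; have := ucvg_Re hf; congr ucvg; apply/funext => n.
  by apply: complexP => //=; rewrite h.
have uPG x : ucvg (fun n => pull_G al a0 b0 (G n) (c n) x) (pull_G al a0 b0 (lim G) (lim c) x).
  rewrite /pull_G; apply: ucvg_add; first by apply: ucvg_mul => //; exact: ucvg_cst.
  apply: ucvg_mul; first exact: ucvg_cst.
  apply: ucvg_add; first by apply: ucvg_mul; [exact: ucvg_conj|exact: ucvg_cst].
  by apply: ucvg_mul; [exact: uc|exact: ucvg_cst].
have uPC x : ucvg (fun n => pull_C al a0 b0 (G n) (c n) x) (pull_C al a0 b0 (lim G) (lim c) x).
  rewrite /pull_C; apply: ucvg_add.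
    by apply: ucvg_add; apply: ucvg_mul => //; exact: ucvg_cst.
  by apply: ucvg_mul; [exact: ucvg_conj|exact: ucvg_cst].
exists (lim G), (lim c), (lim d); split => //.
- move=> x; split; apply: real => // n; have [_ h _ _ _] := H n; by have [] := h x.
- move=> x; split.
  + by apply: ucvg_ge0 (uG x) _ => n; have [_ _ h _ _] := H n; have [] := h x.
  + have U : ucvg (fun n => d n x - (2^-1)%:C) (lim d x - (2^-1)%:C).
      by apply: ucvg_add => //; apply: ucvg_opp; exact: ucvg_cst.
    rewrite -subr_ge0 -[2^-1]/(complex.Re (2^-1)%:C) -ReN -ReD; apply: ucvg_ge0 U _ => n.
    by have [_ _ h _ _] := H n; have [_ h2 _] := h x; rewrite ReD ReN subr_ge0.
  + rewrite !expr2; apply: ucvg_unique (ucvg_mul (uG x) (uG x)) _.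
    have := ucvg_add (ucvg_mul (ud x) (ud x)) (ucvg_mul (ucvg_cst 4) (ucvg_mul (uc x) (ucvg_conj (uc x)))).
    congr ucvg; apply/funext => n; have [_ _ h _ _] := H n; have [_ _] := h x.
    by rewrite !expr2.
- move=> x; apply/eqP; rewrite -subr_eq0; apply/eqP.
  apply: (@ucvg_bound (fun n => d n (x + al) * G n x - d n x * pull_G al a0 b0 (G n) (c n) x) _ _ _ cv0).
    by move=> n; have [_ _ _ h _] := H n; exact: h.
  by apply: ucvg_add; [exact: ucvg_mul|apply: ucvg_opp; exact: ucvg_mul].
- move=> x; apply/eqP; rewrite -subr_eq0; apply/eqP.
  apply: (@ucvg_bound (fun n => d n (x + al) * c n x - d n x * pull_C al a0 b0 (G n) (c n) x) _ _ _ cv0).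
    by move=> n; have [_ _ _ _ h] := H n; exact: h.
  by apply: ucvg_add; [exact: ucvg_mul|apply: ucvg_opp; exact: ucvg_mul].
Qed.

End MetricLimit.

(** * Two-by-two matrices *)

Section TwoByTwo.
Variable R : comNzRingType.
Implicit Types A B : 'M[R]_2.

Lemma ord2P (P : 'I_2 -> Prop) : P 0 -> P 1 -> forall i, P i.
Proof.
move=> P0 P1 [[|[|m]] hm] //.
  by rewrite (_ : Ordinal hm = 0)//; exact: val_inj.
by rewrite (_ : Ordinal hm = 1)//; exact: val_inj.
Qed.

Lemma lift2 : lift ord0 ord0 = 1 :> 'I_2.
Proof. exact: val_inj. Qed.

Lemma mulmx2E A B i j : (A *m B) i j = A i 0 * B 0 j + A i 1 * B 1 j.
Proof. by rewrite mxE !big_ord_recl big_ord0 addr0 lift2. Qed.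

Lemma mx2P A B : A 0 0 = B 0 0 -> A 0 1 = B 0 1 -> A 1 0 = B 1 0 -> A 1 1 = B 1 1 -> A = B.
Proof.
move=> h1 h2 h3 h4; apply/matrixP => i j.
by move: i; apply: ord2P; move: j; apply: ord2P.
Qed.

Lemma det2 A : \det A = A 0 0 * A 1 1 - A 0 1 * A 1 0.
Proof.
rewrite (expand_det_row _ 0) !big_ord_recl big_ord0 /cofactor !det_mx11 !mxE /= addr0.
rewrite !lift2 (_ : lift 1 ord0 = 0 :> 'I_2); last exact: val_inj.
by rewrite expr0 mul1r expr1 mulN1r mulrN.
Qed.

Definition mx2 (a b c d : R) : 'M[R]_2 :=
  \matrix_(i, j) if i == 0 then (if j == 0 then a else b) else (if j == 0 then c else d).
Lemma mx2E a b c d : ((mx2 a b c d 0 0 = a) * (mx2 a b c d 0 1 = b) * (mx2 a b c d 1 0 = c) *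
  (mx2 a b c d 1 1 = d))%type.
Proof. by rewrite !mxE. Qed.
End TwoByTwo.

(** * From an invariant form to a conjugacy into SO(2) *)

Section Reducible.
Variable R : realType.
Variables (al : R) (A : circle R -> SL2 R) (E F E' D : R -> R).
Hypothesis smA : smoothT (mx_of A).
Hypotheses (sE : forall n, cdiff n E) (sF : forall n, cdiff n F) (sD : forall n, cdiff n D).
Hypotheses (pE : forall x, E (x + 1) = E x) (pF : forall x, F (x + 1) = F x) (pD : forall x, D (x + 1) = D x).
Hypotheses (D0 : forall x, 0 < D x) (E0 : forall x, 0 < E x).
Hypothesis EE' : forall x, E x * E' x = F x ^+ 2 + D x ^+ 2.
Let a x : 'M[R]_2 := A (toT x).
(** With Q the symmetric matrix of entries E, F, E' divided by D, of determinant 1, the three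
    hypotheses are the entries of A^T Q(x + al) A = Q(x). *)
Hypothesis inv00 : forall x, D x * (E (x + al) * a x 0 0 ^+ 2 + 2 * F (x + al) * a x 0 0 * a x 1 0
  + E' (x + al) * a x 1 0 ^+ 2) = D (x + al) * E x.
Hypothesis inv01 : forall x, D x * (E (x + al) * a x 0 0 * a x 0 1
  + F (x + al) * (a x 0 0 * a x 1 1 + a x 0 1 * a x 1 0) + E' (x + al) * a x 1 0 * a x 1 1) = D (x + al) * F x.
Hypothesis inv11 : forall x, D x * (E (x + al) * a x 0 1 ^+ 2 + 2 * F (x + al) * a x 0 1 * a x 1 1
  + E' (x + al) * a x 1 1 ^+ 2) = D (x + al) * E' x.

Let y x := isqrt (E x * D x).
(** The upper triangular Cholesky factor, of determinant 1, with b^T b = Q; [b'] is its inverse. *)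
Let b x := mx2 (y x * E x) (y x * F x) 0 (y x * D x).
Let b' x := mx2 (y x * D x) (- (y x * F x)) 0 (y x * E x).

Let y2 x : y x * y x = (E x * D x)^-1.
Proof. by rewrite /y isqrt_sq// mulr_gt0. Qed.

Let det_b x : y x * E x * (y x * D x) = 1.
Proof. by rewrite mulrACA y2 mulVf// mulf_neq0 ?gt_eqF. Qed.

Let bb' x : b x *m b' x = 1%:M.
Proof.
have h := det_b x.
apply: mx2P; rewrite mulmx2E !mx2E mxE ?mulr0 ?mul0r ?addr0 ?add0r//=.
  by ring.
by rewrite mulrC.
Qed.

Fact det_b1 x : \det (b x) == 1.
Proof. by rewrite det2 !mx2E mulr0 subr0 det_b. Qed.
Let Bl x : SL2 R := MkSL2 (det_b1 x).

Let Bl_inv x : ((Bl x)^-1%g : 'M[R]_2) = b' x.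
Proof.
change (invmx (b x) = b' x).
by rewrite -[LHS]mulmx1 -(bb' x) mulmxA mulVmx ?mul1mx//; exact: (SL2_unit (Bl x)).
Qed.

Let pB x : Bl (x + 1) = Bl x.
Proof. by apply: val_inj; rewrite /= /b /y pE pF pD. Qed.

Let form x : (b x)^T *m b x = mx2 (E x / D x) (F x / D x) (F x / D x) (E' x / D x).
Proof.
have Dn : D x != 0 by rewrite gt_eqF.
have En : E x != 0 by rewrite gt_eqF.
have yy := y2 x.
have E'E : E' x = (F x ^+ 2 + D x ^+ 2) / E x by rewrite -EE' mulrAC divff// mul1r.
apply: mx2P; rewrite mulmx2E ![_^T _ _]mxE !mx2E ?E'E;
  move: (y x) (E x) (F x) (D x) yy Dn En => Y e f d yy Dn En.
- by rewrite mulr0 addr0 mulrACA yy; field; rewrite Dn En.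
- by rewrite mul0r addr0 mulrACA yy; field; rewrite Dn En.
- by rewrite mulr0 addr0 mulrACA yy; field; rewrite Dn En.
- by rewrite (mulrACA Y f) (mulrACA Y d) yy; field; rewrite Dn En.
Qed.

Let invariant_form x : (a x)^T *m ((b (x + al))^T *m b (x + al)) *m a x = (b x)^T *m b x.
Proof.
rewrite !form; have D1 : D x != 0 by rewrite gt_eqF.
have D2 : D (x + al) != 0 by rewrite gt_eqF.
have i0 := inv00 x; have i1 := inv01 x; have i2 := inv11 x.
have e0 : E x / D x = (E (x + al) * a x 0 0 ^+ 2 + 2 * F (x + al) * a x 0 0 * a x 1 0
    + E' (x + al) * a x 1 0 ^+ 2) / D (x + al).
  by apply/eqP; rewrite eqr_div// [X in _ == X]mulrC i0 mulrC.
have e1 : F x / D x = (E (x + al) * a x 0 0 * a x 0 1 + F (x + al) * (a x 0 0 * a x 1 1 + a x 0 1 * a x 1 0)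
    + E' (x + al) * a x 1 0 * a x 1 1) / D (x + al).
  by apply/eqP; rewrite eqr_div// [X in _ == X]mulrC i1 mulrC.
have e2 : E' x / D x = (E (x + al) * a x 0 1 ^+ 2 + 2 * F (x + al) * a x 0 1 * a x 1 1
    + E' (x + al) * a x 1 1 ^+ 2) / D (x + al).
  by apply/eqP; rewrite eqr_div// [X in _ == X]mulrC i2 mulrC.
by apply: mx2P; rewrite !mulmx2E !mx2E ![_^T _ _]mxE ?e0 ?e1 ?e2; ring.
Qed.

Let Cl x : SL2 R := (Bl (x + al) * A (toT x) * (Bl x)^-1)%g.

Let Cl_mx x : (Cl x : 'M[R]_2) = b (x + al) *m a x *m b' x.
Proof. by rewrite -Bl_inv. Qed.

(** For C = b(x + al) A b^-1, the invariance of Q = b^T b gives C^T C = b^-T Q b^-1 = 1. *)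
Let Cl_SO2 x : SO2 (Cl x).
Proof.
change ((Cl x : 'M[R]_2) *m (Cl x : 'M[R]_2)^T = 1%:M); apply: mulmx1C; rewrite Cl_mx !trmx_mul -!mulmxA.
rewrite (mulmxA _ (b (x + al))) (mulmxA _ (_ *m b (x + al))) (mulmxA _ (a x)) invariant_form.
by rewrite -mulmxA bb' mulmx1 -trmx_mul bb' trmx1.
Qed.

Let pC x : Cl (x + 1) = Cl x.
Proof.
rewrite /Cl pB -addrA [1 + al]addrC addrA pB; congr (_ * A _ * _)%g.
by apply/toT_eq; rewrite addrC addKr.
Qed.

Let cdiff_y n : cdiff n y.
Proof. by apply: cdiff_isqrt; [move=> x; rewrite mulr_gt0|exact: cdiff_mul]. Qed.

Let cdiff_b n i j : cdiff n (fun x => b x i j).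
Proof.
move: i; apply: ord2P; move: j; apply: ord2P; under eq_fun do rewrite mx2E;
  by [exact: cdiff_cst|apply: cdiff_mul].
Qed.

Let cdiff_b' n i j : cdiff n (fun x => b' x i j).
Proof.
move: i; apply: ord2P; move: j; apply: ord2P; under eq_fun do rewrite mx2E;
  by [exact: cdiff_cst|apply: cdiff_mul|apply: cdiff_opp; apply: cdiff_mul].
Qed.

Let cdiff_mulmx n (M N : R -> 'M[R]_2) : (forall i j, cdiff n (fun x => M x i j)) ->
  (forall i j, cdiff n (fun x => N x i j)) -> forall i j, cdiff n (fun x => (M x *m N x) i j).
Proof.
move=> hM hN i j; under eq_fun do rewrite mulmx2E.
by apply: cdiff_add; exact: cdiff_mul.
Qed.

Lemma rotations_reducible_of_metric : rotations_reducible al A.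
Proof.
have sa : forall i j n, cdiff n (fun x => a x i j) by apply/smooth_mx_entries; exact: smA.
have BE z : Bl (repr (toT z)) = Bl z by exact: repr_toT.
exists (fun t => toPSL (Bl (repr t))), (fun t => Cl (repr t)); split.
(* The conjugacy has a global smooth lift of period 1 to SL2, which serves as the local lift
   everywhere. *)
- move=> x; exists Bl; apply: filterE => z; split; first by rewrite BE.
  move=> n; have /smooth_mx_entries h := fun i j n => cdiff_b n i j; exact: h.
- move=> n x; rewrite (_ : mx_of _ \o _ = fun z => b (z + al) *m a z *m b' z).
    have /smooth_mx_entries h : forall i j n, cdiff n (fun z => (b (z + al) *m a z *m b' z) i j).
      move=> i j m; apply: cdiff_mulmx => // k l; apply: cdiff_mulmx => // i' j'.
      exact: (cdiff_shift al (cdiff_b m i' j')).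
    exact: h.
  by apply/funext => z; rewrite /= /mx_of repr_toT// Cl_mx.
- by move=> t; exact: Cl_SO2.
- move=> t; have [z <-] := toT_surj t.
  by rewrite -toTD !BE repr_toT// /Cl !toPSLM toPSLV.
Qed.

End Reducible.

(** * Real matrices as complex pairs *)

Section ComplexForm.
Variable R : realType.
Local Open Scope complex_scope.
Local Notation C := R[i].

(** [mxa] and [mxb] are the coefficients of M written as w -> a w + b conj(w) on R^2 seen as the
    complex plane. *)
Definition mxa (M : 'M[R]_2) : C := (M 0 0 + M 1 1) / 2 +i* ((M 1 0 - M 0 1) / 2).
Definition mxb (M : 'M[R]_2) : C := (M 0 0 - M 1 1) / 2 +i* ((M 1 0 + M 0 1) / 2).

Lemma cabs_mxab (M : 'M[R]_2) : cabs (mxa M) ^+ 2 - cabs (mxb M) ^+ 2 = \det M.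
Proof. by rewrite !cabs_sq det2 /=; field. Qed.

(** Dictionary between the two descriptions of a form: E = G + 2 Re c, F = 2 Im c, E' = G - 2 Re
    c. *)
Lemma pull_matrix (al : R) (M : R -> 'M[R]_2) (G c : R -> C) x : complex.Im (G (x + al)) = 0 ->
  let g := complex.Re (G (x + al)) in let p := complex.Re (c (x + al)) in let q := complex.Im (c (x + al)) in
  let m i j := M x i j in
  let E1 := (g + 2 * p) * m 0 0 ^+ 2 + 2 * (2 * q) * m 0 0 * m 1 0 + (g - 2 * p) * m 1 0 ^+ 2 in
  let F1 := (g + 2 * p) * m 0 0 * m 0 1 + (2 * q) * (m 0 0 * m 1 1 + m 0 1 * m 1 0)
     + (g - 2 * p) * m 1 0 * m 1 1 in
  let E1' := (g + 2 * p) * m 0 1 ^+ 2 + 2 * (2 * q) * m 0 1 * m 1 1 + (g - 2 * p) * m 1 1 ^+ 2 in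
  pull_G al (fun x => mxa (M x)) (fun x => mxb (M x)) G c x = ((E1 + E1') / 2)%:C /\
  pull_C al (fun x => mxa (M x)) (fun x => mxb (M x)) G c x = ((E1 - E1') / 4) +i* (F1 / 2).
Proof.
move=> G0 g p q m E1 F1 E1'; rewrite /pull_G /pull_C /mxa /mxb.
rewrite /E1 /F1 /E1' /g /p /q /m.
move: G0; case: (G (x + al)) => gr gi /= ->; case: (c (x + al)) => p' q' /=.
move: (M x 0 0) (M x 0 1) (M x 1 0) (M x 1 1) => m00 m01 m10 m11.
by split; apply: complexP; rewrite !expr2 /=; field.
Qed.

Lemma reducible_of_limit_metric (al : R) (A : circle R -> SL2 R) (G c d : R -> C) :
  let a0 x := mxa (A (toT x)) in let b0 x := mxb (A (toT x)) in
  smoothT (mx_of A) -> rapid G -> rapid c -> rapid d ->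
  (forall x, complex.Im (G x) = 0 /\ complex.Im (d x) = 0) ->
  (forall x, [/\ 0 <= complex.Re (G x), 2^-1 <= complex.Re (d x) & G x ^+ 2 = d x ^+ 2 + 4 * (c x * conjc (c x))]) ->
  (forall x, d (x + al) * G x = d x * pull_G al a0 b0 G c x) ->
  (forall x, d (x + al) * c x = d x * pull_C al a0 b0 G c x) -> rotations_reducible al A.
Proof.
move=> a0 b0 sA rG rc rd im ineq eqG eqC.
have per (f : R -> C) : rapid f -> forall x, f (x + 1) = f x.
  by move=> hf; have [B h] := hf 0%N; exact: wle_period h.
pose g x := complex.Re (G x); pose p x := complex.Re (c x); pose q x := complex.Im (c x).
pose D x := complex.Re (d x).
have D0 x : 0 < D x by have [_ h _] := ineq x; apply: lt_le_trans h; rewrite invr_gt0.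
have dE x : d x = (D x)%:C by apply: complexP; [|have [] := im x].
have GE x : G x = (g x)%:C by apply: complexP; [|have [] := im x].
have sq x : g x ^+ 2 = D x ^+ 2 + 4 * (p x ^+ 2 + q x ^+ 2).
  have [_ _] := ineq x; rewrite GE dE mulcJ cabs_sq (natC R 4) -/(p x) -/(q x) !expr2 -!rcM -rcD.
  exact: complexI.
(* Positivity of the form, from G^2 = D^2 + 4|c|^2 with D > 0. *)
have gp x : `|2 * p x| < g x.
  have [g0 _ _] := ineq x; rewrite -(@ltr_pXn2r _ 2) ?nnegrE// real_normK ?num_real// sq.
  by have := D0 x => h; have : 0 < D x ^+ 2 by [rewrite exprn_gt0|]; have := sqr_ge0 (q x); nra.
have Eg x : 0 < g x + 2 * p x by have := gp x; rewrite ltr_norml => /andP[h _]; lra.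
have key x : let m i j := (A (toT x) : 'M[R]_2) i j in let y := x + al in
  let E1 := (g y + 2 * p y) * m 0 0 ^+ 2 + 2 * (2 * q y) * m 0 0 * m 1 0 + (g y - 2 * p y) * m 1 0 ^+ 2 in
  let F1 := (g y + 2 * p y) * m 0 0 * m 0 1 + (2 * q y) * (m 0 0 * m 1 1 + m 0 1 * m 1 0)
     + (g y - 2 * p y) * m 1 0 * m 1 1 in
  let E1' := (g y + 2 * p y) * m 0 1 ^+ 2 + 2 * (2 * q y) * m 0 1 * m 1 1 + (g y - 2 * p y) * m 1 1 ^+ 2 in
  [/\ D x * E1 = D y * (g x + 2 * p x), D x * F1 = D y * (2 * q x) & D x * E1' = D y * (g x - 2 * p x)].
  move=> m y E1 F1 E1'.
  have [PG PC] := pull_matrix (fun x => A (toT x)) c (im y).1.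
  have := eqG x; rewrite PG dE (dE x) GE -!rcM => /complexI e1.
  have := eqC x; rewrite PC dE (dE x) -/E1 -/F1 -/E1' => e2.
  have := congr1 (@complex.Re _) e2; have := congr1 (@complex.Im _) e2.
  rewrite !(ReM, ImM) /= !mul0r !subr0 !addr0 => e3 e4.
  rewrite -/(p x) -/(q x) in e3 e4.
  rewrite -/E1 -/E1' in e1.
  by split; move: e1 e3 e4; rewrite -/(D y); clear; move: E1 E1' F1 => *; lra.
apply: (@rotations_reducible_of_metric R al A (fun x => g x + 2 * p x) (fun x => 2 * q x) (fun x => g x - 2 * p x) D) => //.
- move=> n; apply: cdiff_add; first exact: (rapid_cdiff rG n).1.
  by apply: cdiff_scale; exact: (rapid_cdiff rc n).1.
- by move=> n; apply: cdiff_scale; exact: (rapid_cdiff rc n).2.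
- by move=> n; exact: (rapid_cdiff rd n).1.
- by move=> x; rewrite /g /p !per.
- by move=> x; rewrite /q per.
- by move=> x; rewrite /D per.
- by move=> x; have := sq x; rewrite !expr2 => h; transitivity (g x * g x - 4 * (p x * p x)); [ring|rewrite h; ring].
- by move=> x; have [] := key x.
- by move=> x; have [] := key x.
- by move=> x; have [] := key x.
Qed.

End ComplexForm.

(** * Derivative bounds and growth of the weight sequence *)

Section InitialData.
Variable R : realType.
Local Open Scope complex_scope.
Local Notation C := R[i].

(** Each difference is turned into a derivative by the mean value theorem, one at a time. *)
Lemma fdiff_chain (U : nat -> R -> R) (h : R) : (forall k (x : R), is_derive x 1 (U k) (U k.+1 x)) -> 0 < h ->
  forall s B, (forall x, `|U s x| <= B) -> forall x, `|iter s (fdiff h) (U 0%N) x| <= B * h ^+ s.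
Proof.
move=> + h0 s; elim: s U => [|s IH] U hU B hB x; first by rewrite expr0 mulr1; exact: hB.
rewrite iterSr exprS mulrA; apply: (IH (fun k => fdiff h (U k))) => [k y|y].
  have h1 := is_derive_shift_comp (hU k (y + h)); have h2 := hU k y; exact: (is_deriveB h1 h2).
have yh : y < y + h by rewrite ltrDl.
have cont : {within `[y, y + h], continuous (U s)}.
  apply: continuous_subspaceT => z; apply: differentiable_continuous.
  by apply/derivable1_diffP; exact: (@ex_derive _ _ _ _ _ _ _ (hU s z)).
have [c _ E] := MVT yh (fun z _ => hU s z) cont.
rewrite /fdiff E addrC addKr normrM (gtr0_norm h0); apply: ler_wpM2r; first exact: ltW.
exact: hB.
Qed.

Lemma fdiff_lin (V : zmodType) (W : zmodType) (L : {additive V -> W}) (h : R) (f : R -> V) s x :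
  L (iter s (fdiff h) f x) = iter s (fdiff h) (L \o f) x.
Proof. by elim: s x => //= s IH x; rewrite /fdiff raddfB !IH. Qed.

Lemma mx_entry_norm (M : 'M[R]_2) i j : `|M i j| <= `|M|.
Proof.
change (`|M i j| <= mx_norm M); rewrite mx_normrE; exact: (le_bigmax _ (fun ij => `|M ij.1 ij.2|) (i, j)).
Qed.

Lemma norm_Mr_derive (V : normedModType R) (M : nat -> R) (r eps : R) (f : circle R -> V) :
  (forall s, 0 < M s) -> 0 < r -> (norm_Mr M r f <= eps%:E)%E ->
  forall s x, `|derive1n s (f \o @toT R) x| <= eps * M s / r ^+ s.
Proof.
move=> M0 r0 hn s x; set v := `|_|.
have c1 : 1 <= 4 * pi ^+ 2 / 3 :> R by have := pi_ge2 R; nra.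
pose k := (1 + s%:R) ^+ 2 * r ^+ s.
have k0 : 0 < k by rewrite mulr_gt0 ?exprn_gt0// ltr_wpDr.
have h1 : (k%:E * v%:E * ((M s)^-1)%:E <= ereal_sup
   [set (((1 + s%:R) ^+ 2 * r ^+ s)%:E * C0_norm (derive1n s (f \o @toT R)) * ((M s)^-1)%:E)%E | s in [set: nat]])%E.
  apply: (@le_trans _ _ (k%:E * C0_norm (derive1n s (f \o @toT R)) * ((M s)^-1)%:E)%E); last first.
    by apply: ereal_sup_ubound; exists s.
  apply: lee_wpmul2r; first by rewrite lee_fin invr_ge0 ltW.
  apply: lee_wpmul2l; first by rewrite lee_fin ltW.
  by apply: ereal_sup_ubound; exists x.
have h2 : (((4 * pi ^+ 2) / 3)%:E * (k%:E * v%:E * ((M s)^-1)%:E) <= eps%:E)%E.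
  apply: le_trans hn; apply: lee_wpmul2l => //; rewrite lee_fin; exact: le_trans c1.
rewrite -!EFinM lee_fin in h2.
rewrite ler_pdivlMr ?exprn_gt0// -ler_pdivrMr//; apply: le_trans h2.
have kv : v * r ^+ s / M s <= k * v / M s.
  rewrite ler_pM2r ?invr_gt0// mulrC; apply: ler_wpM2r; first exact: normr_ge0.
  by rewrite /k ler_peMl ?exprn_ge0 ?(ltW r0)// exprn_ege1// lerDl.
apply: le_trans kv _; rewrite ler_peMl//; apply: mulr_ge0; last by rewrite invr_ge0 ltW.
by apply: mulr_ge0; [exact: ltW|exact: normr_ge0].
Qed.

(** (H2) says that ln M_(s+1) - ln M_s is o(s), so ln M_s grows more slowly than any multiple of
    s^2; along multiples of 4 the chosen rate is t^2 ln 2. *)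
Lemma wfun_growth (M : nat -> R) : (forall s, 0 < M s) ->
  (s%:R^-1 * ln (M s.+1 / M s) : R) @[s --> \oo] --> (0 : R) ->
  exists C0 : R, 0 < C0 /\ forall t, M (4 * t)%N <= C0 * 2 ^+ (t * t).
Proof.
move=> M0 /cvgrPdist_le H; pose c : R := ln 2 / 22.
have l2 : 0 < ln 2 :> R by rewrite ln_gt0// ltr1n.
have c0 : 0 < c by rewrite divr_gt0.
have [s0 _ hs0] := H _ c0.
have step s : (s0 <= s)%N -> (0 < s)%N -> ln (M s.+1) <= ln (M s) + c * s%:R.
  move=> s0s sp; have := hs0 s s0s; rewrite /= sub0r normrN => h.
  have sR : (0 : R) < s%:R by rewrite ltr0n.
  have h2 := le_trans (ler_norm _) h.
  rewrite mulrC ler_pdivrMr// ln_div ?posrE// in h2; by rewrite -lerBlDl.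
pose t0 := s0.+1.
(* Four steps from 4t to 4t+4 cost c (16 t + 6) <= 22 c t, whence c = ln 2 / 22. *)
have step4 t : (t0 <= t)%N -> ln (M (4 * t.+1)%N) <= ln (M (4 * t)%N) + ln 2 * t%:R.
  move=> tt; have tp : (0 < t)%N by apply: leq_trans tt.
  have H4 (i : nat) : (i < 4)%N -> ln (M (4 * t + i).+1) <= ln (M (4 * t + i)%N) + (4 * (c * t%:R) + c * i%:R).
    move=> i4; have := @step (4 * t + i)%N; rewrite natrD natrM mulrDr mulrCA.
    by apply; move: tt tp; rewrite /t0; lia.
  have := H4 0%N isT; have := H4 1%N isT; have := H4 2%N isT; have := H4 3%N isT.
  rewrite !addn0 !addnS !addn0 (_ : 4 * t.+1 = (4 * t).+4)%N; last by lia.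
  have t1 : 1 <= t%:R :> R by rewrite ler1n.
  have cE : ln 2 = 22 * c by rewrite /c; field.
  have ct : c <= c * t%:R by rewrite ler_peMr// ltW.
  rewrite cE -(mulrA 22) mulr1 mulr0; move: ct; move: (c * t%:R) => ct.
  move: (ln _) (ln _) (ln _) (ln _) (ln _) => l4 l3 l2' l1 l0.
  clearbody c; clear; move=> *; lra.
pose K : R := \big[Num.max/0]_(i < t0.+1) `|ln (M (4 * i)%N)|.
exists (expR K); split; first exact: expR_gt0.
have K0 : 0 <= K by rewrite /K; elim/big_rec : _ => // i x _ x0; rewrite le_max x0 orbT.
have small t : (t <= t0)%N -> ln (M (4 * t)%N) <= K.
  move=> tt; apply: le_trans (ler_norm _) _; rewrite -ltnS in tt.
  exact: (le_bigmax _ (fun i : 'I_t0.+1 => `|ln (M (4 * i)%N)|) (Ordinal tt)).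
have big t : ln (M (4 * t)%N) <= K + ln 2 * (t * t)%:R.
  elim: t => [|t IH]; first by rewrite mulr0 addr0; exact: small.
  have [tt|tt] := leqP t.+1 t0.
    by apply: le_trans (small _ tt) _; rewrite lerDl mulr_ge0// ltW.
  apply: le_trans (step4 t tt) _.
  have : ln 2 * (t * t)%:R + ln 2 * t%:R <= ln 2 * (t.+1 * t.+1)%:R :> R.
    by rewrite -mulrDr ler_pM2l// -natrD ler_nat; lia.
  by move: IH; lra.
move=> t; rewrite -(lnK (_ : M (4 * t)%N \is Num.pos)) ?posrE//.
rewrite -[X in _ <= _ * X]lnK ?posrE ?exprn_gt0// -expRD ler_expR.
by rewrite lnXn// -[ln 2 *+ _]mulr_natr; exact: big.
Qed.

End InitialData.

(** * The initial weighted norm *)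

Section InitialWeight.
Variable R : realType.
Local Open Scope complex_scope.
Local Notation C := R[i].
Implicit Types (i j m : nat) (k : int).

Lemma irangeS m : perm_eq (irange m.+1) (m.+1%:Z :: - m.+1%:Z :: irange m).
Proof.
apply: uniq_perm; first exact: irange_uniq.
  by rewrite cons_uniq cons_uniq irange_uniq andbT in_cons !mem_irange; apply/andP; split; lia.
by move=> k; rewrite mem_irange in_cons in_cons mem_irange; apply/idP/idP; lia.
Qed.

(** The series of 1/(k(k+1)) telescopes; the induction keeps its partial sums 1 - 1/(m+1), once for
    each sign of k. *)
Lemma sum_irange_le (F : int -> R) (B c : R) m : F 0 <= B -> 0 <= c ->
  (forall k, k != 0 -> F k <= c / (`|k|%:R * (`|k|%:R + 1))) ->
  \sum_(k <- irange m) F k <= B + 2 * c.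
Proof.
move=> F0 c0 Fk.
suff H : \sum_(k <- irange m) F k <= B + 2 * c * (1 - m.+1%:R^-1).
  apply: le_trans H _; rewrite lerD2l -[leRHS]mulr1; apply: ler_wpM2l; first by rewrite mulr_ge0.
  by rewrite gerBl invr_ge0.
elim: m => [|m IH].
  have -> : 1 - 1%:R^-1 = 0 :> R by rewrite invr1 subrr.
  by rewrite /irange /= big_seq1 subrr mulr0 addr0.
rewrite (perm_big _ (irangeS m)); move: (irange m) IH => l IH; rewrite /= !big_cons addrA.
have h1 := Fk m.+1%:Z isT; have h2 := Fk (- m.+1%:Z) isT.
rewrite abszN in h2; move: h1 h2; rewrite absz_nat natr1 => h1 h2.
have E : c / (m.+1%:R * m.+2%:R) = c * m.+1%:R^-1 - c * m.+2%:R^-1.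
  rewrite -mulrBr; congr (c * _); rewrite -[m.+2%:R]natr1.
  have : 0 < m.+1%:R :> R by rewrite ltr0n.
  by move: (m.+1%:R : R) => A A0; field; rewrite !gt_eqF ?addr_gt0.
rewrite E in h1 h2; move: IH h1 h2.
move: (F _) (F _) (\sum_(_ <- _) _) (m.+1%:R^-1) (m.+2%:R^-1) => f1 f2 f3 y1 y2; lra.
Qed.

Variables (n s : nat -> nat).
Hypothesis s1 : forall i, (0 < s i)%N.
Hypothesis growth : forall i, (16 * s i.+1 * 2 ^ n i <= 2 ^ n i.+1)%N.
Hypothesis sums : forall i, (\sum_(i' < i.+2) s i' <= n i)%N.

Lemma wgt_recl j k : wgt R n s j k <= wfac R n s j k * wgt R n s j.+1 k.
Proof.
apply: wgt_le => J; have [jJ|jJ] := ltnP j J.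
  rewrite /wprod big_ltn//; apply: ler_wpM2l; first exact: le_trans (wfac_ge1 _ _ _ _ _).
  exact: wprod_wgt.
by rewrite /wprod big_geq//; apply: mulr_ege1; [exact: wfac_ge1|exact: wgt_ge1].
Qed.

Lemma scales_unbounded i : (i <= n i)%N.
Proof.
elim: i => // i IH; apply: leq_ltn_trans IH _.
rewrite -(ltn_exp2l _ _ (isT : (1 < 2)%N)); apply: leq_trans (growth i).
by have := s1 i.+1; have : (0 < 2 ^ n i)%N by [rewrite expn_gt0|]; nia.
Qed.

(** Let j be the first index with n_j > m. The factors before j contribute at most 2^((m+1) s_i)
    each, and the s_i up to j sum to at most n_(j-1) <= m; from j on, |k| <= 2^(n_j) and the
    remaining product is bounded. The weight grows only like |k|^(log |k|). *)
Lemma wgt0_bound k m : (`|k| <= 2 ^ m)%N ->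
  wgt R n s 0 k <= expR 1 * 2 ^+ s 0%N * 2 ^+ (m.+1 * m).
Proof.
move=> km; have kR : `|k%:~R| <= 2 ^+ m :> R by rewrite -intr_norm -natr_absz -natrX ler_nat.
have ex : exists j, (m < n j)%N by exists m.+1; exact: scales_unbounded.
pose j := ex_minn ex.
have [mj minj] : (m < n j)%N /\ forall i, (i < j)%N -> (n i <= m)%N.
  rewrite /j; case: ex_minnP => j' h1 h2; split => // i ij; rewrite leqNgt; apply/negP => /h2.
  by rewrite leqNgt ij.
have prod : wgt R n s 0 k <= 2 ^+ (m.+1 * \sum_(i < j) s i) * wgt R n s j k.
  elim: {mj minj}j => [|j' IH]; first by rewrite big_ord0 muln0 mul1r.
  apply: le_trans IH _; rewrite big_ord_recr /= mulnDr exprD -mulrA.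
  apply: ler_wpM2l; first exact: exprn_ge0.
  apply: le_trans (wgt_recl j' k) _; apply: ler_wpM2r; first exact: le_trans (wgt_ge1 _ _ _ _ _).
  rewrite exprM /wfac; apply: lerXn2r; rewrite ?nnegrE ?exprn_ge0 ?addr_ge0 ?divr_ge0 ?exprn_ge0//.
  rewrite exprS (_ : 2 * _ = 2 ^+ m + 2 ^+ m :> R); last by ring.
  apply: lerD; first by rewrite exprn_ege1// ler1n.
  by rewrite ler_pdivrMr ?exprn_gt0//; apply: le_trans kR _; rewrite ler_peMr ?exprn_ge0// exprn_ege1// ler1n.
have k2 : `|k%:~R| / 2 ^+ n j <= 1 :> R.
  by rewrite ler_pdivrMr ?exprn_gt0// mul1r; apply: le_trans kR _; rewrite ler_weXn2l ?ler1n// ltnW.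
have tail : wgt R n s j k <= 2 ^+ s j * expR 1.
  apply: le_trans (wgt_ub R s1 growth j k) _; apply: ler_pM.
  - exact: le_trans (wfac_ge1 _ _ _ _ _).
  - exact: expR_ge0.
  - rewrite /wfac; apply: lerXn2r; rewrite ?nnegrE ?addr_ge0 ?divr_ge0 ?exprn_ge0//.
    by rewrite [leRHS]mulr2n lerD2l.
  - rewrite ler_expR ler_pdivrMr// mul1r; apply: le_trans k2 _; by rewrite ler1n.
apply: le_trans prod _; apply: le_trans (ler_wpM2l (exprn_ge0 _ (ler0n _ 2)) tail) _.
rewrite mulrA -exprD -[leRHS]mulrA -exprD mulrC ler_pM2l ?expR_gt0// ler_weXn2l ?ler1n//.
have S0 := sums; case Ej: j mj minj => [|j'] mj minj; first by rewrite big_ord0 muln0 leq_addr.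
have := minj j' (ltnSn _); have := sums j'; rewrite big_ord_recr /=.
set t := (\sum_(_ < _) _)%N; clear; move: t (s j'.+1) (n j') (s 0%N) => *; nia.
Qed.

(** For 2^(m-1) <= |k| < 2^m the difference of order 4m is used. It gains 2^(4m^2), against the
    growth 2^(m^2) of M_(4m) and the weight 2^(m^2 + m). *)
Lemma initial_wle (M : nat -> R) (r C0 eps : R) (R0 : nat) (f : R -> C) :
  (forall i, 0 < M i) -> 0 < r -> r^-1 <= 2 ^+ R0 -> 0 < C0 ->
  (forall t, M (4 * t)%N <= C0 * 2 ^+ (t * t)) -> 0 <= eps -> (forall x, f (x + 1) = f x) ->
  (forall i h x, 0 < h -> cabs (iter i (fdiff h) f x) <= 2 * (eps * M i / r ^+ i) * h ^+ i) ->
  wle (wgt R n s 0) f (eps * (2 * M 0%N +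
    2 * (2 * C0 * 2 ^+ ((4 * R0 + 3) * (4 * R0 + 3)) * (expR 1 * 2 ^+ s 0%N)))).
Proof.
move=> M0 r0 rR C00 hM e0 fp hf.
pose mk k := (trunc_log 2 `|k|).+1.
pose C3 := 2 * C0 * 2 ^+ ((4 * R0 + 3) * (4 * R0 + 3)).
have C30 : 0 <= C3 by rewrite !mulr_ge0 ?exprn_ge0 ?(ltW C00).
pose cb k : R := if k == 0 then 2 * (eps * M 0%N) else
  eps * C3 / (`|k|%:R * (`|k|%:R + 1) * 2 ^+ ((mk k).+1 * mk k)).
have W := wgt_weight R s1 growth 0; have [w00 _ _ _] := W.
have mkP k : k != 0 -> (2 ^ mk k <= 2 * `|k|)%N /\ (`|k| < 2 ^ mk k)%N.
  move=> k0; have kp : (0 < `|k|)%N by rewrite absz_gt0.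
  by have /andP[h1 h2] := trunc_log_bounds (isT : (1 < 2)%N) kp; rewrite /mk; split => //; rewrite expnS leq_pmul2l.
have kR k : k != 0 -> 0 < `|k|%:R :> R by move=> k0; rewrite ltr0n absz_gt0.
apply: (@wle_interpolation _ _ _ _ (2 ^+ n 0%N) (fun i => 2 * (eps * M i / r ^+ i)) cb) => //.
- by move=> k; exact: weight_ge0 W.
- move=> k; apply: le_trans (brk_gek _ k) _.
  by have := brk_wgt R s1 growth k (leqnn 0) (s1 0%N); rewrite expr1 muln1.
- by rewrite /cb eqxx expr0 divr1.
(* The surplus 2m^2 absorbs the factor r^(-4m) and the summation factor k(k+1), at the cost of the
   constant 2^((4 R0 + 3)^2). *)
- move=> k k0; exists (4 * mk k)%N; have [h1 h2] := mkP k k0; have K0 := kR k k0.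
  rewrite /cb (negbTE k0); move: (mk k) h1 h2 => m h1 h2.
  pose t := M (4 * m)%N / r ^+ (4 * m); pose d : R := `|k|%:R * (`|k|%:R + 1) * 2 ^+ (m.+1 * m).
  have E1 : t <= C0 * 2 ^+ (m * m) * 2 ^+ (R0 * (4 * m)).
    rewrite /t -exprVn; apply: ler_pM; rewrite ?(ltW (M0 _)) ?exprn_ge0 ?invr_ge0 ?(ltW r0)//.
    by rewrite [leRHS]exprM; apply: lerXn2r; rewrite ?nnegrE ?exprn_ge0 ?invr_ge0 ?(ltW r0).
  have E2 : d <= 2 ^+ (m + m + m.+1 * m).
    rewrite /d exprD; apply: ler_wpM2r; first exact: exprn_ge0.
    rewrite exprD; apply: ler_pM; rewrite ?addr_ge0// -?natrX ?natr1 ler_nat//; exact: ltnW.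
  have E3 : 2 ^+ (m * (4 * m)) <= (2 * `|k%:~R|) ^+ (4 * m) :> R.
    rewrite exprM; apply: lerXn2r; rewrite ?nnegrE ?exprn_ge0 ?mulr_ge0//.
    by rewrite -intr_norm -natr_absz -natrM -natrX ler_nat.
  have D0 : 0 < d.
    by rewrite !mulr_gt0 ?exprn_gt0// ltr_wpDl.
  rewrite [leRHS]mulrAC ler_pdivlMr// -/d.
  rewrite (_ : 2 * _ * d = eps * (2 * t * d)); last by rewrite /t -(mulrA eps); ring.
  rewrite -[leRHS]mulrA; apply: ler_wpM2l => //.
  apply: (@le_trans _ _ (C3 * 2 ^+ (m * (4 * m)))); last by apply: ler_wpM2l.
  apply: (@le_trans _ _ (2 * (C0 * 2 ^+ (m * m) * 2 ^+ (R0 * (4 * m))) * 2 ^+ (m + m + m.+1 * m))).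
    apply: ler_pM; rewrite ?(ltW D0) ?ler_pM2l//.
    by rewrite !mulr_ge0 ?invr_ge0 ?exprn_ge0 ?(ltW r0) ?(ltW (M0 _)).
  rewrite /C3 -!mulrA ler_pM2l// ler_pM2l// -!exprD ler_weXn2l ?ler1n//.
  by clear; move: m => m; nia.
- move=> m; rewrite mulrDr mulrCA [eps * (2 * _)]mulrCA; apply: sum_irange_le.
  + by rewrite /cb eqxx w00 mulr1.
  + by rewrite !mulr_ge0 ?expR_ge0 ?exprn_ge0 ?(ltW C00).
  + move=> k k0; rewrite /cb (negbTE k0); have K0 := kR k k0; have [_ h2] := mkP k k0.
    have H := wgt0_bound (ltnW h2); move: (mk k) H => m' H.
    have P0 : 0 < 2 ^+ (m'.+1 * m') :> R by rewrite exprn_gt0.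
    have A0 : 0 < `|k|%:R + 1 :> R by rewrite ltr_wpDl.
    apply: le_trans (ler_wpM2l _ H) _.
      by apply: divr_ge0; [exact: mulr_ge0|apply/ltW; rewrite !mulr_gt0].
    rewrite le_eqVlt; apply/orP; left; apply/eqP; rewrite -/C3.
    by field; rewrite !gt_eqF.
Qed.

End InitialWeight.

(** * Growth requirements on the scales *)

Section ScaleParameters.
Implicit Types (i : nat).
Variables (n r : nat -> nat) (S g : nat).
Let s i := (5 * (S * (i + 100)))%N.
Let P := (400 * (S * S) + 20 + g)%N.
Hypothesis S0 : (0 < S)%N.
Hypothesis n0 : (P * (101 * 101) <= n 0)%N.
Hypothesis nr : forall i, (6 * n i <= 5 * r i)%N.
Hypothesis rn : forall i, (r i <= n i.+1)%N.

(** n grows by 6/5 at least at each step, and (i+101)^2 by 6/5 at most. Since the s_i are linear in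
    i, a quadratic lower bound on n_i with a large constant yields all the requirements below. *)
Lemma scales_quadratic i : (P * ((i + 101) * (i + 101)) <= n i)%N.
Proof.
elim: i => [|i IH]; first by rewrite add0n.
have h : (5 * ((i.+1 + 101) * (i.+1 + 101)) <= 6 * ((i + 101) * (i + 101)))%N by clear; nia.
have h2 : (5 * (P * ((i.+1 + 101) * (i.+1 + 101))) <= 6 * (P * ((i + 101) * (i + 101))))%N.
  by rewrite !(mulnCA _ P) leq_mul2l h orbT.
by move: (nr i) (rn i) IH h2; clear; move: (P * _)%N (P * _)%N => *; lia.
Qed.

Let PS : (400 * (S * S) <= P)%N. Proof. by rewrite /P; clear; lia. Qed.

Lemma scales_linear i c : (c * S * (i + 101) <= 400 * (S * S) * ((i + 101) * (i + 101)))%N ->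
  (c * S * (i + 101) <= n i)%N.
Proof.
move=> h; apply: leq_trans h (leq_trans _ (scales_quadratic i)).
by rewrite leq_mul2r PS orbT.
Qed.

Lemma scales_growth i : (16 * s i.+1 * 2 ^ n i <= 2 ^ n i.+1)%N.
Proof.
have h : (400 * S * (i + 101) <= n i)%N.
  by apply: scales_linear; move: S0; clear; nia.
have h2 : (16 * s i.+1 <= n i.+1 - n i)%N.
  by rewrite /s; move: h (nr i) (rn i); clear; nia.
have h3 : (n i <= n i.+1)%N by move: (nr i) (rn i); clear; lia.
rewrite -[X in (_ <= 2 ^ X)%N](subnK h3) expnD leq_mul2r; apply/orP; right.
by apply: leq_trans h2 (ltnW (ltn_expl _ _)).
Qed.

Lemma scales_power i : ((8 * s i) ^ s i <= 2 ^ n i)%N.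
Proof.
apply: (@leq_trans ((2 ^ (8 * s i)) ^ s i)).
  by rewrite leq_exp2r; [exact: ltnW (ltn_expl _ _)|rewrite /s; move: S0; clear; nia].
rewrite -expnM leq_exp2l//; apply: leq_trans (scales_quadratic i); apply: leq_trans (leq_mul PS (leqnn _)).
by rewrite /s; clear; nia.
Qed.

Lemma scales_sum i : (\sum_(i' < i.+2) s i' <= n i)%N.
Proof.
apply: (@leq_trans (i.+2 * s i.+1)).
  rewrite -[X in (_ <= X * _)%N]card_ord -sum_nat_const; apply: leq_sum => k _.
  by rewrite /s leq_mul2l leq_mul2l leq_add2r -ltnS ltn_ord !orbT.
apply: leq_trans (scales_quadratic i); apply: leq_trans (leq_mul PS (leqnn _)).
by rewrite /s; move: S0; clear; nia.
Qed.

Lemma scales_large i : (12 + i + g <= n i)%N.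
Proof.
apply: leq_trans (scales_quadratic i); rewrite /P; clear.
by apply: (@leq_trans ((20 + g) * (i + 101))); [nia|rewrite mulnA; nia].
Qed.

End ScaleParameters.

(** * The initial cocycle in complex form *)

Section InitialCocycle.
Variable R : realType.
Local Open Scope complex_scope.
Local Notation C := R[i].

Lemma fdiff_comb (W : R -> 'M[R]_2) (c eps h : R) (i j k l : 'I_2) s :
  (forall m (x : R), derivable (derive1n m W) x 1) -> 0 < h -> `|c| = 1 ->
  (forall x, `|derive1n s W x| <= eps) ->
  forall x, `|iter s (fdiff h) (fun y => (W y i j + c * W y k l) / 2) x| <= eps * h ^+ s.
Proof.
move=> hW h0 c1 hB; pose U m x := (derive1n m W x i j + c * derive1n m W x k l) / 2.
have D m i' j' (x : R) : is_derive x 1 (fun y => derive1n m W y i' j') (derive1n m.+1 W x i' j').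
  have dv := hW m x; rewrite derive1nS derive1E derive_mx// mxE; apply: derivableP.
  by have /derivable_mxP := dv; exact.
apply: (@fdiff_chain _ U h) => // [m x|x].
  rewrite /U; have h1 := D m i j x; have h2 := D m k l x.
  rewrite [X in is_derive _ _ X _](_ : _ = (fun y => 2^-1 * (derive1n m W y i j + c * derive1n m W y k l))).
    rewrite mulrC; apply: (is_deriveZ 2^-1); apply: is_deriveD; exact: (is_deriveZ c).
  by apply/funext => y; rewrite mulrC.
rewrite /U normrM [`|2^-1|]ger0_norm// ler_pdivrMr// mulr2n mulrDr mulr1.
apply: le_trans (ler_normD _ _) _; rewrite normrM c1 mul1r.
by apply: lerD; apply: le_trans (mx_entry_norm _ _ _) (hB x).
Qed.

Lemma fdiff_ReIm (h : R) (f : R -> C) s x :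
  complex.Re (iter s (fdiff h) f x) = iter s (fdiff h) (fun y => complex.Re (f y)) x /\
  complex.Im (iter s (fdiff h) f x) = iter s (fdiff h) (fun y => complex.Im (f y)) x.
Proof.
elim: s x => //= s IH x; rewrite /fdiff !(ReD, ImD) !(ReN, ImN).
by have [-> ->] := IH x; have [-> ->] := IH (x + h).
Qed.

Lemma fdiff_mxab (W : R -> 'M[R]_2) (eps h : R) s :
  (forall m (x : R), derivable (derive1n m W) x 1) -> 0 < h ->
  (forall x, `|derive1n s W x| <= eps) -> forall x,
  cabs (iter s (fdiff h) (fun y => mxa (W y)) x) <= 2 * eps * h ^+ s /\
  cabs (iter s (fdiff h) (fun y => mxb (W y)) x) <= 2 * eps * h ^+ s.
Proof.
move=> hW h0 hB x; have n1 : `|1| = 1 :> R by rewrite normr1.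
have nN1 : `|-1| = 1 :> R by rewrite normrN1.
have K c i j k l (u : R -> R) : `|c| = 1 -> (forall y, u y = (W y i j + c * W y k l) / 2) ->
    `|iter s (fdiff h) u x| <= eps * h ^+ s.
  by move=> c1 uE; rewrite (_ : u = fun y => (W y i j + c * W y k l) / 2); [exact: fdiff_comb|exact/funext].
rewrite (_ : 2 * eps * h ^+ s = eps * h ^+ s + eps * h ^+ s); last by ring.
split; apply: cabs_ReIm_le; rewrite (fdiff_ReIm _ _ _ _).1 || rewrite (fdiff_ReIm _ _ _ _).2.
- by apply: (K 1 0 0 1 1 _ n1) => y; rewrite mul1r.
- by apply: (K (-1) 1 0 0 1 _ nN1) => y; rewrite mulN1r.
- by apply: (K (-1) 0 0 1 1 _ nN1) => y; rewrite mulN1r.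
- by apply: (K 1 1 0 0 1 _ n1) => y; rewrite mul1r.
Qed.

(** |a|^2 + |b|^2 is half the sum of the squared entries, hence 1 for a rotation, and |a|^2 - |b|^2
    is the determinant 1. *)
Lemma SO2_mxab (Q : SL2 R) : SO2 Q -> cabs (mxa Q) = 1 /\ mxb Q = 0.
Proof.
move=> hQ; have d := SL2_det Q; have ab := cabs_mxab Q; rewrite d in ab.
have e0 : Q 0 0 ^+ 2 + Q 0 1 ^+ 2 = 1.
  by have /matrixP /(_ 0 0) := hQ; rewrite mulmx2E !mxE !expr2.
have e1 : Q 1 0 ^+ 2 + Q 1 1 ^+ 2 = 1.
  by have /matrixP /(_ 1 1) := hQ; rewrite mulmx2E !mxE !expr2.
have ab2 : cabs (mxa Q) ^+ 2 + cabs (mxb Q) ^+ 2 = 1.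
  rewrite !cabs_sq /=; rewrite (_ : _ + _ = ((Q 0 0 ^+ 2 + Q 0 1 ^+ 2) + (Q 1 0 ^+ 2 + Q 1 1 ^+ 2)) / 2); last by field.
  by rewrite e0 e1; field.
have b0 : cabs (mxb Q) ^+ 2 = 0 by lra.
have a1 : cabs (mxa Q) ^+ 2 = 1 by lra.
split; last by apply: cabs_eq0; apply/eqP; move/eqP: b0; rewrite expf_eq0.
by apply/eqP; rewrite -(@eqrXn2 _ 2 (cabs _) 1) ?cabs_ge0// a1 expr1n.
Qed.

End InitialCocycle.

(** * Initial rotation number and Diophantine data *)

Section RotationData.
Variable R : realType.
Local Open Scope complex_scope.

(** The moving direction is W(x, y) = e(y) and the lift is [psi] itself, so the integral defining
    the fibered rotation number is I0. *)
Lemma rotates_of_lift (al : R) (A : circle R -> SL2 R) (psi u : circle R * circle R -> R)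
    (mu : probability (borel_torus2 R) R) :
  continuous psi -> (forall z, 0 < u z) ->
  (forall (x : circle R) (y : R), A x *m dir y = u (x, toT y) *: dir (y + psi (x, toT y))) ->
  rotates al psi mu (\int[mu]_z psi z) (fun x => mxa (A (toT x))) (fun x => mxb (A (toT x))).
Proof.
move=> cpsi u0 hA.
have ep y : e (y + 1) = e y :> R[i] by rewrite eD e1 mulr1.
have er y : e (repr (toT y)) = e y :> R[i] by exact: repr_toT.
have cl : continuous (fun x : R => 2 * pi * x) by apply: contM; [exact: cont_cst|exact: cont_id].
have cc (f : R -> R) : continuous f -> (forall y, f (y + 1) = f y) ->
    continuous (fun z : circle R * circle R => f (repr z.2)).
  move=> cf fp z; apply: (@continuous_comp _ _ _ snd (fun c : circle R => f (repr c)) z).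
    exact: cvg_snd.
  exact: circle_continuous.
exists (fun z => e (repr z.2)), psi; split; split => //.
- apply: (cc (fun y => complex.Re (e y))) => [|y]; last by rewrite ep.
  exact: (cont_comp (@continuous_cos R) cl).
- apply: (cc (fun y => complex.Im (e y))) => [|y]; last by rewrite ep.
  exact: (cont_comp (@continuous_sin R) cl).
- by move=> z; rewrite cabs_e.
- move=> x y; exists (u (toT x, y)) => //.
  have := hA (toT x) (repr y); rewrite (_ : toT (repr y) = y); last by rewrite /toT reprK.
  move=> /matrixP h; have := h 0 0; have := h 1 0; rewrite !mxE !big_ord_recl !big_ord0 !mxE /= !lift2 !addr0.
  move=> h1 h0; rewrite -[RHS]mulrA -eD [psi _ + _]addrC.
  apply: complexP; rewrite /e /cis /mxa /mxb /= !mul0r ?subr0 ?addr0.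
    by rewrite -h0; field.
  by rewrite -h1; field.
- move=> z; rewrite /torus_map /= (_ : z.2 + toT (psi z) = toT (repr z.2 + psi z)).
    by rewrite er eD mulrC.
  by rewrite toTD /toT reprK.
Qed.

Lemma dist_int_le (x : R) (j : int) : dist_int x <= `|x - j%:~R|.
Proof. by apply: ge_inf; [exists 0 => _ [i _ <-]|exists j]. Qed.

Lemma diophantine_power (gamma tau d : R) (T : nat) (k : int) : 0 < gamma -> tau <= T%:R ->
  gamma * bracket R k `^ (- tau) <= d -> gamma <= d * brk R k ^+ T.
Proof.
move=> g0 tT; have b1 : 1 <= bracket R k := brk_ge1 R k.
have b0 : 0 < bracket R k by exact: lt_le_trans b1.
move=> h; have d0 : 0 <= d by apply: le_trans h; rewrite mulr_ge0 ?powR_ge0 ?(ltW g0).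
move: h; rewrite powRN ler_pdivrMr ?powR_gt0// => h; apply: le_trans h _.
apply: ler_wpM2l => //; rewrite -powR_mulrn ?(ltW b0)//; exact: ler_powR.
Qed.

Lemma small_divisor (x d D : R) : 0 <= D -> (forall p : int, d <= `|x - p%:~R| * D) ->
  2 * d <= cabs (e x - 1 : R[i]) * D.
Proof.
move=> D0 h; have [p hp] := nearest_int x.
apply: le_trans (ler_wpM2l (ler0n _ 2) (h p)) _.
by rewrite mulrA; apply: ler_wpM2r => //; exact: cabs_eB1_ge.
Qed.

End RotationData.

(** * Choice of the smallness and assembly of the scheme *)

Unset Implicit Arguments.
Theorem theorem1p2 (R : realType) (M : nat -> R)
  (M_gt0 : forall s, 0 < M s)
  (H1 : forall k l s : nat, (k < l)%N -> (l < s)%N ->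
     M l ^+ (s - k) < M k ^+ (s - l) * M s ^+ (l - k))
  (H2 : (s%:R^-1 * ln (M s.+1 / M s) : R) @[s --> \oo] --> (0 : R))
  (r tau gamma : R) (r_gt0 : 0 < r) (tau_gt1 : 1 < tau)
  (gamma_gt0 : 0 < gamma) :
  exists2 eps : R, 0 < eps &
    forall (alpha : R) (A : circle R -> SL2 R),
      irrational alpha ->
      U_Mr M r (mx_of A) ->
      (exists2 Rot : SL2 R, SO2 Rot &
         (norm_Mr M r (fun x => (mx_of A x - SL2_val Rot)%R) <= eps%:E)%E) ->
      forall rho : R,
        fibered_rotation_number alpha A (toT rho) ->
        (forall k : int,
           gamma * bracket R k `^ (- tau) <= dist_int (k%:~R * alpha + 2 * rho)
        /\ gamma * bracket R k `^ (- tau)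
             <= dist_int (k%:~R * alpha - 2 * rho)) ->
        rotations_reducible alpha A.
Proof.
(* T is an integer exponent above tau, N = 4T the power of q lost in [scale_step], and S the step of
   the linearly growing orders s_i. *)
pose T := (Num.trunc tau).+1; pose N := (4 * T)%N; pose S := (N + 100)%N.
have tT : tau <= T%:R by exact: ltW (truncnS_gt tau).
pose gam := Num.min gamma 1.
have gam0 : 0 < gam by rewrite /gam lt_min gamma_gt0 ltr01.
have gam1 : gam <= 1 by rewrite /gam ge_min lexx orbT.
have pow_gt (x : R) : exists g : nat, x <= 2 ^+ g.
  exists (Num.trunc x).+1; apply: le_trans (ltW (truncnS_gt x)) _.
  by rewrite -natrX ler_nat ltnW// ltn_expl.
have [g hg] := pow_gt gam^-1; have [R0 rR0] := pow_gt r^-1.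
have [C0 [C00 hC0]] := wfun_growth M_gt0 H2.
(* The quadratic lower bound on the scales, at index 0; the term g secures 2^(-g) <= gam. *)
pose k0 := ((400 * (S * S) + 20 + g) * (101 * 101))%N.
pose s i := (5 * (S * (i + 100)))%N.
pose Bc : R := 2 * M 0%N + 2 * (2 * C0 * 2 ^+ ((4 * R0 + 3) * (4 * R0 + 3)) * (expR 1 * 2 ^+ s 0%N)).
have Bc0 : 0 < Bc.
  apply: addr_gt0; first exact: mulr_gt0.
  apply: mulr_gt0 => //; apply: mulr_gt0; apply: mulr_gt0.
  - exact: mulr_gt0.
  - exact: exprn_gt0.
  - exact: expR_gt0.
  - exact: exprn_gt0.
(* Chosen so that eps Bc <= 2^(-n_0 100 S), the size required at stage 0. The scales depend on alpha
   and rho, but n_0 <= 2 k0 holds for all of them, so eps does not. *)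
pose eps := ((2 : R) ^+ (2 * k0 * (S * 100)))^-1 / Bc.
have eps0 : 0 < eps by rewrite divr_gt0// invr_gt0 exprn_gt0.
exists eps => // alpha A _ [smA _] [Rot hRot hnorm] rho [psi [u [mu [cpsi [cu u0] hdir [hinv _] rhoE]]]] dio.
have gd (l j : int) : gam <= `|l%:~R * alpha - 2 * rho - j%:~R| * brk R l ^+ T.
  apply: (@le_trans _ _ gamma); first by rewrite /gam ge_min lexx.
  apply: diophantine_power gamma_gt0 tT _; apply: le_trans (dio l).2 _; exact: dist_int_le.
have k020 : (20 <= k0)%N by rewrite /k0; clear; nia.
have [n [rr [q [[nk n2k nr rn nn] [q0 qn sd1 sd2]]]]] := scale_sequence gam0 gd k020.
have S0 : (0 < S)%N by rewrite /S addn_gt0 orbT.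
have s1 i : (0 < s i)%N by rewrite /s !muln_gt0 S0 addn_gt0 orbT.
have growth := scales_growth S0 nk nr rn.
have exps := scales_power S0 nk nr rn.
have sums := scales_sum S0 nk nr rn.
have big i : 2 ^+ (12 + i) <= gam * 2 ^+ n i.
  apply: (@le_trans _ _ (gam * 2 ^+ (12 + i + g))); last first.
    by rewrite ler_pM2l// ler_weXn2l ?ler1n//; exact: (scales_large nk nr rn).
  rewrite (exprD _ (12 + i)) mulrCA ler_peMr ?exprn_ge0//.
  by rewrite -ler_pdivrMl// mulr1.
have TN : (T < N)%N by rewrite /N ltn_Pmull.
have NS : (N + 100 <= S)%N by [].
pose W x : 'M[R]_2 := mx_of A (toT x) - SL2_val Rot.
have Wsm (m : nat) (x : R) : derivable (derive1n m W) x 1.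
  suff /smooth_mx_entries h : forall i j m, cdiff m (fun x => W x i j) by exact: h.
  move=> i j m'; have /smooth_mx_entries hA := smA.
  under eq_fun do rewrite !mxE.
  by apply: cdiff_sub; [exact: hA|exact: cdiff_cst].
have Wb i (x : R) : `|derive1n i W x| <= eps * M i / r ^+ i by exact: norm_Mr_derive hnorm i x.
have Wp x : W (x + 1) = W x.
  by rewrite /W; congr (mx_of A _ - _); apply/toT_eq; rewrite addrAC subrr add0r.
have hWa : wle (wgt R n s 0) (fun x => mxa (W x)) (eps * Bc).
  apply: (initial_wle s1 growth sums M_gt0 r_gt0 rR0 C00 hC0 (ltW eps0)) => [x|i h x h0].
    by rewrite Wp.
  exact: (fdiff_mxab Wsm h0 (Wb i) x).1.
have hWb : wle (wgt R n s 0) (fun x => mxb (W x)) (eps * Bc).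
  apply: (initial_wle s1 growth sums M_gt0 r_gt0 rR0 C00 hC0 (ltW eps0)) => [x|i h x h0].
    by rewrite Wp.
  exact: (fdiff_mxab Wsm h0 (Wb i) x).2.
pose dl := ((2 ^+ n 0%N)^-1 : R) ^+ (S * (0 + 100)).
have dle : eps * Bc <= dl.
  rewrite /eps mulfVK ?gt_eqF// /dl exprVn lef_pV2 ?posrE ?exprn_gt0// -exprM.
  by rewrite ler_weXn2l ?ler1n// add0n leq_mul2r n2k orbT.
have [kap1 rb0] := SO2_mxab hRot; pose kap := mxa Rot.
have w0 k : 0 <= wgt R n s 0 k by apply: le_trans (wgt_ge1 R s1 growth 0 k).
pose z0 x := (conjc kap * mxa (W x))%C.
have hz : wle (wgt R n s 0) z0 dl.
  by apply: wle_mono dle _; apply: wle_unit; rewrite ?cabsJ.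
pose a0 x := mxa (A (toT x)); pose b0 x := mxb (A (toT x)).
have aE x : a0 x = kap * (1 + z0 x).
  rewrite mulrDr mulr1 /z0 mulrA mulcJ kap1 expr1n mul1r.
  by apply: complexP; rewrite /a0 /kap /mxa /W !mxE /=; field.
have bE x : mxb (W x) = b0 x.
  by rewrite -[RHS]subr0 -rb0; apply: complexP; rewrite /b0 /mxb /W !mxE /=; field.
have hb : wle (wgt R n s 0) b0 dl by apply: eq_wle bE _; exact: wle_mono dle hWb.
have wt0 := wgt_weight R s1 growth 0.
have dl1 : dl <= 1.
  by rewrite exprn_ile1 ?invr_ge0 ?exprn_ge0// invf_le1 ?exprn_gt0// exprn_ege1// ler1n.
have a2 x : cabs (a0 x) <= 2.
  rewrite aE cabsM kap1 mul1r; apply: cabs_add_le; first by rewrite cabs1.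
  exact: le_trans (wle_sup x wt0 hz) dl1.
have b1 x : cabs (b0 x) <= 1 by exact: le_trans (wle_sup x wt0 hb) dl1.
have dab x : cabs (a0 x) ^+ 2 - cabs (b0 x) ^+ 2 = 1 by rewrite cabs_mxab SL2_det.
pose I0 := \int[mu]_z psi z.
have hrot : rotates alpha psi mu I0 a0 b0 by exact: rotates_of_lift.
have eI : e I0 = e rho :> R[i].
  have /toT_eq /intrP [p hp] := rhoE; rewrite -(subrK I0 rho) hp eD e_int mul1r.
  by [].
have u01 : cabs (e I0 : R[i]) = 1 by exact: cabs_e.
have sd1' i (l : int) : l != 0 -> (`|l| < q i)%N ->
    gam / 4 <= cabs (e (l%:~R * alpha) - 1 : R[i]) * (`|l%:~R| ^+ T * 2 ^+ n i).
  move=> l0 lq; rewrite (_ : gam / 4 = 2 * (gam / 8)); last by field.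
  by apply: small_divisor => [|p]; [rewrite mulr_ge0 ?exprn_ge0|exact: sd1].
have sd2' i (l : int) : (`|l| <= 2 ^ rr i)%N ->
    gam <= cabs (e (l%:~R * alpha) - (e I0) ^+ 2 : R[i]) * (q i)%:R ^+ N.
  move=> lr; rewrite eI.
  have -> : cabs (e (l%:~R * alpha) - (e rho) ^+ 2 : R[i]) = cabs (e (l%:~R * alpha - 2 * rho) - 1 : R[i]).
    rewrite (_ : e (l%:~R * alpha) - _ = e (2%:R * rho) * (e (l%:~R * alpha - 2 * rho) - 1)).
      by rewrite cabsM cabs_e mul1r.
    by rewrite mulrBr mulr1 -eD [2%:R * rho + _]addrC subrK (_ : 2%:R * rho = rho + rho) ?eD ?expr2//; ring.
  rewrite (_ : gam = 2 * (gam / 2)); last by field.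
  by apply: small_divisor => [|p]; [rewrite exprn_ge0|exact: sd2].
have init := kam_state0 alpha gam0 gam1 TN NS growth big kap1 aE hz hb hrot.
have states j : kam_state alpha (rotates alpha psi mu I0) a0 b0 n N S gam j.
  elim: j => [|j IH]; first exact: init.
  exact: (kam_state_next (rotates_rt cpsi hinv) (rotates_cj cpsi hinv) (@rotates_near _ _ _ _ _) u01
    gam0 gam1 TN NS nr rn nn growth exps big q0 qn sd1' sd2' IH).
have defect j := kam_invariant_defect gam0 gam1 TN NS growth big dab a2 b1 (states j).
have [G [c [d [[rG rc rd] im ineq eqG eqC]]]] :=
  metric_limit (K := fun t => 4 * 2 ^+ (t * n t)) defect.
exact: reducible_of_limit_metric smA rG rc rd im ineq eqG eqC.
Qed.
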